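(* Let $(X_n)_{n\le0}$ be an $\mathbb{R}^d$-valued strongly monotonic Markov process which is identifiable, and let $\mathcal{F}$ be its natural filtration. Then the following are equivalent: $\mathcal{F}$ is Kolmogorovian; for every $n\le0$, $\mathcal{L}(X_n\mid\mathcal{F}_{-\infty})=\mathcal{L}(X_n)$ a.s.; $\mathcal{F}$ is standard; $\mathcal{L}(X_0\mid\mathcal{F}_{-\infty})=\mathcal{L}(X_0)$ a.s.
   Context: $d\ge1$ integer or $d=\infty$; $A_n$ support of the law of $X_n$; $\mathcal F_n=\sigma(X_m;m\le n)$, $\mathcal F_{-\infty}=\bigcap_n\mathcal F_n$; Kolmogorovian: $\mathcal F_{-\infty}$ trivial. Standard: a filtration generated by a copy of $(X_n)$ is immersed (i.e. contained, with $\mathcal F_{n+1}$ conditionally independent of the bigger $\sigma$-field at time $n$ given $\mathcal F_n$) in a filtration generated by independent random variables. Identifiable: for each $n$, $x\mapsto\mathcal{L}(X_n\mid X_{n-1}=x)$ is injective. Monotonic: for each $n<0$, $x,x'\in A_n$ there is a coupling $(Y,Y')$ of $\mathcal{L}(X_{n+1}\mid X_n=x)$ and $\mathcal{L}(X_{n+1}\mid X_n=x')$, depending measurably on $(x,x')$, with $x(k)\le x'(k)\Rightarrow Y(k)\le Y'(k)$ a.s. and $x(k)\ge x'(k)\Rightarrow Y(k)\ge Y'(k)$ a.s. for all $k$. Strongly monotonic: monotonic, each coordinate process $(X_n(k))$ Markovian, and its natural filtration immersed in $\mathcal F$. *)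

(* Defs.v *)
From HB Require Import structures.
From mathcomp Require Import all_boot all_order all_algebra.
From mathcomp Require Import all_classical all_reals all_analysis measurable_realfun.
Set Implicit Arguments. Unset Strict Implicit. Unset Printing Implicit Defensive.
Import Order.TTheory GRing.Theory Num.Theory.
Local Open Scope classical_set_scope.
Local Open Scope ring_scope.

Inductive dimension := dfin of nat | dinf.

Definition Idx (d : dimension) : Type := match d with dfin n => 'I_n | dinf => nat end.

Definition Rvec (R : realType) (d : dimension) := Idx d -> R.
HB.instance Definition _ (R : realType) (d : dimension) := gen_eqMixin (Rvec R d).
HB.instance Definition _ (R : realType) (d : dimension) := gen_choiceMixin (Rvec R d).
HB.instance Definition _ (R : realType) d :=
  isPointed.Build (Rvec R d) (fun _ => 0%R).

(** product (= Borel) sigma-algebra on R^d: generated by the coordinates *)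
Definition coord_sets (R : realType) d : set (set (Rvec R d)) :=
  [set A | exists k (B : set R), measurable B /\ A = (fun x => x k) @^-1` B].

Definition Rd (R : realType) d : measurableType _ :=
  g_sigma_algebraType (@coord_sets R d).

Section Defs.
Context (R : realType) (dO : measure_display) (O : measurableType dO)
        (P : probability O R).

Definition natfilt {dT} {T : measurableType dT} (X : int -> O -> T) (n : int)
  : set (set O) :=
  <<s [set A | exists m : int, m <= n /\
        exists2 B : set T, measurable B & A = X m @^-1` B] >>.

Definition tailf (F : int -> set (set O)) : set (set O) :=
  [set A | forall n : int, n <= 0 -> F n A].

Definition kolmogorovian (F : int -> set (set O)) : Prop :=
  forall A, tailf F A -> P A = 0%E \/ P A = 1%E.

Definition sub_measurable (G : set (set O)) (f : O -> R) : Prop :=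
  forall U : set R, measurable U -> G (f @^-1` U).

Definition cexp_version (G : set (set O)) (h f : O -> R) : Prop :=
  [/\ sub_measurable G f, P.-integrable setT (EFin \o f) &
      forall A, G A -> (\int[P]_(w in A) (f w)%:E = \int[P]_(w in A) (h w)%:E)%E].

Definition cond_indep (A B C : set (set O)) : Prop :=
  forall a b, A a -> B b ->
  forall f g, cexp_version C (\1_a) f -> cexp_version C (\1_b) g ->
    cexp_version C (\1_(a `&` b)) (f \* g).

Definition immersed (F G : int -> set (set O)) : Prop :=
  (forall n : int, n <= 0 -> F n `<=` G n) /\
  (forall n : int, n < 0 -> cond_indep (F (n + 1)) (G n) (F n)).

Definition cond_law_version {dT} {T : measurableType dT} (G : set (set O))
  (Y : O -> T) (K : O -> {measure set T -> \bar R}) : Prop :=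
  [/\ forall w, K w [set: T] = 1%E,
      forall B : set T, measurable B -> forall U : set (\bar R), measurable U ->
        G ((fun w => K w B) @^-1` U) &
      forall A (B : set T), G A -> measurable B ->
        P (A `&` Y @^-1` B) = (\int[P]_(w in A) K w B)%E].

Definition cond_law_is_law {dT} {T : measurableType dT} (G : set (set O))
  (Y : O -> T) : Prop :=
  exists K : O -> {measure set T -> \bar R}, cond_law_version G Y K /\
    {ae P, forall w, forall B : set T, measurable B -> K w B = P (Y @^-1` B)}.

Definition markov_with {dT} {T : measurableType dT} (X : int -> O -> T)
  (K : int -> R.-pker T ~> T) : Prop :=
  (forall n : int, n <= 0 -> measurable_fun setT (X n)) /\
  (forall n : int, n < 0 ->
     cond_law_version (natfilt X n) (X (n + 1)) (fun w => K n (X n w))).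

Definition markov {dT} {T : measurableType dT} (X : int -> O -> T) : Prop :=
  exists K : int -> R.-pker T ~> T, markov_with X K.

End Defs.

Section RdDefs.
Context (R : realType) (d : dimension) (dO : measure_display) (O : measurableType dO)
        (P : probability O R).

(** x belongs to the support A_n of the law of Y (product topology on R^d:
    every basic open neighbourhood of x has positive probability) *)
Definition in_support (Y : O -> Rd R d) (x : Rd R d) : Prop :=
  forall (J : set (Idx d)) (e : R), finite_set J -> 0 < e ->
    (0 < P [set w | forall k, J k -> (`|Y w k - x k| < e)%R])%E.

Definition identifiable (X : int -> O -> Rd R d)
  (K : int -> R.-pker (Rd R d) ~> (Rd R d)) : Prop :=
  forall n : int, n < 0 -> forall x x',
    in_support (X n) x -> in_support (X n) x' ->
    (forall B, measurable B -> K n x B = K n x' B) -> x = x'.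

Definition monotonic (X : int -> O -> Rd R d)
  (K : int -> R.-pker (Rd R d) ~> (Rd R d)) : Prop :=
  forall n : int, n < 0 ->
  exists C : R.-pker (Rd R d * Rd R d)%type ~> (Rd R d * Rd R d)%type,
  forall x x', in_support (X n) x -> in_support (X n) x' ->
    [/\ forall B, measurable B -> C (x, x') (B `*` setT) = K n x B,
        forall B, measurable B -> C (x, x') (setT `*` B) = K n x' B &
        forall k : Idx d,
          (x k <= x' k -> C (x, x') [set p | p.1 k <= p.2 k] = 1%E) /\
          (x' k <= x k -> C (x, x') [set p | p.2 k <= p.1 k] = 1%E)].

Definition strongly_monotonic (X : int -> O -> Rd R d)
  (K : int -> R.-pker (Rd R d) ~> (Rd R d)) : Prop :=
  [/\ monotonic X K,
      forall k : Idx d, markov P (fun n w => X n w k) &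
      forall k : Idx d,
        immersed P (natfilt (fun n w => X n w k)) (natfilt X)].

End RdDefs.

Definition same_law (R : realType) {dT} {T : measurableType dT}
  {d1} {O1 : measurableType d1} (P1 : probability O1 R) (X1 : int -> O1 -> T)
  {d2} {O2 : measurableType d2} (P2 : probability O2 R) (X2 : int -> O2 -> T)
  : Prop :=
  forall (s : seq int) (B : int -> set T),
    (forall n, n \in s -> (n <= 0)%R) -> (forall n, measurable (B n)) ->
    P1 (\bigcap_(n in [set` s]) X1 n @^-1` B n) =
    P2 (\bigcap_(n in [set` s]) X2 n @^-1` B n).

Definition mutually_independent (R : realType) {dO} {O : measurableType dO}
  (P : probability O R) (xi : int -> O -> R) : Prop :=
  forall (s : seq int) (B : int -> set R), uniq s ->
    (forall n, n \in s -> (n <= 0)%R) -> (forall n, measurable (B n)) ->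
    P (\bigcap_(n in [set` s]) xi n @^-1` B n) =
    (\prod_(n <- s) P (xi n @^-1` B n))%E.

Definition standard (R : realType) {dT} {T : measurableType dT}
  {dO} {O : measurableType dO} (P : probability O R) (X : int -> O -> T) : Prop :=
  exists (d' : measure_display) (O' : measurableType d') (P' : probability O' R)
         (X' : int -> O' -> T) (xi : int -> O' -> R),
    [/\ forall n : int, (n <= 0)%R -> measurable_fun setT (X' n),
        forall n : int, (n <= 0)%R -> measurable_fun setT (xi n),
        same_law P X P' X',
        mutually_independent P' xi &
        immersed P' (natfilt X') (natfilt xi)].

(* Main.v *)
Require Import Defs.
From HB Require Import structures.
From mathcomp Require Import all_boot all_order all_algebra.
From mathcomp Require Import all_classical all_reals all_analysis measurable_realfun.
From mathcomp Require Import ring lra.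
Import Order.TTheory GRing.Theory Num.Theory.
Import numFieldNormedType.Exports.
Set Implicit Arguments. Unset Strict Implicit. Unset Printing Implicit Defensive.
Local Open Scope classical_set_scope.
Local Open Scope ring_scope.

(** Write [F_n] for the natural filtration and [T_n] for "[X_n] is independent of the
    tail"; by the Markov property the tail is trivial iff all [T_n] hold.

    Couple [X], after adjoining independent uniform noise, with a chain [Z] which is
    restarted at a time [a] independently of the past and then moves jointly with [X]
    by the monotone coupling. Then [Z_n] has the law of [X_n], is independent of [F_a],
    and [Z] and [X] are built from uniform innovations [V_n], each independent of the
    past. The order of [X_n(k)] and [Z_n(k)], once it is decided at time [s = a + 1],
    persists; so if [E = {Z_s(k) < X_s(k)}] then
    [P(X_b(k) > t >= Z_b(k)) = P(E, X_b(k) > t) - P(E, Z_b(k) > t)]. Under [T_b] both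
    terms are asymptotically [P(E) P(X_b(k) > t)] as [a] tends to [-oo] (backward
    martingale convergence), hence [Z_b] converges to [X_b].

    [T_(n+1)] implies [T_n]: the convergence at time [n + 1] entails that of the
    conditional probabilities [K_n(Z_n, {y(k) > t})] to [K_n(X_n, {y(k) > t})]. These
    functions separate the points of the support of [X_n]: if they agree at [x] and
    [x'], the two coordinates of the monotone coupling have the same marginals and are
    ordered, hence equal, so that the two laws coincide and [x = x'] by
    identifiability. Thus they generate the Borel sets up to null sets, [Z_n]
    converges to [X_n], and independence of [Z_n] from the tail passes to the limit.

    If the tail is trivial, blocks of such couplings, with lengths chosen recursively,
    are concatenated; then [X_n] is a.s. a function of the innovations up to time [n].
    Conversely the tail of a filtration immersed in that of an independent sequence is
    trivial by Kolmogorov's zero-one law. *)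

(** * Laws, products and kernels *)

(** Two asymmetries shape the coupling. The restarted chain moves by [Z_(n+1) = g(Z_n, V_(n+1))],
    without looking at [X], because [Z] has to be a function of the innovations alone once blocks
    are used to generate [X]; then [X_(n+1)] is a function of [X_n], [Z_n] and the same innovation.
    On the given space [X] is already there, so an innovation cannot be chosen beforehand: it is
    sampled afterwards, from its conditional law given the past and [X_(n+1)], and this sampling
    consumes the extra uniform variables. The limits are uniform: [P(A and E) - P(A) P(E)] is small
    over all events [E] of a remote past. For [A = {X_b in B}] the maximizing [E] is a superlevel
    set of an iterated kernel at [X_s]; as [Z] has the same kernels after time [s] and the same law
    at [s], the bound for [X] also holds for [Z]. Convergence of [Z_n] to [X_n] means that
    [P(X_n in B, Z_n not in B)] tends to 0 for every Borel [B]. Since the laws agree, such sets [B]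
    form a sigma-algebra, so that generators suffice, in infinite dimension too. *)

Section measures_from_functions.
Local Open Scope ereal_scope.
Context {R : realType}.

Lemma preim_measurable d1 d2 (T1 : measurableType d1) (T2 : measurableType d2)
    (f : T1 -> T2) (B : set T2) :
  measurable_fun setT f -> measurable B -> measurable (f @^-1` B).
Proof. by move=> mf mB; rewrite -[X in measurable X]setTI; exact: mf. Qed.

Section to_prob.
Context d (T : measurableType d) (m : set T -> \bar R).
Hypotheses (m0 : m set0 = 0) (mge0 : forall A, 0 <= m A)
  (ms : semi_sigma_additive m) (m1 : m setT = 1).

(** The hypotheses are arguments of the function, so that the structures declared below are attached
    to a head constant from which they can be inferred. *)
Definition to_prob_fun & m set0 = 0 & (forall A, 0 <= m A) &
  semi_sigma_additive m & m setT = 1 := m.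

HB.instance Definition _ := isMeasure.Build d T R
  (to_prob_fun m0 mge0 ms m1) m0 mge0 ms.

HB.instance Definition _ := Measure_isProbability.Build d T R
  (to_prob_fun m0 mge0 ms m1) m1.

Definition to_prob : probability T R := to_prob_fun m0 mge0 ms m1.

End to_prob.

Definition law d1 d2 (T1 : measurableType d1) (T2 : measurableType d2)
    (P : probability T1 R) (f : T1 -> T2) (mf : measurable_fun setT f) :
  probability T2 R :=
  let f' : {mfun T1 >-> T2} := HB.pack f (isMeasurableFun.Build _ _ _ _ _ mf) in
  distribution P f'.

Lemma lawE d1 d2 (T1 : measurableType d1) (T2 : measurableType d2)
    (P : probability T1 R) (f : T1 -> T2) (mf : measurable_fun setT f) A :
  law P mf A = P (f @^-1` A).
Proof. by []. Qed.

Lemma ge0_integral_law d1 d2 (T1 : measurableType d1) (T2 : measurableType d2)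
    (P : probability T1 R) (f : T1 -> T2) (mf : measurable_fun setT f)
    (D : set T2) (h : T2 -> \bar R) :
  measurable D -> measurable_fun setT h -> (forall y, 0 <= h y) ->
  \int[law P mf]_(y in D) h y = \int[P]_(x in f @^-1` D) h (f x).
Proof.
move=> mD mh h0.
rewrite (@eq_measure_integral _ _ _ D (pushforward P f)) => [|A mA AD].
  by rewrite ge0_integral_pushforward//; exact: measurable_funTS.
by [].
Qed.

Lemma measure_eq_pi d (T : measurableType d) (G : set (set T))
    (m1 m2 : {measure set T -> \bar R}) :
  @measurable _ T = <<s G >> -> setI_closed G -> G setT ->
  (forall A, G A -> m1 A = m2 A) -> m1 setT < +oo ->
  forall A, measurable A -> m1 A = m2 A.
Proof.
move=> mG GI GT m12 mfin A mA.
apply: (measure_unique G (fun _ : nat => setT)) => //.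
by apply/seteqP; split => // x _; exists 0%N.
Qed.

Lemma measure_eq_rect d1 d2 (T1 : measurableType d1) (T2 : measurableType d2)
    (m1 m2 : {measure set (T1 * T2) -> \bar R}) :
  (forall A B, measurable A -> measurable B -> m1 (A `*` B) = m2 (A `*` B)) ->
  m1 setT < +oo ->
  forall W, measurable W -> m1 W = m2 W.
Proof.
move=> m12 fin W mW.
apply: (measure_eq_pi (@measurable_prod_measurableType _ _ T1 T2)) => //.
- move=> _ _ [A mA [B mB <-]] [A' mA' [B' mB' <-]].
  by exists (A `&` A'); [exact: measurableI|exists (B `&` B');
    [exact: measurableI|rewrite setXI]].
- by exists setT => //; exists setT => //; rewrite setXTT.
- by move=> _ [A mA [B mB <-]]; exact: m12.
Qed.

Lemma prob_eq_rect d1 d2 (T1 : measurableType d1) (T2 : measurableType d2)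
    (P1 P2 : probability (T1 * T2)%type R) :
  (forall A B, measurable A -> measurable B -> P1 (A `*` B) = P2 (A `*` B)) ->
  forall W, measurable W -> P1 W = P2 W.
Proof.
move=> P12; apply: measure_eq_rect => //.
exact: le_lt_trans (probability_le1 P1 measurableT) (ltry _).
Qed.

Section kernel_product.
Context d1 d2 (S : measurableType d1) (T : measurableType d2)
  (P : probability S R) (k : R.-pker S ~> T).

(** Law of a pair whose first coordinate has law [P] and whose second is drawn from [k] at the
    first. It turns the monotone coupling kernel into a joint law of two successive states of both
    chains. *)
Definition kprod_fun (W : set (S * T)) := \int[P]_s k s (xsection W s).

Let kprod0 : kprod_fun set0 = 0.
Proof. by rewrite /kprod_fun integral0_eq// => s _; rewrite xsection0. Qed.

Let kprod_ge0 A : 0 <= kprod_fun A.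
Proof. exact: integral_ge0. Qed.

Let kprod_sigma_additive : semi_sigma_additive kprod_fun.
Proof.
move=> F mF tF mUF.
rewrite [X in _ --> X](_ : _ = \sum_(n <oo) kprod_fun (F n)).
  apply/cvg_closeP; split; last by rewrite closeE.
  by apply: is_cvg_nneseries => n _ _; exact: kprod_ge0.
rewrite -integral_nneseries//; last first.
  by move=> n; apply: (measurable_fun_xsection_finite_kernel k); rewrite inE.
apply: eq_integral => x _; apply/esym/cvg_lim => //=; rewrite xsection_bigcup.
apply: (measure_sigma_additive _ (trivIset_xsection tF)) => ?.
exact: measurable_xsection.
Qed.

Let kprodT : kprod_fun setT = 1.
Proof.
rewrite /kprod_fun (eq_integral (cst 1)).
  by rewrite integral_cst// mul1e; exact: (probability_setT P).
move=> s _ /=; rewrite (_ : xsection _ _ = setT); first exact: prob_kernel.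
by apply/seteqP; split => // y _; rewrite /xsection /= in_setT.
Qed.

Definition kprod : probability (S * T)%type R :=
  to_prob kprod0 kprod_ge0 kprod_sigma_additive kprodT.

Lemma kprodE W : kprod W = \int[P]_s k s (xsection W s).
Proof. by []. Qed.

Lemma kprodX A B : measurable A -> measurable B ->
  kprod (A `*` B) = \int[P]_(s in A) k s B.
Proof.
move=> mA mB; rewrite kprodE [RHS]integral_mkcond; apply: eq_integral => s _.
rewrite patchE; case: ifPn => sA; first by rewrite in_xsectionX.
by rewrite notin_xsectionX// measure0.
Qed.

End kernel_product.

End measures_from_functions.

Section lam_def.
Context {R : realType}.
Let U : probability (measurableTypeR R) R := uniform_prob (@ltr01 R).

(* [uniform_prob] lives on [measurableTypeR R], whose display differs from the one of [R]. *)
Definition lam : probability R R := @to_prob R _ R U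
  (measure0 U) (measure_ge0 U) (@measure_semi_sigma_additive _ _ _ U)
  (probability_setT U).

End lam_def.

Section probability_product.
Local Open Scope ereal_scope.
Context {R : realType} d1 d2 (T1 : measurableType d1) (T2 : measurableType d2).
Context (P1 : probability T1 R) (P2 : probability T2 R).

Definition pprod : probability (T1 * T2)%type R := (P1 \x P2).

Lemma pprodE W : pprod W = \int[P1]_x P2 (xsection W x).
Proof. by []. Qed.

Lemma pprodX A B : measurable A -> measurable B ->
  pprod (A `*` B) = P1 A * P2 B.
Proof. exact: product_measure1E. Qed.

End probability_product.

Section lam_facts.
Local Open Scope ereal_scope.
Context {R : realType}.

Lemma lam_le (c : R) : (0 <= c <= 1)%R -> lam [set u : R | (u <= c)%R] = c%:E.
Proof.
move=> /andP[c0 c1].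
have mc : measurable [set u : R | (u <= c)%R].
  by rewrite -set_itvNyc; exact: measurable_itv.
transitivity (\int[uniform_prob (@ltr01 R)]_u (\1_[set u : R | (u <= c)%R] u)%:E).
  by rewrite integral_indic// setIT.
rewrite [LHS]integral_uniform//=; last exact/measurable_EFinP/measurable_indic.
rewrite subr0 invr1 mul1e integral_indic//=.
rewrite (_ : _ `&` _ = `[0%R, c]%classic).
  rewrite lebesgue_measure_itv/=; case: ifPn.
    by rewrite lte_fin EFinN sube0.
  by rewrite lte_fin -leNgt => c0'; congr EFin; apply/eqP; rewrite eq_le c0 c0'.
apply/seteqP; split=> x /=; rewrite !in_itv/=.
  by move=> [xc /andP[-> _]].
by move=> /andP[x0 xc]; split => //; rewrite x0 (le_trans xc).
Qed.

End lam_facts.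

Local Open Scope ereal_scope.

(** * Conditional laws, slices and densities *)

Section integral_conditional.
Import HBNNSimple.
Context {R : realType} dO dS dT (O : measurableType dO) (S : measurableType dS)
  (T : measurableType dT) (P : probability O R) (k : R.-pker S ~> T)
  (x : O -> S) (mx : measurable_fun setT x) (Y : O -> T) (mY : measurable_fun setT Y)
  (E : set O) (mE : measurable E).
Hypothesis PE : forall B, measurable B ->
  P (E `&` Y @^-1` B) = \int[P]_(w in E) k (x w) B.

Let mk (h : T -> \bar R) : measurable_fun setT h -> (forall y, 0 <= h y) ->
  measurable_fun setT (fun w => \int[k (x w)]_y h y).
Proof.
move=> mh h0; apply: (measurableT_comp (f := fun s => \int[k s]_y h y)) => //.
by apply: measurable_fun_integral_kernel => // U mU; exact: measurable_kernel.
Qed.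

Let nnsfun_case (f : {nnsfun T >-> R}) :
  \int[P]_(w in E) (f (Y w))%:E = \int[P]_(w in E) \int[k (x w)]_y (f y)%:E.
Proof.
have mYf r : measurable (Y @^-1` (f @^-1` [set r])) by exact: preim_measurable.
under eq_integral do rewrite fimfunE -fsumEFin//.
rewrite ge0_integral_fsum//; last 2 first.
- move=> r; apply/measurable_EFinP/measurable_funTS; apply: measurable_funM => //.
  exact: (measurable_indic (mYf r)).
- by move=> r w _; rewrite EFinM nnfun_muleindic_ge0.
under [RHS]eq_integral.
  move=> w _.
  under eq_integral.
    by move=> y _; rewrite fimfunE -fsumEFin//; over.
  rewrite /= ge0_integral_fsum//; last 2 first.
    - by move=> r; exact/measurable_EFinP/measurableT_comp.
    - by move=> r y _; rewrite EFinM nnfun_muleindic_ge0.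
  under eq_fsbigr.
    move=> r _.
    rewrite (integralZl_indic _ (fun r => f @^-1` [set r]))//; last first.
      by move=> r0; rewrite preimage_nnfun0.
    rewrite integral_indic// setIT.
    over.
  over.
have mkf r : measurable_fun setT (fun w => k (x w) (f @^-1` [set r])).
  by exact: (measurableT_comp (measurable_kernel k _ _) mx).
rewrite /= [RHS]ge0_integral_fsum//; last 2 first.
- by move=> r; apply: measurable_funTS; apply: measurable_funeM.
- by move=> r w _; apply: (mulemu_ge0 (fun r => f @^-1` [set r])) => r0; rewrite preimage_nnfun0.
apply: eq_fsbigr => r _.
have [r0|r0] := leP 0%R r; last first.
  rewrite preimage_nnfun0//.
  rewrite [LHS]integral0_eq; last by move=> w _; rewrite indic0 mulr0.
  by rewrite integral0_eq// => w _; rewrite measure0 mule0.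
under [LHS]eq_integral do rewrite EFinM.
rewrite [LHS]ge0_integralZl//; last first.
  by apply/measurable_EFinP/measurable_funTS; exact: (measurable_indic (mYf r)).
rewrite [RHS]ge0_integralZl//; last exact: measurable_funTS.
congr (_ * _); rewrite -PE//.
apply: etrans (integral_indic P mE (mYf r)) _.
by rewrite setIC.
Qed.

(** [PE] is the case of indicators. Linearity gives simple functions, and monotone convergence, for
    the inner kernel integral as well as for the outer one, gives the general case. *)
Lemma integral_conditional (h : T -> \bar R) : measurable_fun setT h ->
  (forall y, 0 <= h y) ->
  \int[P]_(w in E) h (Y w) = \int[P]_(w in E) \int[k (x w)]_y h y.
Proof.
move=> mh h0; pose f_ := nnsfun_approx measurableT mh.
have fh y : EFin (f_ n y) @[n --> \oo] --> h y by exact: cvg_nnsfun_approx.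
have nd y : nondecreasing_seq (fun n => (f_ n y)%:E).
  by move=> a b ab; rewrite lee_fin; exact/lefP/nd_nnsfun_approx.
have L : \int[P]_(w in E) (f_ n (Y w))%:E @[n --> \oo] --> \int[P]_(w in E) h (Y w).
  rewrite (_ : \int[P]_(w in E) h (Y w) = \int[P]_(w in E) limn (fun n => (f_ n (Y w))%:E)).
    apply: cvg_monotone_convergence => //.
    - move=> n; apply/measurable_EFinP/measurable_funTS; exact: measurableT_comp.
    - by move=> n w _; rewrite lee_fin.
  by apply: eq_integral => w _; apply/esym/cvg_lim.
have Rt : \int[P]_(w in E) \int[k (x w)]_y (f_ n y)%:E @[n --> \oo] -->
    \int[P]_(w in E) \int[k (x w)]_y h y.
  rewrite (_ : \int[P]_(w in E) \int[k (x w)]_y h y =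
    \int[P]_(w in E) limn (fun n => \int[k (x w)]_y (f_ n y)%:E)).
    apply: cvg_monotone_convergence => //.
    - move=> n; apply: measurable_funTS; apply: mk; first exact/measurable_EFinP.
      by move=> y; rewrite lee_fin.
    - by move=> n w _; apply: integral_ge0 => y _; rewrite lee_fin.
    - move=> w _ a b ab; apply: ge0_le_integral => //.
      + by move=> y _; rewrite lee_fin.
      + exact/measurable_EFinP.
      + exact/measurable_EFinP.
      + by move=> y _; exact: nd.
  apply: eq_integral => w _; apply/esym/cvg_lim => //.
  rewrite (_ : \int[k (x w)]_y h y = \int[k (x w)]_y limn (fun n => (f_ n y)%:E)).
    apply: cvg_monotone_convergence => //.
    - by move=> n; exact/measurable_EFinP.
    - by move=> n y _; rewrite lee_fin.
  by apply: eq_integral => y _; apply/esym/cvg_lim.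
have EQ : (fun n => \int[P]_(w in E) (f_ n (Y w))%:E) =
    (fun n => \int[P]_(w in E) \int[k (x w)]_y (f_ n y)%:E).
  by apply/funext => n; exact: nnsfun_case.
by rewrite EQ in L; exact: (cvg_unique _ L Rt).
Qed.

End integral_conditional.

Lemma kernel_fin_num {R : realType} d1 d2 (S : measurableType d1) (T : measurableType d2)
    (k : R.-pker S ~> T) s B : measurable B -> k s B \is a fin_num.
Proof.
move=> mB; rewrite ge0_fin_numE//; apply: (@le_lt_trans _ _ (k s setT)).
  by apply: le_measure; rewrite ?inE.
by rewrite prob_kernel ltry.
Qed.

Section slice.
Context {R : realType} d1 d2 (S : measurableType d1) (T : measurableType d2).
Context (Q : probability (S * T)%type R) (D : set T) (mD : measurable D).

(** With [D] fixed this is a measure in the first coordinate, so that statements on rectangles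
    become statements on measures, one coordinate at a time. Countable additivity depends on the
    measurability of [D], which is therefore an argument. *)
Definition slice & measurable D := fun A : set S => Q (A `*` D).

Let slice0 : slice mD set0 = 0. Proof. by rewrite /slice set0X measure0. Qed.

Let slice_ge0 A : 0 <= slice mD A. Proof. exact: measure_ge0. Qed.

Let slice_sigma_additive : semi_sigma_additive (slice mD).
Proof.
move=> F mF tF mUF; rewrite /slice setX_bigcupl.
apply: measure_semi_sigma_additive.
- by move=> n; exact: measurableX.
- apply/trivIsetP => /= i j _ _ ij.
  move/trivIsetP : tF => /(_ _ _ I I ij) tF.
  by rewrite -setXI tF set0X.
- by rewrite -setX_bigcupl; exact: measurableX.
Qed.

HB.instance Definition _ := isMeasure.Build _ _ _ (slice mD)
  slice0 slice_ge0 slice_sigma_additive.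

Let slice_fin : fin_num_fun (slice mD).
Proof. by move=> A mA; apply: fin_num_measure; exact: measurableX. Qed.

HB.instance Definition _ := @Measure_isFinite.Build _ _ _ (slice mD) slice_fin.

End slice.

Section ae_le.
Context {R : realType} d (S : measurableType d) (m : probability S R).

(** On the exceptional set [f - g] is positive while its integral is at most 0, so the set is
    null. *)
Lemma integral_le_null (f g : S -> R) :
  measurable_fun setT f -> measurable_fun setT g ->
  (forall s, 0 <= f s)%R -> (forall s, 0 <= g s)%R ->
  \int[m]_s (g s)%:E < +oo ->
  (forall E, measurable E -> \int[m]_(s in E) (f s)%:E <= \int[m]_(s in E) (g s)%:E) ->
  m [set s | (g s < f s)%R] = 0.
Proof.
move=> mf mg f0 g0 gfin fg; set E := [set s | _].
have mE : measurable E by rewrite -[E]setTI; exact: measurable_fun_ltr.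
have mf' A : measurable_fun A (EFin \o f).
  by apply/measurable_EFinP/measurable_funTS.
have mg' A : measurable_fun A (EFin \o g).
  by apply/measurable_EFinP/measurable_funTS.
have gE : \int[m]_(s in E) (g s)%:E \is a fin_num.
  rewrite ge0_fin_numE ?integral_ge0//; last by move=> s _; rewrite lee_fin.
  apply: le_lt_trans gfin; apply: ge0_subset_integral => //.
  by move=> s _; rewrite lee_fin.
have : \int[m]_(s in E) `|(f s - g s)%:E| = 0.
  transitivity (\int[m]_(s in E) (f s - g s)%:E).
    apply: eq_integral => s; rewrite inE => gf.
    by rewrite gee0_abs// lee_fin subr_ge0 ltW.
  apply/eqP; rewrite eq_le; apply/andP; split; last first.
    by apply: integral_ge0 => s /= gf; rewrite lee_fin subr_ge0 ltW.
  rewrite -(leeD2lE _ _ gE) adde0 -ge0_integralD//; last 3 first.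
  - by move=> s _; rewrite lee_fin.
  - by move=> s /= gf; rewrite lee_fin subr_ge0 ltW.
  - by apply/measurable_EFinP/measurable_funTS/measurable_funB.
  rewrite (eq_integral (fun s => (f s)%:E)); first exact: fg.
  by move=> s _ /=; rewrite -EFinD addrC subrK.
move/ae_eq_integral_abs => H.
have /H {H} : measurable_fun E (fun s => (f s - g s)%:E).
  by apply/measurable_EFinP/measurable_funTS/measurable_funB.
move=> /(_ mE)[N [mN N0 subN]].
apply: (subset_measure0 mE mN _ N0) => s Es; apply: subN => /=.
move=> /(_ Es) [] /eqP; rewrite subr_eq0 => /eqP fg'.
by move: Es; rewrite /E /= fg' ltxx.
Qed.

Lemma integral_le_ae (f g : S -> R) :
  measurable_fun setT f -> measurable_fun setT g ->
  (forall s, 0 <= f s)%R -> (forall s, 0 <= g s)%R ->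
  \int[m]_s (g s)%:E < +oo ->
  (forall E, measurable E -> \int[m]_(s in E) (f s)%:E <= \int[m]_(s in E) (g s)%:E) ->
  {ae m, forall s, (f s <= g s)%R}.
Proof.
move=> mf mg f0 g0 gfin fg; exists [set s | (g s < f s)%R]; split.
- by rewrite -[X in measurable X]setTI; exact: measurable_fun_ltr.
- exact: integral_le_null.
- by move=> s /= /negP; rewrite -ltNge.
Qed.

Lemma integral_eq_ae (f g : S -> R) :
  measurable_fun setT f -> measurable_fun setT g ->
  (forall s, 0 <= f s)%R -> (forall s, 0 <= g s)%R ->
  \int[m]_s (g s)%:E < +oo ->
  (forall E, measurable E -> \int[m]_(s in E) (f s)%:E = \int[m]_(s in E) (g s)%:E) ->
  {ae m, forall s, f s = g s}.
Proof.
move=> mf mg f0 g0 gfin fg.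
have H1 : {ae m, forall s, (f s <= g s)%R}.
  by apply: integral_le_ae => // E mE; rewrite fg.
have H2 : {ae m, forall s, (g s <= f s)%R}.
  by apply: integral_le_ae => // [|E mE]; rewrite fg.
by apply: filterS2 H1 H2 => s fs gs; apply/eqP; rewrite eq_le fs gs.
Qed.

End ae_le.

(** [h] is the Radon-Nikodym density of [slice] with respect to the first marginal. It is at most 1
    almost everywhere because the slice is dominated by the marginal; truncation makes the bound
    hold everywhere. *)
Lemma cond_prob {R : realType} d1 d2 (S : measurableType d1)
    (T : measurableType d2) (Q : probability (S * T)%type R) (D : set T) :
  measurable D ->
  exists h : S -> R, [/\ measurable_fun setT h, forall s, (0 <= h s <= 1)%R &
    forall A, measurable A ->
      Q (A `*` D) = \int[law Q measurable_fst]_(s in A) (h s)%:E].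
Proof.
move=> mD; set m := law Q measurable_fst.
have mE A : measurable A -> m A = Q (A `*` setT).
  move=> mA; rewrite /m lawE; congr (Q _).
  by apply/seteqP; split => [[x y] /=|[x y] []].
have slice_dom : slice Q mD `<< m.
  apply/null_content_dominatesP => A mA mA0.
  apply: (@subset_measure0 _ _ _ Q _ (A `*` setT)).
  - exact: measurableX.
  - exact: measurableX.
  - by move=> [x y] [].
  - exact: etrans (esym (mE _ mA)) mA0.
have [f [f0 ffin fint fE]] := radon_nikodym_sigma_finite slice_dom.
have mf : measurable_fun setT f by exact: measurable_int fint.
have mff : measurable_fun setT (fine \o f) by exact: measurableT_comp.
have fE' A : measurable A -> Q (A `*` D) = \int[m]_(s in A) (fine (f s))%:E.
  by move=> mA; rewrite -/(slice Q mD A) fE//; apply: eq_integral => s _; rewrite fineK.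
have f1 : {ae m, forall s, (fine (f s) <= 1)%R}.
  apply: (@integral_le_ae _ _ _ m (fine \o f) (cst 1%R)) => //.
  - by move=> s /=; rewrite fine_ge0.
  - rewrite (eq_integral (cst 1))// integral_cst// mul1e ltey_eq; apply/orP; left; exact: fin_num_measure.
  - move=> E mE'; rewrite /= -fE'// (eq_integral (cst 1))// integral_cst// mul1e [leRHS](mE _ mE').
    by apply: le_measure; rewrite ?inE//; [exact: measurableX|exact: measurableX|move=> [x y] []].
exists (fun s => Num.min (fine (f s)) 1%R); split.
- by apply: measurable_minr => //; exact: measurable_cst.
- by move=> s; rewrite le_min ler01 fine_ge0//= ge_min lexx orbT.
- move=> A mA; rewrite fE'//; apply: ge0_ae_eq_integral => //.
  + by apply/measurable_EFinP/measurable_funTS.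
  + by apply/measurable_EFinP/measurable_funTS/measurable_minr => //; exact: measurable_cst.
  + by move=> s _; rewrite lee_fin fine_ge0.
  + by move=> s _; rewrite lee_fin le_min ler01 fine_ge0.
  + by apply: filterS f1 => s fs1 _; congr EFin; rewrite min_l.
Qed.

(** * Conditional quantile transform *)

(* [T] is a measurable retract of the unit interval. *)
Definition standard_space (R : realType) d (T : measurableType d) :=
  exists (e : T -> R) (j : R -> T), [/\ measurable_fun setT e,
    measurable_fun setT j, forall x, j (e x) = x & forall x, (0 <= e x <= 1)%R].

Lemma measurable_mem_set d (T : measurableType d) (A : set T) :
  measurable A -> measurable_fun setT (fun x => x \in A).
Proof.
move=> mA; apply: (measurable_fun_bool true) => /=.
by rewrite setTI (_ : _ @^-1` _ = A)//; apply/seteqP; split=> x /=;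
  [move/set_mem|move/mem_set].
Qed.

Section chain.
Context {R : realType} d1 d2 (S : measurableType d1) (T : measurableType d2).
Context (m1 : {measure set S -> \bar R}) (m2 : {measure set T -> \bar R}).
Context (a : nat -> R) (F : nat -> set S) (G : nat -> set T).
Hypotheses (mF : forall i, measurable (F i)) (mG : forall i, measurable (G i)).
Hypothesis Fmono : forall i k, (a i <= a k)%R -> F i `<=` F k.
Hypothesis Gmono : forall i k, (a i <= a k)%R -> G i `<=` G k.
Hypothesis FG : forall i, m1 (F i) = m2 (G i).

(** The index values [a] order both families in the same way, so a finite union is the member with
    the largest [a], the same index on both sides. Continuity from below passes to the countable
    union. *)
Lemma chain_bigcup (I : set nat) :
  m1 (\bigcup_(i in I) F i) = m2 (\bigcup_(i in I) G i).
Proof.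
pose Fn n := \bigcup_(i in I `&` `I_n) F i.
pose Gn n := \bigcup_(i in I `&` `I_n) G i.
have step n : (Fn n = set0 /\ Gn n = set0) \/
    exists2 k, I k & Fn n = F k /\ Gn n = G k.
  elim: n => [|n IH].
    left; rewrite /Fn /Gn (_ : I `&` `I_0 = set0) ?bigcup_set0//.
    by apply/seteqP; split => // x [].
  have [In|In] := pselect (I n); last first.
    have -> : Fn n.+1 = Fn n.
      apply/seteqP; split => x [i [Ii /= ni] Fi]; exists i => //; split => //=.
        move: ni; rewrite ltnS leq_eqVlt => /predU1P[ni|//].
        by rewrite ni in Ii.
      exact: leq_trans ni _.
    have -> : Gn n.+1 = Gn n.
      apply/seteqP; split => x [i [Ii /= ni] Fi]; exists i => //; split => //=.
        move: ni; rewrite ltnS leq_eqVlt => /predU1P[ni|//].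
        by rewrite ni in Ii.
      exact: leq_trans ni _.
    exact: IH.
  have eqF : Fn n.+1 = F n `|` Fn n.
    apply/seteqP; split => x.
      move=> [i [Ii /= ni] Fi]; move: ni; rewrite ltnS leq_eqVlt => /predU1P[<-|ni].
        by left.
      by right; exists i.
    move=> [Fx|[i [Ii /= ni] Fi]]; first by exists n => //; split => //=.
    by exists i => //; split => //=; exact: leq_trans ni _.
  have eqG : Gn n.+1 = G n `|` Gn n.
    apply/seteqP; split => x.
      move=> [i [Ii /= ni] Fi]; move: ni; rewrite ltnS leq_eqVlt => /predU1P[<-|ni].
        by left.
      by right; exists i.
    move=> [Fx|[i [Ii /= ni] Fi]]; first by exists n => //; split => //=.
    by exists i => //; split => //=; exact: leq_trans ni _.
  right; case: IH => [[F0 G0]|[k Ik [Fk Gk]]].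
    by exists n => //; rewrite eqF eqG F0 G0 !setU0.
  rewrite eqF eqG Fk Gk; have [nk|kn] := leP (a n) (a k).
    by exists k => //; split; apply/setUidPr; [exact: Fmono|exact: Gmono].
  by exists n => //; split; apply/setUidPl; [apply: Fmono|apply: Gmono]; exact: ltW.
have FGn n : m1 (Fn n) = m2 (Gn n).
  by case: (step n) => [[-> ->]|[k _ [-> ->]]]; rewrite ?measure0.
have mFn n : measurable (Fn n) by rewrite /Fn; apply: bigcup_measurable => i _; exact: mF.
have mGn n : measurable (Gn n) by rewrite /Gn; apply: bigcup_measurable => i _; exact: mG.
have FE : \bigcup_(i in I) F i = \bigcup_n Fn n.
  apply/seteqP; split => x [i Ii Fi]; first by exists i.+1 => //; exists i => //; split => //=.
  by case: Fi => k [Ik _] Fk; exists k.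
have GE : \bigcup_(i in I) G i = \bigcup_n Gn n.
  apply/seteqP; split => x [i Ii Fi]; first by exists i.+1 => //; exists i => //; split => //=.
  by case: Fi => k [Ik _] Fk; exists k.
have c1 : m1 (Fn n) @[n --> \oo] --> m1 (\bigcup_n Fn n).
  apply: nondecreasing_cvg_mu => //; first exact: bigcupT_measurable.
  move=> n p np; apply/subsetPset => x [i [Ii /= ni] Fi]; exists i => //; split => //=.
  exact: leq_trans np.
have c2 : m2 (Gn n) @[n --> \oo] --> m2 (\bigcup_n Gn n).
  apply: nondecreasing_cvg_mu => //; first exact: bigcupT_measurable.
  move=> n p np; apply/subsetPset => x [i [Ii /= ni] Fi]; exists i => //; split => //=.
  exact: leq_trans np.
rewrite FE GE; move: c1; rewrite (_ : (fun n => _) = (fun n => m2 (Gn n))).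
  by move=> c1; exact: (cvg_unique _ c1 c2).
by apply/funext => n; exact: FGn.
Qed.

End chain.

Lemma measure_eq_ray (R : realType) (m1 m2 : {measure set R -> \bar R}) :
  (forall t, m1 [set y | (y < t)%R] = m2 [set y | (y < t)%R]) ->
  m1 setT = m2 setT -> m1 setT < +oo ->
  forall B, measurable B -> m1 B = m2 B.
Proof.
move=> H HT fin B mB.
pose G := setT |` [set A : set R | exists t : R, A = [set y | (y < t)%R]].
apply: (@measure_eq_pi _ _ _ G) => //.
- apply: etrans (RGenInftyO.measurableE R) _; apply/seteqP; split.
    apply: sub_sigma_algebra2 => _ [t [-> ]]; right; exists t.
    by apply/seteqP; split => y /=; rewrite in_itv.
  apply: smallest_sub; first exact: smallest_sigma_algebra.
  move=> _ [->|[t ->]].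
    rewrite -(setC0); apply: sigma_algebraC; exact: sigma_algebra0.
  apply: sub_sigma_algebra; exists t.
  by split => //; apply/seteqP; split => y /=; rewrite in_itv.
- move=> _ _ [->|[t ->]] [->|[s ->]].
  + by left; rewrite setIT.
  + by right; exists s; rewrite setTI.
  + by right; exists t; rewrite setIT.
  + right; exists (Num.min t s); apply/seteqP; split => y /=.
      by move=> [? ?]; rewrite lt_min; apply/andP.
    by rewrite lt_min => /andP.
- by left.
- by move=> _ [->|[t ->]].
Qed.

Lemma measurable_subgraph {R : realType} d (S : measurableType d)
    (A : set S) (h : S -> R) : measurable A -> measurable_fun setT h ->
  measurable [set p : S * R | A p.1 /\ (p.2 <= h p.1)%R].
Proof.
move=> mA mh; rewrite (_ : [set _ | _] = (A `*` setT) `&` [set p | (p.2 <= h p.1)%R]).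
  apply: measurableI; first exact: measurableX.
  rewrite -[X in measurable X]setTI; apply: measurable_fun_ler => //.
  exact: measurableT_comp.
by apply/seteqP; split => [[x y] [/= Ax yh]|[x y] [[]]].
Qed.

(** By sections: a uniform variable lies below [h s] with probability [h s]. *)
Lemma subgraph_lam {R : realType} d (S : measurableType d)
    (m : probability S R) (A : set S) (h : S -> R) :
  measurable A -> measurable_fun setT h -> (forall s, 0 <= h s <= 1)%R ->
  pprod m lam [set p : S * R | A p.1 /\ (p.2 <= h p.1)%R] =
  \int[m]_(s in A) (h s)%:E.
Proof.
move=> mA mh h01; rewrite pprodE [RHS]integral_mkcond.
apply: eq_integral => s _ /=; rewrite patchE.
case: ifPn => [|sA].
  rewrite inE => As; rewrite (_ : xsection _ s = [set u | (u <= h s)%R]).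
    exact: lam_le.
  by apply/seteqP; split => u; rewrite /xsection /= inE //= => -[].
rewrite (_ : xsection _ s = set0) ?measure0//.
apply/seteqP; split => // u; rewrite /xsection /= inE /= => -[As].
by rewrite notin_setE in sA.
Qed.

Section transfer_real.
Context {R : realType} d (S : measurableType d) (Q : probability (S * R)%type R).
Hypothesis Q01 : Q (setT `*` `[0%R, 1%R]%classic) = 1.

Let m := law Q measurable_fst.

(** Enumerates the rationals of the unit interval. Every other code is sent to 1, itself an
    admissible level, so that all values stay in the interval. *)
Let qs (i : nat) : R := odflt 1%R (omap (fun q : rat =>
  if (0 <= q <= 1)%R then ratr q else 1%R) (unpickle i)).

Let qs01 i : (0 <= qs i <= 1)%R.
Proof.
rewrite /qs; case: (unpickle i) => [q|] /=; last by rewrite ler01 lexx.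
case: ifPn => [/andP[q0 q1]|_]; last by rewrite ler01 lexx.
by rewrite ler0q q0 -(ler_rat R) in q1 * => //; rewrite rmorph1 in q1.
Qed.

Let qs_dense (y t : R) : (y < t)%R -> (0 < t)%R -> (t <= 1)%R ->
  exists i, (y <= qs i)%R /\ (qs i < t)%R.
Proof.
move=> yt t0 t1.
have : (Num.max y 0 < t)%R by rewrite gt_max yt.
move=> /rat_in_itvoo[q]; rewrite in_itv/= gt_max => /andP[/andP[yq q0] qt].
exists (pickle q); rewrite /qs pickleK/= ifT ?qt ?(ltW yq)//.
rewrite -(ler0q R) (ltW q0)/= -(ler_rat R) rmorph1.
by rewrite (le_trans (ltW qt)).
Qed.

Let D i : set R := [set y | (y <= qs i)%R].

Let mD i : measurable (D i).
Proof. by rewrite /D -set_itvNyc; exact: measurable_itv. Qed.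

(** A conditional distribution function at rational levels. Each level is determined only up to a
    null set, so monotonicity may fail on the set [Bad], a countable union of null sets; there all
    levels are reset to 0. *)
Let monotone_cond_prob : exists h : nat -> S -> R,
  [/\ forall i, measurable_fun setT (h i),
      forall i s, (0 <= h i s <= 1)%R,
      forall i k s, (qs i <= qs k)%R -> (h i s <= h k s)%R &
      forall i A, measurable A -> Q (A `*` D i) = \int[m]_(s in A) (h i s)%:E].
Proof.
have [h hP] := choice (fun i => cond_prob Q (mD i)).
have mh i : measurable_fun setT (h i) by case: (hP i).
have h01 i s : (0 <= h i s <= 1)%R by case: (hP i).
have hE i A : measurable A -> Q (A `*` D i) = \int[m]_(s in A) (h i s)%:E.
  by case: (hP i) => _ _; exact.
pose B i k : set S := if (qs i <= qs k)%R then [set s | (h k s < h i s)%R] else set0.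
have mB i k : measurable (B i k).
  rewrite /B; case: ifPn => // _.
  by rewrite -[X in measurable X]setTI; exact: measurable_fun_ltr.
have B0 i k : m (B i k) = 0.
  rewrite /B; case: ifPn => [ik|_]; last exact: measure0.
  apply: integral_le_null => //.
  - by move=> s; case/andP: (h01 i s).
  - by move=> s; case/andP: (h01 k s).
  - by rewrite -hE// ltey_eq; apply/orP; left; apply: fin_num_measure; exact: measurableX.
  - move=> E mE; rewrite -!hE//; apply: le_measure; rewrite ?inE; [exact: measurableX..|].
    by move=> [x y] [/= Ex yi]; split => //; exact: le_trans ik.
pose Bad := \bigcup_i \bigcup_k B i k.
have mBad : measurable Bad by do 2 (apply: bigcupT_measurable => ?).
have Bad0 : m Bad = 0.
  apply: measure_negligible => //.
  apply: negligible_bigcup => i; apply: negligible_bigcup => k.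
  by apply/negligibleP; [exact: mB|exact: B0].
exists (fun i s => if s \in Bad then 0%R else h i s); split.
- move=> i; apply: measurable_fun_ifT => //.
  exact: measurable_mem_set.
- by move=> i s; case: ifPn => _; rewrite ?lexx ?ler01.
- move=> i k s ik; case: ifPn => // sB; rewrite leNgt; apply/negP => hki.
  move: sB; rewrite notin_setE; apply; exists i => //; exists k => //.
  by rewrite /B ik.
- move=> i A mA; rewrite hE//; apply: ge0_ae_eq_integral => //.
  + by apply/measurable_EFinP/measurable_funTS.
  + apply/measurable_EFinP/measurable_funTS; apply: measurable_fun_ifT => //.
    exact: measurable_mem_set.
  + by move=> s _; rewrite lee_fin; case/andP: (h01 i s).
  + by move=> s _; rewrite lee_fin; case: ifPn => // _; case/andP: (h01 i s).
  + exists Bad; split => // s /= /not_implyP[_]; apply: contraPP => sB.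
    by rewrite memNset.
Qed.

Lemma transfer_real : exists2 r : S * R -> R, measurable_fun setT r &
  forall W, measurable W -> pprod m lam ((fun p => (p.1, r p)) @^-1` W) = Q W.
Proof.
have [h [mh h01 hmono hE]] := monotone_cond_prob.
(* [r] is a generalized inverse: the infimum of the levels [q] such that [u] is at most the
   conditional distribution function at [q]. The value 1 at the other levels has no effect on an
   infimum of levels in the unit interval. An infimum is below [t] exactly when a member is, so laws
   are compared on strict rays. *)
pose v i (p : S * R) : R := if (p.2 <= h i p.1)%R then qs i else 1%R.
pose r p := infs (v ^~ p) 0%N.
have v0 i p : (0 <= v i p)%R.
  by rewrite /v; case: ifPn => // _; case/andP: (qs01 i).
have vlb p : has_lbound (range (v ^~ p)) by exists 0%R => _ [i _ <-].
have mv i : measurable_fun setT (v i).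
  apply: measurable_fun_ifT => //; first by apply: measurable_fun_ler => //; exact: measurableT_comp.
have mr : measurable_fun setT r by apply: measurable_fun_infs.
exists r => //.
have rlt p t : (r p < t)%R <-> exists i, (v i p < t)%R.
  rewrite /r /infs /sdrop /=; split.
    by move=> /inf_lt -[|y [i _ <-] yt]; [exists (v 0%N p), 0%N|exists i].
  move=> [i it]; apply: le_lt_trans it; apply: ge_inf.
    by exists 0%R => _ [k _ <-].
  by exists i.
pose L := law (pprod m lam) (measurable_fun_pair measurable_fst mr).
suff LQ : forall W, measurable W -> L W = Q W by move=> W mW; rewrite -LQ.
have LT0 A : measurable A -> pprod m lam (A `*` setT) = Q (A `*` setT).
  move=> mA; rewrite pprodX// probability_setT mule1.
  rewrite /m lawE; congr (Q _).
  by apply/seteqP; split => [[x y] /=|[x y] []].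
have LT A : measurable A -> L (A `*` setT) = Q (A `*` setT).
  by move=> mA; rewrite -LT0.
have Lray A t : measurable A ->
    L (A `*` [set y | (y < t)%R]) = Q (A `*` [set y | (y < t)%R]).
  move=> mA.
  have mt : measurable [set y : R | (y < t)%R].
    by rewrite -set_itvNyo; exact: measurable_itv.
  have mI : measurable (`[0%R, 1%R]%classic : set R) by exact: measurable_itv.
  have Q0 (B : set R) : measurable B -> B `&` `[0%R, 1%R]%classic = set0 -> Q (A `*` B) = 0.
    move=> mB B0; apply: (@subset_measure0 _ _ _ Q _ (~` (setT `*` `[0%R, 1%R]%classic))).
    - exact: measurableX.
    - by apply: measurableC; exact: measurableX.
    - move=> [x y] [/= Ax By] [_ /= y01].
      by have : (B `&` `[0%R, 1%R]%classic) y by []; rewrite B0.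
    - have mTI : measurable ([set: S] `*` (`[0%R, 1%R]%classic : set R)).
        exact: measurableX.
      have := probability_setC Q mTI.
      by rewrite [X in _ - X]Q01 subee.
  have [t0|t0] := leP t 0%R.
    rewrite /L lawE (_ : _ @^-1` _ = set0) ?measure0; last first.
      apply/seteqP; split => // -[x y] [_ /=] /rlt[i] /lt_le_trans/(_ t0).
      by rewrite ltNge v0.
    rewrite [RHS]Q0//; apply/seteqP; split => // y [/= yt].
    by rewrite in_itv/= => /andP[y0 _]; move: (lt_le_trans yt t0); rewrite ltNge y0.
  have [t1|t1] := leP t 1%R; last first.
    rewrite /L lawE (_ : _ @^-1` _ = A `*` setT).
      rewrite LT0// (_ : A `*` setT = (A `*` [set y | (y < t)%R]) `|` (A `*` ~` [set y | (y < t)%R])).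
        have mAt : measurable (A `*` [set y | (y < t)%R]) by exact: measurableX.
        have mAt' : measurable (A `*` ~` [set y | (y < t)%R]).
          by apply: measurableX => //; exact: measurableC.
        rewrite (measureU Q mAt mAt'); last first.
          by apply/seteqP; split => // -[x y] [[_ /= yt] [_ /=]].
        rewrite [X in _ + X]Q0 ?adde0//; first exact: measurableC.
        apply/seteqP; split => // y [/= yt]; rewrite in_itv/= => /andP[_ y1].
        by apply: yt; exact: le_lt_trans t1.
      apply/seteqP; split => [[x y] [/= Ax _]|[x y] [[]|[]]]//.
      by have [yt|yt] := pselect (y < t)%R; [left|right].
    apply/seteqP; split => [[x y] []|[x y] [Ax _]]//; split => //=.
    by apply/rlt; exists 0%N; rewrite /v; case: ifPn => // _; apply: le_lt_trans t1; case/andP: (qs01 0).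
  (* For [t] in the unit interval, both sides are unions, over the rational levels below [t], of
     sets that increase with the level and have equal measures level by level. *)
  pose F i : set (S * R) := [set p | A p.1 /\ (p.2 <= h i p.1)%R].
  pose G i : set (S * R) := A `*` D i.
  have := @chain_bigcup R _ _ _ _ (pprod m lam) Q qs F G _ _ _ _ _ [set i | (qs i < t)%R].
  rewrite /L lawE (_ : _ @^-1` _ = \bigcup_(i in [set i | (qs i < t)%R]) F i); last first.
    apply/seteqP; split => [[x y] [/= Ax /rlt[i]]|[x y] [i /= it [/= Ax yh]]].
      rewrite /v /=; case: ifPn => [yh it|_]; first by exists i.
      by rewrite ltNge t1.
    by split => //=; apply/rlt; exists i; rewrite /v /= yh.
  rewrite (_ : A `*` [set y | (y < t)%R] = \bigcup_(i in [set i | (qs i < t)%R]) G i); last first.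
    apply/seteqP; split => [[x y] [/= Ax yt]|[x y] [i /= it [/= Ax yh]]].
      by have [i [yi it]] := qs_dense yt t0 t1; exists i.
    by split => //=; exact: le_lt_trans it.
  apply.
  - by move=> i; exact: measurable_subgraph.
  - by move=> i; exact: measurableX.
  - by move=> i k ik p [/= Ap ph]; split => //; exact: le_trans (hmono _ _ _ ik).
  - by move=> i k ik [x y] [/= Ax yi]; split => //; exact: le_trans ik.
  - by move=> i; apply: etrans (subgraph_lam m mA (mh i) (h01 i)) _; rewrite -hE.
apply: prob_eq_rect.
move=> A B mA mB.
(* Once the coordinates are exchanged, [slice] with [A] fixed turns both sides into measures on the
   line, which the rays determine. *)
have msw := measurable_fun_pair (@measurable_snd _ _ S R) (@measurable_fst _ _ S R).
have sw C : (fun p : S * R => (p.2, p.1)) @^-1` (C `*` A) = A `*` C.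
  by apply/seteqP; split => [[x y] []|[x y] []].
have slE (Q' : probability (S * R)%type R) C : slice (law Q' msw) mA C = Q' (A `*` C).
  by rewrite -sw.
apply: etrans (esym (slE L B)) (etrans _ (slE Q B)).
apply: measure_eq_ray => //.
- by move=> t; apply: etrans (slE L _) (etrans _ (esym (slE Q _))); exact: Lray.
- by apply: etrans (slE L _) (etrans _ (esym (slE Q _))); exact: LT.
- apply: le_lt_trans (ltry 1%R); apply: le_trans (probability_le1 L measurableT).
  by rewrite [leLHS]slE; apply: le_measure; rewrite ?inE//; exact: measurableX.
Qed.

End transfer_real.

(* [r s] is the conditional quantile function of the second coordinate given [s]. *)
Lemma transfer {R : realType} d1 d2 (S : measurableType d1)
    (T : measurableType d2) (Q : probability (S * T)%type R) :
  standard_space R T ->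
  exists2 r : S * R -> T, measurable_fun setT r &
  forall W, measurable W ->
    pprod (law Q measurable_fst) lam ((fun p => (p.1, r p)) @^-1` W) = Q W.
Proof.
move=> [e [j [me mj ej e01]]].
have mse : measurable_fun setT (fun p : S * T => (p.1, e p.2)).
  by apply: measurable_fun_pair => //; exact: measurableT_comp.
have [|r mr rQ] := @transfer_real R _ S (law Q mse).
  rewrite lawE (_ : _ @^-1` _ = setT) ?probability_setT//.
  by apply/seteqP; split => // -[x y] _; split => //=; rewrite in_itv/= e01.
exists (j \o r); first exact: measurableT_comp.
move=> W mW.
have mj2 : measurable_fun setT (fun p : S * R => (p.1, j p.2)).
  by apply: measurable_fun_pair => //; exact: measurableT_comp.
have E V : pprod (law (law Q mse) measurable_fst) lam V =
    pprod (law Q measurable_fst) lam V.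
  by rewrite !pprodE; apply: eq_measure_integral.
apply: etrans (etrans (esym (E _)) (rQ _ (preim_measurable mj2 mW))) _.
rewrite lawE; congr (Q _).
by apply/seteqP; split => -[x y] /=; rewrite ej.
Qed.

(** * Coding points of R^d by reals *)

(* Using only the digits [0] and [2] makes the digits measurable functions of the sum. *)
Section ternary_coding.
Local Open Scope ring_scope.
Context {R : realType}.
Implicit Types (b : nat -> bool) (y : R).

Let psum b n : R := \sum_(i < n) (if b i then 2 / 3 ^+ i.+1 else 0).

Definition ternary b : R := sup (range (psum b)).

Let psum_ge0 b n : 0 <= psum b n.
Proof. by apply: sumr_ge0 => i _; case: ifP => // _; rewrite divr_ge0// exprn_ge0. Qed.

Let psum_le b n : psum b n <= 1 - 1 / 3 ^+ n.
Proof.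
elim: n => [|n IH]; first by rewrite /psum big_ord0 expr0 divr1 subrr.
have H : 1 / 3 ^+ n = 3 / 3 ^+ n.+1 :> R.
  by rewrite exprS invfM mulrA divff ?pnatr_eq0.
have p0 : 0 <= 1 / 3 ^+ n.+1 :> R by rewrite divr_ge0// exprn_ge0.
rewrite /psum big_ord_recr/= -/(psum b n); move: IH; rewrite H => IH.
apply: le_trans (lerD IH (_ : _ <= 2 / 3 ^+ n.+1)) _.
  by case: ifP => // _; rewrite divr_ge0// exprn_ge0.
by lra.
Qed.

Let psum_le1 b n : psum b n <= 1.
Proof.
by apply: le_trans (psum_le b n) _; rewrite gerBl divr_ge0// exprn_ge0.
Qed.

Let psum_ub b : has_ubound (range (psum b)).
Proof. by exists 1 => _ [n _ <-]. Qed.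

Let psum_ternary b n : psum b n <= ternary b.
Proof. by apply: ub_le_sup => //; exists n. Qed.

Lemma ternary01 b : 0 <= ternary b <= 1.
Proof.
apply/andP; split; first exact: le_trans (psum_ge0 b 0) (psum_ternary b 0).
by apply: ge_sup; [exists (psum b 0), 0%N|move=> _ [n _ <-]].
Qed.

Let psumS b n : psum b n.+1 = ((if b 0%N then 2 else 0) + psum (b \o succn) n) / 3.
Proof.
rewrite /psum big_ord_recl/= expr1 [RHS]mulrDl; congr (_ + _).
  by case: ifP => // _; rewrite mul0r.
rewrite mulr_suml; apply: eq_bigr => i _ /=; case: ifP => // _; last by rewrite mul0r.
by rewrite -mulrA -invfM -exprSr.
Qed.

Let ternaryS b : ternary b = ((if b 0%N then 2 else 0) + ternary (b \o succn)) / 3.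
Proof.
have pS := psumS b; have /andP[t0 _] := ternary01 (b \o succn).
have : 0 <= (if b 0%N then 2 else 0) :> R by case: ifP.
move: pS; set c : R := if b 0%N then 2 else 0; move: c => c pS c0.
apply/eqP; rewrite eq_le; apply/andP; split.
  apply: ge_sup; first by exists (psum b 0), 0%N.
  move=> _ [[|n] _ <-]; first by rewrite {1}/psum big_ord0; lra.
  by rewrite pS; have := psum_ternary (b \o succn) n; lra.
suff : ternary (b \o succn) <= 3 * ternary b - c by lra.
apply: ge_sup; first by exists (psum (b \o succn) 0), 0%N.
by move=> _ [n _ <-]; have := psum_ternary b n.+1; rewrite pS; lra.
Qed.

(** A first digit 0 leaves the sum at most 1/3 and a first digit 2 makes it at least 2/3, so the
    threshold 1/2 tells them apart. *)
Let bit0 y := 1 / 2 <= y.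

Let peel y := 3 * y - (if bit0 y then 2 else 0).

Definition ternary_digit i y := bit0 (iter i peel y).

Lemma ternaryK b i : ternary_digit i (ternary b) = b i.
Proof.
have bit0E c : bit0 (ternary c) = c 0%N.
  rewrite /bit0 ternaryS; have /andP[t0 t1] := ternary01 (c \o succn).
  by case: (c 0%N); [apply/idP; lra|apply/negbTE; rewrite -ltNge; lra].
have peelE c : peel (ternary c) = ternary (c \o succn).
  by rewrite /peel bit0E {1}ternaryS; case: (c 0%N); lra.
rewrite /ternary_digit; elim: i b => [|i IH] b; first exact: bit0E.
by rewrite iterSr peelE IH.
Qed.

Lemma measurable_ternary d (S : measurableType d) (B : nat -> S -> bool) :
  (forall i, measurable_fun setT (B i)) ->
  measurable_fun setT (fun s => ternary (fun i => B i s)).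
Proof.
move=> mB; rewrite (_ : (fun s => _) = (fun s => sups ((fun n s => psum (fun i => B i s) n) ^~ s) 0%N)).
  apply: measurable_fun_sups => //.
  move=> n; apply: measurable_sum => i.
  by apply: measurable_fun_ifT.
apply/funext => s; rewrite /ternary /sups /sdrop /=; congr sup.
by apply/seteqP; split => _ [n _ <-]; exists n.
Qed.

Lemma measurable_ternary_digit i : measurable_fun setT (ternary_digit i).
Proof.
have mbit : measurable_fun setT bit0.
  by apply: measurable_fun_ler.
have mpeel : measurable_fun setT peel.
  apply: measurable_funB; first exact: measurable_funM.
  exact: measurable_fun_ifT.
apply: measurableT_comp => //; elim: i => [|i IH]; first exact: measurable_id.
exact: measurableT_comp.
Qed.

End ternary_coding.

Section Rd_facts.
Context {R : realType} {dd : dimension}.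
Notation T := (Rd R dd).

Lemma measurable_coord (k : Idx dd) : measurable_fun setT (fun x : T => x k).
Proof.
move=> _ B mB; rewrite setTI; apply: sub_sigma_algebra.
by exists k, B.
Qed.

Lemma measurable_coord_gt (k : Idx dd) (c : R) : measurable [set x : T | (c < x k)%R].
Proof.
by rewrite -[X in measurable X]setTI; apply: measurable_fun_ltr => //; exact: measurable_coord.
Qed.

Lemma measurable_coord_le (k : Idx dd) :
  measurable [set p : T * T | (p.1 k <= p.2 k)%R] /\
  measurable [set p : T * T | (p.2 k <= p.1 k)%R].
Proof.
have m1 := measurableT_comp (measurable_coord k) (@measurable_fst _ _ T T).
have m2 := measurableT_comp (measurable_coord k) (@measurable_snd _ _ T T).
by split; rewrite -[X in measurable X]setTI; exact: measurable_fun_ler.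
Qed.

Lemma measurable_toRd d (S : measurableType d) (f : S -> T) :
  (forall k, measurable_fun setT (fun s => f s k)) -> measurable_fun setT f.
Proof.
move=> mf; apply: (@measurability _ _ S T setT f (@coord_sets R dd)) => //.
move=> _ [A [k [B [mB ->]]] <-]; rewrite setTI.
exact: (preim_measurable (mf k)).
Qed.

(** The case analysis gives access to the countable structure of the index type, which is hidden
    while the dimension is a variable. *)
Lemma enum_coord : exists en : nat -> option (Idx dd * rat),
  forall p, exists i, en i = Some p.
Proof.
case: dd => [n|] /=.
  by exists (fun i => unpickle i : option ('I_n * rat)) => p; exists (pickle p); rewrite pickleK.
by exists (fun i => unpickle i : option (nat * rat)) => p; exists (pickle p); rewrite pickleK.
Qed.

(** A point is coded by the truth values of [q < x k] for all pairs of a coordinate [k] and a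
    rational [q], and [x k] is decoded as the supremum of the rationals recorded for [k]. The
    default [-oo] is neutral for suprema, and [fine] gives a value to reals that are not codes. *)
Lemma Rd_standard : standard_space R T.
Proof.
have [en en_surj] := enum_coord.
pose b i (x : T) : bool := if en i is Some (k, q) then (ratr q < x k)%R else false.
have mb i : measurable_fun setT (b i).
  rewrite /b; case: (en i) => [[k q]|]; last exact: measurable_cst.
  by apply: measurable_fun_ltr => //; exact: measurable_coord.
pose v (k : Idx dd) i (y : R) : \bar R := if en i is Some (k', q) then
  (if `[< k' = k >] && ternary_digit i y then (ratr q)%:E else -oo) else -oo.
have mv k i : measurable_fun setT (v k i).
  rewrite /v; case: (en i) => [[k' q]|]; last exact: measurable_cst.
  case: asboolP => /= _; last exact: measurable_cst.
  by apply: measurable_fun_ifT => //; exact: measurable_ternary_digit.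
pose j (y : R) : T := fun k => fine (esups (v k ^~ y) 0%N).
exists (fun x => ternary (b ^~ x)), j; split.
- exact: measurable_ternary.
- apply: measurable_toRd => k; apply: measurableT_comp => //.
  exact: measurable_fun_esups.
- move=> x; apply/funext => k; rewrite /j /esups /=.
  suff -> : ereal_sup (sdrop (v k ^~ (ternary (b ^~ x))) 0%N) = (x k)%:E by [].
  set A := sdrop _ _.
  have Aq q : (ratr q < x k)%R -> A (ratr q)%:E.
    move=> qx; have [i ei] := en_surj (k, q); exists i => //.
    by rewrite /v ei asboolT//= ternaryK /b ei qx.
  apply/eqP; rewrite eq_le; apply/andP; split.
    apply: ge_ereal_sup => _ [i _ <-]; rewrite /v.
    case ei : (en i) => [[k' q]|]; last by rewrite leNye.
    case: asboolP => /= [kk|_]; last by rewrite leNye.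
    rewrite ternaryK /b ei; case: ifP => [qx|_]; last by rewrite leNye.
    by rewrite lee_fin ltW// -kk.
  rewrite leNgt; apply/negP => Ax.
  have ubA q : (ratr q < x k)%R -> (ratr q)%:E <= ereal_sup A.
    by move=> /Aq /ereal_sup_ubound.
  have [q0 q0x] : exists q : rat, (ratr q < x k)%R.
    have : (x k - 1 < x k)%R by rewrite ltrBlDr ltrDl.
    by move=> /rat_in_itvoo[q]; rewrite in_itv/= => /andP[_ ?]; exists q.
  have ub0 := ubA _ q0x; move: ub0 Ax ubA; case: (ereal_sup A) => [r| |]//= _.
  rewrite lte_fin => /rat_in_itvoo[q]; rewrite in_itv/= => /andP[rq qx].
  by move=> /(_ _ qx); rewrite lee_fin leNgt rq.
- by move=> x; exact: ternary01.
Qed.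

End Rd_facts.

Lemma le_ratr_lt (R : realType) (x y : R) :
  (forall q : rat, (ratr q < x)%R -> (ratr q < y)%R) -> (x <= y)%R.
Proof.
move=> xy; rewrite leNgt; apply/negP => /rat_in_itvoo[q].
by rewrite in_itv/= => /andP[yq /xy]; rewrite ltNge (ltW yq).
Qed.

Lemma eq_ratr_lt (R : realType) (x y : R) :
  (forall q : rat, (ratr q < x)%R <-> (ratr q < y)%R) -> x = y.
Proof.
by move=> xy; apply/eqP; rewrite eq_le; apply/andP; split; apply: le_ratr_lt => q /xy.
Qed.

Section standard_closure.
Context {R : realType}.

Lemma standard_retract d1 d2 (T1 : measurableType d1) (T2 : measurableType d2)
    (e : T1 -> T2) (j : T2 -> T1) :
  measurable_fun setT e -> measurable_fun setT j -> (forall x, j (e x) = x) ->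
  standard_space R T2 -> standard_space R T1.
Proof.
move=> me mj ej [e' [j' [me' mj' ej' e01]]].
exists (e' \o e), (j \o j'); split; [exact: measurableT_comp..| |by move=> x /=].
by move=> x /=; rewrite ej' ej.
Qed.

Lemma R_standard : standard_space R R.
Proof.
apply: (@standard_retract _ _ R (Rd R (dfin 1)) (fun x _ => x) (fun x => x ord0)) => //.
- by apply: measurable_toRd => k; exact: measurable_id.
- exact: measurable_coord.
- exact: Rd_standard.
Qed.

Lemma R2_standard : standard_space R (R * R)%type.
Proof.
apply: (@standard_retract _ _ (R * R)%type (Rd R (dfin 2))
  (fun x k => if k == ord0 then x.1 else x.2) (fun x => (x ord0, x ord_max))) => //.
- apply: measurable_toRd => k.
  by case: (k == ord0); [exact: measurable_fst|exact: measurable_snd].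
- apply: measurable_fun_pair; [exact: (@measurable_coord R (dfin 2) ord0)|
    exact: (@measurable_coord R (dfin 2) ord_max)].
- by case.
- exact: Rd_standard.
Qed.

End standard_closure.

Section ae_prob.
Context {R : realType} d (T : measurableType d) (P : probability T R).

Lemma ae_of_prob1 (A : set T) : measurable A -> P A = 1 -> {ae P, forall x, A x}.
Proof.
move=> mA PA; exists (~` A); split => //; first exact: measurableC.
by apply: etrans (probability_setC P mA) _; rewrite [X in _ - X]PA subee.
Qed.

Lemma prob1_of_ae (A : set T) : measurable A -> {ae P, forall x, A x} -> P A = 1.
Proof.
move=> mA [N [mN N0 AN]].
have A0 : P (~` A) = 0.
  by apply: (@subset_measure0 _ _ _ P _ _ (measurableC mA) mN AN N0).
have := probability_setC P (measurableC mA).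
by rewrite setCK => ->; rewrite [X in _ - X]A0 sube0.
Qed.

Lemma ae_exists (A : set T) : {ae P, forall x, A x} -> exists x, A x.
Proof.
move=> [N [mN N0 AN]]; apply: contrapT => nA.
have : P setT = 0.
  apply: (@subset_measure0 _ _ _ P _ _ measurableT mN _ N0) => x _.
  by apply: AN => /= Ax; apply: nA; exists x.
by rewrite probability_setT => /eqP; rewrite onee_eq0.
Qed.

Lemma eq_prob_ae (A B : set T) : measurable A -> measurable B ->
  {ae P, forall x, A x <-> B x} -> P A = P B.
Proof.
move=> mA mB [N [mN N0 AN]].
have AE C : measurable C -> P C = P (C `\` N).
  move=> mC; rewrite -[in LHS](setUIDK C N) measureU//; last 3 first.
  - exact: measurableI.
  - exact: measurableD.
  - by rewrite setDE setIACA setICr setI0.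
  rewrite [X in X + _](_ : _ = 0) ?add0e//.
  by apply: (@subset_measure0 _ _ _ P _ _ (measurableI _ _ mC mN) mN _ N0) => x [].
rewrite (AE _ mA) (AE _ mB); congr (P _); apply/seteqP; split => x [Ax Nx]; split => //.
- by have [/(_ Ax)] : A x <-> B x by apply: contrapT => h; apply: Nx; exact: AN.
- by have [_ /(_ Ax)] : A x <-> B x by apply: contrapT => h; apply: Nx; exact: AN.
Qed.

End ae_prob.

Section graph_lemma.
Context {R : realType} d1 d2 (S : measurableType d1) (T : measurableType d2).
Context (Q : probability (S * T)%type R).
Hypothesis stdT : standard_space R T.

(* By [transfer] the second coordinate is [r (s, u)] for independent [s] and [u]; by
   Fubini some fixed [u] is good for almost all [s], and single-valuedness ends the proof. *)
Lemma graph_fun (G : set (S * T)) : measurable G -> Q G = 1 ->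
  (forall s y y', G (s, y) -> G (s, y') -> y = y') ->
  exists2 phi : S -> T, measurable_fun setT phi & {ae Q, forall p, p.2 = phi p.1}.
Proof.
move=> mG QG Gfun; have [r mr rQ] := transfer Q stdT.
have msr : measurable_fun setT (fun p : S * R => (p.1, r p)).
  exact: measurable_fun_pair.
have mus : measurable_fun setT (fun p : R * (S * T) => (p.2.1, p.1)).
  apply: measurable_fun_pair => //; exact: measurableT_comp.
pose W := (fun p : R * (S * T) => (p.2.1, p.1)) @^-1`
  ((fun p : S * R => (p.1, r p)) @^-1` (~` G)).
have mW : measurable W.
  by apply: preim_measurable => //; apply: preim_measurable => //; exact: measurableC.
have W0 : pprod lam Q W = 0.
  pose L := law (pprod lam Q) mus.
  have LE : forall V, measurable V -> L V = pprod (law Q measurable_fst) lam V.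
    apply: prob_eq_rect => A B mA mB.
    have mAT : measurable (A `*` [set: T]) by exact: measurableX.
    transitivity (pprod lam Q (B `*` (A `*` setT))).
      rewrite /L lawE; congr (pprod lam Q _).
      by apply/seteqP; split => [[u [s y]] []|[u [s y]] [? []]].
    rewrite !pprodX// muleC; congr (_ * _); rewrite lawE; congr (Q _).
    by apply/seteqP; split => [[s y] []|[s y] Ay].
  have mnG : measurable (~` G) by exact: measurableC.
  apply: etrans (LE _ (preim_measurable msr mnG)) _.
  apply: etrans (rQ _ mnG) _.
  by apply: etrans (probability_setC Q mG) _; rewrite [X in _ - X]QG subee.
have [u u0] : exists u, Q (xsection W u) = 0.
  apply: (@ae_exists _ _ _ lam).
  have : \int[lam]_u `|Q (xsection W u)| = 0.
    rewrite -[RHS]W0 pprodE; apply: eq_integral => u _.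
    by rewrite gee0_abs.
  move/(ae_eq_integral_abs _ measurableT).
  by move=> /(_ (measurable_fun_xsection _ mW)); apply: filterS => u; exact.
have mu : measurable_fun setT (fun s => (s, u) : S * R) by exact: measurable_fun_pair.
exists (fun s => r (s, u)); first exact: measurableT_comp.
have H1 : {ae Q, forall p, G p} by exact: ae_of_prob1.
have H2 : {ae Q, forall p, G (p.1, r (p.1, u))}.
  exists (xsection W u); split; [exact: measurable_xsection|exact: u0|].
  by move=> [s y] /= nG; rewrite /xsection /= inE.
by apply: filterS2 H1 H2 => -[s y] /= Gy Gr; exact: Gfun Gy Gr.
Qed.

End graph_lemma.

(** This is [transfer] with a one-point first coordinate: a pair of independent uniform variables is
    the image of a single one. *)
Lemma split_lam (R : realType) : exists f g : R -> R,
  [/\ measurable_fun setT f, measurable_fun setT g &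
   forall W, measurable W -> lam ((fun u => (f u, g u)) @^-1` W) = pprod lam lam W].
Proof.
have ms : measurable_fun setT (fun p : R * R => (tt, p)).
  exact: measurable_fun_pair.
have [r mr rQ] := transfer (law (pprod lam lam) ms) (@R2_standard R).
have mtt : measurable_fun setT (fun u : R => (tt, u)) by exact: measurable_fun_pair.
exists (fun u => (r (tt, u)).1), (fun u => (r (tt, u)).2); split.
- by apply: measurableT_comp => //; exact: measurableT_comp.
- by apply: measurableT_comp => //; exact: measurableT_comp.
- move=> W mW; have mTW : measurable ([set: unit] `*` W) by exact: measurableX.
  transitivity (law (pprod lam lam) ms ([set: unit] `*` W)); last first.
    by rewrite lawE; congr (pprod _ _ _); apply/seteqP; split => [p []|p Wp].
  rewrite -rQ//.
  have -> : (fun p : unit * R => (p.1, r p)) @^-1` ([set: unit] `*` W) =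
      [set: unit] `*` ((fun u => r (tt, u)) @^-1` W).
    by apply/seteqP; split => [[[] u] []|[[] u] []].
  rewrite pprodX//; last by apply: preim_measurable => //; exact: measurableT_comp.
  rewrite probability_setT mul1e; congr (lam _).
  by apply/seteqP; split => u /=; case: (r (tt, u)).
Qed.

(** * Innovations *)

(** Equality is tested on the real codes, as two inequalities. *)
Lemma measurable_eq_standard (R : realType) d1 d2 (S : measurableType d1)
    (T : measurableType d2) (f g : S -> T) : standard_space R T ->
  measurable_fun setT f -> measurable_fun setT g -> measurable [set s | f s = g s].
Proof.
move=> [e [j [me mj ej _]]] mf mg.
rewrite (_ : [set s | _] = [set s | (e (f s) <= e (g s))%R] `&` [set s | (e (g s) <= e (f s))%R]).
  have mef := measurableT_comp me mf; have meg := measurableT_comp me mg.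
  by apply: measurableI; rewrite -[X in measurable X]setTI; exact: measurable_fun_ler.
apply/seteqP; split => s /=; first by move=> ->.
by move=> [h1 h2]; rewrite -[LHS]ej -[RHS]ej; congr j; apply/eqP; rewrite eq_le h1 h2.
Qed.

(** The integrals are compared only over events generated by [phi], but both integrands are
    functions of [phi]: they agree almost everywhere for the law of [phi], hence for [m], hence over
    every event. *)
Lemma integral_upgrade (R : realType) d1 d2 (S : measurableType d1)
    (S' : measurableType d2) (m : probability S R) (phi : S -> S')
    (h1 h2 : S' -> \bar R) :
  measurable_fun setT phi ->
  measurable_fun setT h1 -> measurable_fun setT h2 ->
  (forall s, 0 <= h1 s <= 1) -> (forall s, 0 <= h2 s <= 1) ->
  (forall A, measurable A -> \int[m]_(s in phi @^-1` A) h1 (phi s) =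
    \int[m]_(s in phi @^-1` A) h2 (phi s)) ->
  forall E, measurable E -> \int[m]_(s in E) h1 (phi s) = \int[m]_(s in E) h2 (phi s).
Proof.
move=> mphi mh1 mh2 h1_01 h2_01 H E mE.
have fin (h : S' -> \bar R) : (forall s, 0 <= h s <= 1) -> forall s, (fine (h s))%:E = h s.
  move=> h01 s; rewrite fineK//; have /andP[h0 hle] := h01 s.
  by rewrite ge0_fin_numE// (le_lt_trans hle)// ltry.
have ge0 (h : S' -> \bar R) : (forall s, 0 <= h s <= 1) -> forall s, (0 <= fine (h s))%R.
  by move=> h01 s; rewrite fine_ge0//; case/andP: (h01 s).
have mfine h : measurable_fun setT h -> measurable_fun setT (fine \o h : S' -> R).
  by move=> mh; exact: measurableT_comp.
have : {ae law m mphi, forall s, fine (h1 s) = fine (h2 s)}.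
  apply: (@integral_eq_ae R _ S' (law m mphi) (fine \o h1) (fine \o h2)).
  - exact: mfine.
  - exact: mfine.
  - exact: ge0.
  - exact: ge0.
  - apply: (@le_lt_trans _ _ (\int[law m mphi]_s (cst 1) s)).
      apply: ge0_le_integral => //.
      + by move=> s _; rewrite lee_fin; exact: ge0.
      + by apply/measurable_EFinP; exact: mfine.
      + by move=> s _; rewrite [leLHS]fin//; case/andP: (h2_01 s).
    rewrite integral_cst// mul1e.
    exact: le_lt_trans (probability_le1 (law m mphi) measurableT) (ltry _).
  - move=> A mA; rewrite (eq_integral h1) => [|s _]; last exact: fin.
    rewrite [RHS](eq_integral h2) => [|s _]; last exact: fin.
    have h10 s : 0 <= h1 s by case/andP: (h1_01 s).
    have h20 s : 0 <= h2 s by case/andP: (h2_01 s).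
    apply: etrans (ge0_integral_law m mphi mA mh1 h10) _.
    by apply: etrans _ (esym (ge0_integral_law m mphi mA mh2 h20)); exact: H.
move=> [N [mN N0 hN]]; apply: ge0_ae_eq_integral => //.
- by apply: measurable_funTS; exact: measurableT_comp.
- by apply: measurable_funTS; exact: measurableT_comp.
- by move=> s _; case/andP: (h1_01 (phi s)).
- by move=> s _; case/andP: (h2_01 (phi s)).
- exists (phi @^-1` N); split => //; first exact: preim_measurable.
  move=> s /= h; apply: hN => /= h'; apply: h => _.
  by rewrite -(fin _ h1_01) h' fin.
Qed.

Section product_facts.
Context {R : realType}.

Lemma pprod_section d1 d2 (S : measurableType d1) (S' : measurableType d2)
    (m : probability S R) (m' : probability S' R) (E : set S) (W : set (S * S')) :
  measurable E -> measurable W ->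
  pprod m m' ((E `*` setT) `&` W) = \int[m]_(s in E) m' (xsection W s).
Proof.
move=> mE mW; rewrite pprodE [RHS]integral_mkcond; apply: eq_integral => s _.
rewrite patchE; case: ifPn => sE.
  congr (m' _); apply/seteqP; split => u; rewrite /xsection /= !inE; first by case.
  by move=> Wu; split => //; split => //=; rewrite inE in sE.
rewrite (_ : xsection _ _ = set0) ?measure0//; apply/seteqP; split => // u.
by rewrite /xsection /= inE => -[[/= Es _] _]; rewrite notin_setE in sE.
Qed.

Lemma pprod_assoc d1 d2 d3 (S1 : measurableType d1) (S2 : measurableType d2)
    (S3 : measurableType d3) (m1 : probability S1 R) (m2 : probability S2 R)
    (m3 : probability S3 R) W : measurable W ->
  pprod m1 (pprod m2 m3) ((fun p => ((p.1, p.2.1), p.2.2)) @^-1` W) =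
  pprod (pprod m1 m2) m3 W.
Proof.
have mf : measurable_fun setT (fun p : S1 * (S2 * S3) => ((p.1, p.2.1), p.2.2)).
  apply: measurable_fun_pair; last exact: measurableT_comp.
  by apply: measurable_fun_pair => //; exact: measurableT_comp.
rewrite -lawE; apply: (prob_eq_rect (P1 := law (pprod m1 (pprod m2 m3)) mf)) => A B mA mB.
rewrite pprodX// [in RHS]pprodE -ge0_integralZr//; last first.
  exact: measurable_fun_xsection.
rewrite lawE pprodE; apply: eq_integral => s _; rewrite -pprodX//; last first.
  exact: measurable_xsection.
congr (pprod m2 m3 _); apply/seteqP; split => -[a b]; rewrite /xsection /= !inE /=.
  by move=> [].
by move=> [].
Qed.

End product_facts.

(* Unification would otherwise unfold these towers of measure constructions. *)
Opaque lam pprod law.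

Section product_maps.
Context {R : realType} d1 d2 d3 (S1 : measurableType d1) (S2 : measurableType d2)
  (S3 : measurableType d3).

Lemma pprod_map1 (P1 : probability S1 R) (P2 : probability S2 R)
    (P3 : probability S3 R) (f : S1 -> S2) :
  measurable_fun setT f -> (forall C, measurable C -> P1 (f @^-1` C) = P2 C) ->
  forall W, measurable W ->
  pprod P1 P3 ((fun p => (f p.1, p.2)) @^-1` W) = pprod P2 P3 W.
Proof.
move=> mf P12 W mW.
have mf3 : measurable_fun setT (fun p : S1 * S3 => (f p.1, p.2)).
  by apply: measurable_fun_pair => //; exact: measurableT_comp.
rewrite -lawE; move: W mW; apply: prob_eq_rect => A B mA mB.
transitivity (pprod P1 P3 ((f @^-1` A) `*` B)).
  by rewrite lawE; congr (pprod _ _ _); apply/seteqP; split => -[s u] [].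
have mfA := preim_measurable mf mA.
apply: etrans (pprodX P1 P3 mfA mB) _.
by apply: etrans _ (esym (pprodX P2 P3 mA mB)); congr (_ * _); exact: P12.
Qed.

Lemma pprod_map2 (P1 : probability S1 R) (P2 : probability S2 R)
    (P3 : probability S3 R) (f : S1 -> S2) :
  measurable_fun setT f -> (forall C, measurable C -> P1 (f @^-1` C) = P2 C) ->
  forall W, measurable W ->
  pprod P3 P1 ((fun p => (p.1, f p.2)) @^-1` W) = pprod P3 P2 W.
Proof.
move=> mf P12 W mW.
have mf3 : measurable_fun setT (fun p : S3 * S1 => (p.1, f p.2)).
  by apply: measurable_fun_pair => //; exact: measurableT_comp.
rewrite -lawE; move: W mW; apply: prob_eq_rect => A B mA mB.
transitivity (pprod P3 P1 (A `*` (f @^-1` B))).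
  by rewrite lawE; congr (pprod _ _ _); apply/seteqP; split => -[s u] [].
have mfB := preim_measurable mf mB.
apply: etrans (pprodX P3 P1 mA mfB) _.
by apply: etrans _ (esym (pprodX P3 P2 mA mB)); congr (_ * _); exact: P12.
Qed.

End product_maps.

Section step_lemma.
Context {R : realType} dO dS dT (O : measurableType dO) (S : measurableType dS)
  (T : measurableType dT) (P : probability O R).
Context (m : probability S R) (Xi : O -> S) (mXi : measurable_fun setT Xi).
Context (x z : S -> T) (mx : measurable_fun setT x) (mz : measurable_fun setT z).
Context (x' : O -> T) (mx' : measurable_fun setT x').
Context (eta : O -> R) (meta : measurable_fun setT eta).
Context (k1 k2 : R.-pker T ~> T).
Context (Q : probability ((T * T) * (T * T))%type R).
Hypothesis stdT : standard_space R T.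
Hypothesis H : forall E B D, measurable E -> measurable B -> measurable D ->
  P (Xi @^-1` E `&` x' @^-1` B `&` eta @^-1` D) =
  (\int[m]_(s in E) k1 (x s) B) * lam D.
Hypothesis HQ1 : forall A B, measurable A -> measurable B ->
  Q (A `*` (B `*` setT)) = \int[m]_(s in (fun s => (x s, z s)) @^-1` A) k1 (x s) B.
Hypothesis HQ2 : forall A B, measurable A -> measurable B ->
  Q (A `*` (setT `*` B)) = \int[m]_(s in (fun s => (x s, z s)) @^-1` A) k2 (z s) B.

Let xz s := (x s, z s).
Let mxz : measurable_fun setT xz. Proof. exact: measurable_fun_pair. Qed.

Let mk (k : R.-pker T ~> T) (y : S -> T) B : measurable B -> measurable_fun setT y ->
  measurable_fun setT (fun s => k (y s) B).
Proof. by move=> mB my; exact: measurableT_comp (measurable_kernel k _ mB) my. Qed.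

Let k01 (k : R.-pker T ~> T) B : measurable B -> forall s, 0 <= k s B <= 1.
Proof.
move=> mB s; rewrite measure_ge0/= -(prob_kernel (s := k) s).
by apply: le_measure; rewrite ?inE.
Qed.

Let lam_section01 d (S' : measurableType d) (W : set (S' * R)) s :
  measurable W -> 0 <= lam (xsection W s) <= 1.
Proof.
by move=> mW; rewrite measure_ge0/= probability_le1//; exact: measurable_xsection.
Qed.

Let k_total (k : R.-pker T ~> T) (y : S -> T) E : measurable E ->
  m E = \int[m]_(s in E) k (y s) setT.
Proof.
move=> mE; rewrite (eq_integral (cst 1)) => [|s _]; last exact: prob_kernel.
by rewrite integral_cst// mul1e.
Qed.

(** The uniform coordinate is independent of the whole past, and [W] sees the past only through
    [phi]. A conditional probability given [phi] is thus one given the past, and events generated by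
    [phi] suffice to identify it. *)
Lemma innovation_section d (S' : measurableType d) (phi : S -> S')
    (W : set (S' * R)) (h : S' -> \bar R) :
  measurable_fun setT phi -> measurable W ->
  measurable_fun setT h -> (forall s, 0 <= h s <= 1) ->
  (forall A, measurable A -> pprod m lam ([set p | A (phi p.1) /\ W (phi p.1, p.2)])
    = \int[m]_(s in phi @^-1` A) h (phi s)) ->
  forall E, measurable E -> pprod m lam ([set p | E p.1 /\ W (phi p.1, p.2)]) =
    \int[m]_(s in E) h (phi s).
Proof.
move=> mphi mW mh h01 HA.
have mphi2 : measurable_fun setT (fun p : S * R => (phi p.1, p.2)).
  by apply: measurable_fun_pair => //; exact: measurableT_comp.
have eqE E : measurable E -> pprod m lam ([set p | E p.1 /\ W (phi p.1, p.2)]) =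
    \int[m]_(s in E) lam (xsection W (phi s)).
  move=> mE; have mWphi := preim_measurable mphi2 mW.
  apply: etrans _ (pprod_section m lam mE mWphi).
  by congr (pprod m lam _); apply/seteqP; split => -[s u] [] //= [].
move=> E mE; apply: etrans (eqE _ mE) _.
apply: (@integral_upgrade _ _ _ _ _ m phi (fun s => lam (xsection W s)) h) => //.
- exact: measurable_fun_xsection.
- by move=> s; exact: lam_section01.
- move=> A mA; have mpA := preim_measurable mphi mA.
  exact: etrans (esym (eqE _ mpA)) (HA _ mA).
Qed.

Let Qz := law Q (measurable_fun_pair
  (measurableT_comp (@measurable_snd _ _ T T) (@measurable_fst _ _ (T * T)%type (T * T)%type))
  (measurableT_comp (@measurable_snd _ _ T T) (@measurable_snd _ _ (T * T)%type (T * T)%type))).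

(** [g] is the conditional quantile function for the law of the old and new second states, [x] being
    left out of the conditioning. As [k2] depends on [z] only, the result still has the right law
    given the whole past. *)
Lemma step_second : exists2 g : T * R -> T, measurable_fun setT g &
  forall E B, measurable E -> measurable B ->
    pprod m lam [set p | E p.1 /\ B (g (z p.1, p.2))] = \int[m]_(s in E) k2 (z s) B.
Proof.
have [g mg gQ] := transfer Qz stdT; exists g => // E B mE mB.
apply: (@innovation_section _ T z (g @^-1` B) (fun t => k2 t B)) => //.
- exact: preim_measurable.
- exact: measurable_kernel.
- exact: k01.
- move=> A mA.
  have QzA A' : measurable A' -> forall C, measurable C -> Qz (A' `*` C) = \int[m]_(s in z @^-1` A') k2 (z s) C.
    move=> mA' C mC; have -> : z @^-1` A' = xz @^-1` (setT `*` A').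
      by apply/seteqP; split => s /=; [|case].
    have mTA := measurableX (@measurableT _ T) mA'.
    apply: etrans _ (HQ2 mTA mC); rewrite /Qz lawE; congr (Q _).
    by apply/seteqP; split => -[[a b] [c e]] /=; [move=> []|move=> [[_ ?] [_ ?]]].
  have mzg : measurable_fun setT (fun p : S * R => (z p.1, p.2)).
    by apply: measurable_fun_pair => //; exact: measurableT_comp.
  have E1 : forall W, measurable W -> law (pprod m lam) mzg W = pprod (law Qz measurable_fst) lam W.
    move=> W mW; rewrite lawE; apply: pprod_map1 => // C mC.
    apply: etrans (k_total k2 z (preim_measurable mz mC)) _.
    apply: etrans (esym (QzA _ mC _ measurableT)) _.
    transitivity (Qz (fst @^-1` C)); last by rewrite lawE.
    by congr (Qz _); apply/seteqP; split => -[a b] // [].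
  have mgB : measurable (g @^-1` B) by exact: preim_measurable.
  have mAg : measurable ((A `*` setT) `&` g @^-1` B).
    by apply: measurableI => //; exact: measurableX.
  transitivity (law (pprod m lam) mzg ((A `*` setT) `&` g @^-1` B)).
    rewrite lawE; congr (pprod m lam _); apply/seteqP.
    by split => -[s u] /= [] // [].
  apply: etrans (E1 _ mAg) _; apply: etrans _ (QzA _ mA _ mB).
  apply: etrans _ (gQ _ (measurableX mA mB)).
  congr (pprod _ lam _); apply/seteqP.
  by split => -[s u] /= [] // [].
Qed.

Let Q2 := law Q (measurable_fun_pair
  (measurable_fun_pair (@measurable_fst _ _ (T * T)%type (T * T)%type)
    (measurableT_comp (@measurable_snd _ _ T T) (@measurable_snd _ _ (T * T)%type (T * T)%type)))
  (measurableT_comp (@measurable_fst _ _ T T) (@measurable_snd _ _ (T * T)%type (T * T)%type))).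

(** The uniform variable is split into two independent ones. One produces the new second state from
    [z]; the other produces the new first state from its conditional law under [Q] given the old
    pair and the new second state. [Q2] lists the variables in that order. *)
Lemma step_model : exists (g : T * R -> T) (rho : (T * T) * R -> T),
  [/\ measurable_fun setT g, measurable_fun setT rho,
    forall E B, measurable E -> measurable B ->
      pprod m lam [set p | E p.1 /\ B (g (z p.1, p.2))] = \int[m]_(s in E) k2 (z s) B &
    forall W, measurable W ->
      pprod m lam [set p | W (xz p.1, (rho (xz p.1, p.2), g (z p.1, p.2)))] = Q W].
Proof.
have [g0 mg0 g0E] := step_second.
have [f1 [f2 [mf1 mf2 f12]]] := split_lam R.
have [r0 mr0 r0Q] := transfer Q2 stdT.
pose g (q : T * R) := g0 (q.1, f1 q.2).
have mg : measurable_fun setT g.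
  apply: measurableT_comp => //; apply: measurable_fun_pair => //.
  exact: measurableT_comp.
pose rho (q : (T * T) * R) := r0 ((q.1, g (q.1.2, q.2)), f2 q.2).
have mrho : measurable_fun setT rho.
  apply: measurableT_comp => //; apply: measurable_fun_pair; last exact: measurableT_comp.
  apply: measurable_fun_pair => //; apply: measurableT_comp => //.
  by apply: measurable_fun_pair => //; exact: measurableT_comp.
have mf12 : measurable_fun setT (fun u => (f1 u, f2 u)) by exact: measurable_fun_pair.
have a2 W : measurable W ->
    pprod m lam ((fun p => ((p.1, f1 p.2), f2 p.2)) @^-1` W) = pprod (pprod m lam) lam W.
  move=> mW; apply: etrans _ (pprod_assoc m lam lam mW).
  apply: etrans _ (pprod_map2 (P1 := lam) m mf12 f12 _); first by [].
  apply: preim_measurable => //.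
  apply: measurable_fun_pair; last exact: measurableT_comp.
  by apply: measurable_fun_pair => //; exact: measurableT_comp.
have mxg : measurable_fun setT (fun p : S * R => (xz p.1, g0 (z p.1, p.2))).
  apply: measurable_fun_pair; first exact: measurableT_comp.
  apply: measurableT_comp => //; apply: measurable_fun_pair => //.
  exact: measurableT_comp.
have a3 W : measurable W ->
    pprod m lam ((fun p => (xz p.1, g0 (z p.1, p.2))) @^-1` W) = law Q2 measurable_fst W.
  rewrite -lawE; move: W; apply: prob_eq_rect => A B mA mB.
  have mxzA := preim_measurable mxz mA.
  transitivity (pprod m lam [set p | (xz @^-1` A) p.1 /\ B (g0 (z p.1, p.2))]).
    by rewrite lawE; congr (pprod m lam _); apply/seteqP; split => -[s u] [].
  apply: etrans (g0E _ _ mxzA mB) _; apply: etrans (esym (HQ2 mA mB)) _.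
  rewrite [RHS]lawE /Q2 [RHS]lawE; congr (Q _); apply/seteqP.
  by split => -[p [y y']] /=; [move=> [? []]|move=> []].
have a4 W : measurable W ->
    pprod (pprod m lam) lam ((fun q => ((xz q.1.1, g0 (z q.1.1, q.1.2)), q.2)) @^-1` W) =
    pprod (law Q2 measurable_fst) lam W.
  by move=> mW; apply: (pprod_map1 lam mxg a3).
exists g, rho; split => //.
- move=> E B mE mB; rewrite -g0E//.
  have mW : measurable [set q : (S * R) * R | E q.1.1 /\ B (g0 (z q.1.1, q.1.2))].
    apply: measurableI.
      exact: (preim_measurable (measurableT_comp (@measurable_fst _ _ S R) measurable_fst)).
    apply: (preim_measurable _ mB) => /=; apply: measurableT_comp => //.
    apply: measurable_fun_pair; last exact: measurableT_comp.
    by apply: measurableT_comp => //; exact: measurableT_comp.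
  apply: etrans (a2 _ mW) _.
  have mV : measurable [set p : S * R | E p.1 /\ B (g0 (z p.1, p.2))].
    apply: measurableI; first exact: (preim_measurable measurable_fst).
    apply: (preim_measurable _ mB) => /=; apply: measurableT_comp => //.
    by apply: measurable_fun_pair => //; exact: measurableT_comp.
  transitivity (pprod (pprod m lam) lam ([set p : S * R | E p.1 /\ B (g0 (z p.1, p.2))] `*` setT)).
    by congr (pprod _ _ _); apply/seteqP; split => -[[s u] u'] //= [].
  by rewrite pprodX// probability_setT mule1.
- move=> W mW.
  pose V := [set q : ((T * T) * T) * T | W (q.1.1, (q.2, q.1.2))].
  have mV : measurable V.
    apply: (preim_measurable _ mW) => /=; apply: measurable_fun_pair.
      exact: measurableT_comp.
    by apply: measurable_fun_pair => //; exact: measurableT_comp.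
  have mr : measurable_fun setT (fun q => (q.1, r0 q)) by exact: measurable_fun_pair.
  have mrV := preim_measurable mr mV.
  have mxzg : measurable_fun setT
      (fun q : (S * R) * R => ((xz q.1.1, g0 (z q.1.1, q.1.2)), q.2)).
    apply: measurable_fun_pair => //; exact: (measurableT_comp mxg measurable_fst).
  transitivity (Q2 V); last by rewrite lawE; congr (Q _); apply/seteqP; split => -[p []].
  rewrite -r0Q//; apply: etrans _ (a4 _ mrV).
  by apply: etrans _ (a2 _ (preim_measurable mxzg mrV)).
Qed.

Let PXi E : measurable E -> P (Xi @^-1` E) = m E.
Proof.
move=> mE; have := H mE (@measurableT _ T) (@measurableT _ R).
rewrite !preimage_setT !setIT => ->.
by rewrite probability_setT mule1 -k_total.
Qed.

(** In the model the innovation comes first and the next state is computed from it; here the next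
    state [x'] is given. [v] samples the innovation from its conditional law in the model given the
    past and the next state, with [eta] as source of randomness, so the past, the next state and the
    innovation get the joint law of the model. *)
Lemma step_innovation : exists (v : (S * T) * R -> R) (g : T * R -> T) (rho : (T * T) * R -> T),
  let V w := v ((Xi w, x' w), eta w) in
  [/\ [/\ measurable_fun setT v, measurable_fun setT g & measurable_fun setT rho],
    forall E D, measurable E -> measurable D ->
      P (Xi @^-1` E `&` V @^-1` D) = P (Xi @^-1` E) * lam D,
    {ae P, forall w, x' w = rho (xz (Xi w), V w)},
    forall W, measurable W ->
      P [set w | W (xz (Xi w), (x' w, g (z (Xi w), V w)))] = Q W &
    forall E B, measurable E -> measurable B ->
      P (Xi @^-1` E `&` [set w | B (g (z (Xi w), V w))]) = \int[m]_(s in E) k2 (z s) B].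
Proof.
have [g [rho [mg mrho gE rhoE]]] := step_model.
have mxzp : measurable_fun setT (fun p : S * R => (xz p.1, p.2)).
  by apply: measurable_fun_pair => //; exact: measurableT_comp.
have mzp : measurable_fun setT (fun p : S * R => (z p.1, p.2)).
  by apply: measurable_fun_pair => //; exact: measurableT_comp.
have mrhop : measurable_fun setT (fun p : S * R => rho (xz p.1, p.2)).
  exact: (measurableT_comp mrho mxzp).
have mq : measurable_fun setT (fun p : S * R => ((p.1, rho (xz p.1, p.2)), p.2)).
  by apply: measurable_fun_pair => //; exact: measurable_fun_pair.
pose Q3 := law (pprod m lam) mq.
have [v mv vQ] := transfer Q3 (@R_standard R).
have mXx : measurable_fun setT (fun w => (Xi w, x' w)) by exact: measurable_fun_pair.
have mXxe : measurable_fun setT (fun w => ((Xi w, x' w), eta w)) by exact: measurable_fun_pair.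
have rho_law E B : measurable E -> measurable B ->
    law Q3 measurable_fst (E `*` B) = \int[m]_(s in E) k1 (x s) B.
  move=> mE mB; have mrB : measurable (rho @^-1` B) by exact: preim_measurable.
  transitivity (pprod m lam [set p | E p.1 /\ (rho @^-1` B) (xz p.1, p.2)]).
    by rewrite lawE /Q3 lawE.
  have mk1 : measurable_fun setT (fun p : T * T => k1 p.1 B).
    exact: (measurableT_comp (measurable_kernel k1 _ mB) measurable_fst).
  apply: (@innovation_section _ (T * T)%type xz (rho @^-1` B) (fun p => k1 p.1 B)) => //.
    by move=> s; exact: k01.
  move=> A mA; apply: etrans _ (HQ1 mA mB).
  apply: etrans _ (rhoE _ (measurableX mA (measurableX mB (@measurableT _ T)))).
  by congr (pprod m lam _); apply/seteqP; split => -[s u] /=; [case|case=> ? []].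
have law3 W : measurable W ->
    law P mXxe W = pprod (law Q3 measurable_fst) lam W.
  move: W; apply: prob_eq_rect => W D mW mD.
  transitivity (slice (law P mXxe) mD W); first by [].
  transitivity (slice (pprod (law Q3 measurable_fst) lam) mD W); last by [].
  apply: measure_eq_rect mW => [E B mE mB|]; last first.
    apply: le_lt_trans (ltry 1%R); rewrite /slice; apply: probability_le1.
    exact: measurableX.
  rewrite /slice; apply: etrans _ (esym (pprodX _ lam (measurableX mE mB) mD)).
  transitivity (P (Xi @^-1` E `&` x' @^-1` B `&` eta @^-1` D)).
    by apply: etrans (lawE P mXxe _) _.
  by apply: etrans (H mE mB mD) _; congr (_ * _); rewrite rho_law.
have mvv : measurable_fun setT (fun q => (q.1, v q)) by exact: measurable_fun_pair.
(* The joint law of past, next state and innovation is that of the model; the remaining claims are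
   read off from this identity. *)
have main W : measurable W ->
    P [set w | W ((Xi w, x' w), v ((Xi w, x' w), eta w))] =
    pprod m lam [set p | W ((p.1, rho (xz p.1, p.2)), p.2)].
  move=> mW; have mvW := preim_measurable mvv mW.
  transitivity (law P mXxe ((fun q => (q.1, v q)) @^-1` W)); first by rewrite lawE.
  apply: etrans (law3 _ mvW) _; apply: etrans (vQ _ mW) _.
  by rewrite lawE.
exists v, g, rho; split => //.
- move=> E D mE mD; rewrite PXi//; apply: etrans _ (pprodX m lam mE mD).
  have mW := measurableX (measurableX mE (@measurableT _ T)) mD.
  transitivity (P [set w | ((E `*` setT) `*` D) ((Xi w, x' w), v ((Xi w, x' w), eta w))]).
    by congr (P _); apply/seteqP; split => w [] // [].
  apply: etrans (main _ mW) _; congr (pprod m lam _); apply/seteqP.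
  by split => -[s u] [] // [].
- pose W := [set q : (S * T) * R | q.1.2 = rho (xz q.1.1, q.2)].
  have mW : measurable W.
    apply: (measurable_eq_standard stdT).
      exact: (measurableT_comp (@measurable_snd _ _ S T) (@measurable_fst _ _ (S * T)%type R)).
    apply: measurableT_comp => //; apply: measurable_fun_pair => //.
    exact: (measurableT_comp mxz (measurableT_comp (@measurable_fst _ _ S T)
      (@measurable_fst _ _ (S * T)%type R))).
  apply: (@ae_of_prob1 _ _ _ P [set w | W ((Xi w, x' w), v ((Xi w, x' w), eta w))]).
    have mm : measurable_fun setT (fun w => ((Xi w, x' w), v ((Xi w, x' w), eta w))).
      by apply: measurable_fun_pair => //; exact: measurableT_comp.
    exact: (preim_measurable mm mW).
  apply: etrans (main _ mW) _; rewrite (_ : [set p | _] = setT) ?probability_setT//.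
  by apply/seteqP; split.
- move=> W mW; apply: etrans _ (rhoE _ mW).
  have mm : measurable_fun setT (fun q : (S * T) * R => (xz q.1.1, (q.1.2, g (z q.1.1, q.2)))).
    apply: measurable_fun_pair; first by apply: measurableT_comp => //; exact: measurableT_comp.
    apply: measurable_fun_pair; first exact: measurableT_comp.
    apply: measurableT_comp => //; apply: measurable_fun_pair => //.
    by apply: measurableT_comp => //; exact: measurableT_comp.
  exact: (main _ (preim_measurable mm mW)).
- move=> E B mE mB; apply: etrans _ (gE _ _ mE mB).
  have mW : measurable [set q : (S * T) * R | E q.1.1 /\ B (g (z q.1.1, q.2))].
    apply: measurableI.
      exact: (preim_measurable (measurableT_comp measurable_fst (@measurable_fst _ _ (S * T)%type R)) mE).
    apply: (preim_measurable _ mB) => /=.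
    apply: measurableT_comp => //; apply: measurable_fun_pair => //.
    by apply: measurableT_comp => //; exact: measurableT_comp.
  exact: (main _ mW).
Qed.

End step_lemma.

(** * Filtrations and driven chains *)

Definition adapted {O : Type} {d} {T : measurableType d} (F : set (set O))
  (Y : O -> T) := forall B : set T, measurable B -> F (Y @^-1` B).

Section filtration_facts.
Context {R : realType} dO (O : measurableType dO) (F : set (set O)).
Hypothesis sF : sigma_algebra setT F.

Lemma measurable_gE : @measurable _ (g_sigma_algebraType F) = F.
Proof. exact: sigma_algebra_id. Qed.

Lemma filtC E : F E -> F (~` E).
Proof. by rewrite -measurable_gE; exact: measurableC. Qed.

Lemma filtI E E' : F E -> F E' -> F (E `&` E').
Proof. by rewrite -measurable_gE; exact: measurableI. Qed.

Lemma filtU E E' : F E -> F E' -> F (E `|` E').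
Proof. by rewrite -measurable_gE; exact: measurableU. Qed.

Lemma filtT : F setT.
Proof. by rewrite -measurable_gE. Qed.

Lemma filt0 : F set0.
Proof. by rewrite -measurable_gE. Qed.

Lemma filt_bigcup (E : nat -> set O) : (forall i, F (E i)) -> F (\bigcup_i E i).
Proof. by rewrite -measurable_gE; exact: bigcupT_measurable. Qed.

Lemma filt_bigcap (E : nat -> set O) : (forall i, F (E i)) -> F (\bigcap_i E i).
Proof. by rewrite -measurable_gE; exact: bigcapT_measurable. Qed.

Lemma adaptedP d (T : measurableType d) (Y : O -> T) :
  adapted F Y <-> @measurable_fun _ _ (g_sigma_algebraType F) T setT Y.
Proof.
split => h; first by move=> _ B mB; rewrite setTI measurable_gE; exact: h.
by move=> B mB; have := preim_measurable h mB; rewrite measurable_gE.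
Qed.

Lemma adapted_comp d1 d2 (T1 : measurableType d1) (T2 : measurableType d2)
    (Y : O -> T1) (f : T1 -> T2) :
  adapted F Y -> measurable_fun setT f -> adapted F (f \o Y).
Proof. by move=> aY mf B mB; exact: (aY _ (preim_measurable mf mB)). Qed.

Lemma adapted_pair d1 d2 (T1 : measurableType d1) (T2 : measurableType d2)
    (Y1 : O -> T1) (Y2 : O -> T2) :
  adapted F Y1 -> adapted F Y2 -> adapted F (fun w => (Y1 w, Y2 w)).
Proof.
by move=> /adaptedP a1 /adaptedP a2; apply/adaptedP; exact: measurable_fun_pair.
Qed.

Lemma adapted_cst d (T : measurableType d) (c : T) : adapted F (cst c).
Proof. by apply/adaptedP; exact: measurable_cst. Qed.

Hypothesis Fm : F `<=` measurable.

Lemma adapted_measurable d (T : measurableType d) (Y : O -> T) :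
  adapted F Y -> measurable_fun setT Y.
Proof. by move=> aY _ B mB; rewrite setTI; apply: Fm; exact: aY. Qed.

(** Pushing [P] forward along the identity presents its restriction to [F] as a probability on a
    measurable type of its own, so that the past itself can serve as a coordinate. *)
Lemma measurable_id_sub :
  @measurable_fun _ _ O (g_sigma_algebraType F) setT id.
Proof. by move=> _ B; rewrite measurable_gE setTI => /Fm. Qed.

Lemma integral_sub (P : probability O R) E (h : O -> \bar R) :
  F E -> @measurable_fun _ _ (g_sigma_algebraType F) _ setT h ->
  (forall w, 0 <= h w) ->
  \int[law P measurable_id_sub]_(s in E) h s = \int[P]_(w in E) h w.
Proof.
move=> FE mh h0.
have mE : @measurable _ (g_sigma_algebraType F) E by rewrite measurable_gE.
exact: (ge0_integral_law P measurable_id_sub mE mh h0).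
Qed.

End filtration_facts.

(* Given [F n], the next state has law [K n (X n)] and [eta (n + 1)] is an independent
   uniform variable, which provides the randomness for the couplings. *)
Record driven (R : realType) dO (O : measurableType dO) (P : probability O R)
    dT (T : measurableType dT) (F : int -> set (set O)) (X : int -> O -> T)
    (eta : int -> O -> R) (K : int -> R.-pker T ~> T) : Prop := Driven {
  driven_sigma : forall n, sigma_algebra setT (F n);
  driven_meas : forall n : int, (n <= 0)%R -> F n `<=` measurable;
  driven_incr : forall n : int, F n `<=` F (n + 1)%R;
  driven_X : forall n : int, (n <= 0)%R -> adapted (F n) (X n);
  driven_eta : forall n : int, (n <= 0)%R -> adapted (F n) (eta n);
  driven_step : forall (n : int) E B D, (n < 0)%R -> F n E -> measurable B -> measurable D ->
    P (E `&` X (n + 1)%R @^-1` B `&` eta (n + 1)%R @^-1` D) =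
    (\int[P]_(w in E) K n (X n w) B) * lam D }.

Section driven_facts.
Context {R : realType} dO (O : measurableType dO) (P : probability O R)
  dT (T : measurableType dT) (F : int -> set (set O)) (X : int -> O -> T)
  (eta : int -> O -> R) (K : int -> R.-pker T ~> T).
Hypothesis dr : driven P F X eta K.
Hypothesis stdT : standard_space R T.

Lemma driven_markov (n : int) E B : (n < 0)%R -> F n E -> measurable B ->
  P (E `&` X (n + 1)%R @^-1` B) = \int[P]_(w in E) K n (X n w) B.
Proof.
move=> n0 FE mB; have := driven_step dr n0 FE mB (@measurableT _ R).
by rewrite preimage_setT setIT probability_setT mule1.
Qed.

Lemma driven_mono (n : int) (i : nat) : F n `<=` F (n + i%:Z)%R.
Proof.
elim: i => [|i IH]; first by rewrite addr0.
by move=> E /IH /(driven_incr dr); rewrite -addrA -PoszD addn1.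
Qed.

Lemma driven_le (n p : int) : (n <= p)%R -> F n `<=` F p.
Proof.
move=> np; have -> : p = (n + `|p - n|%N%:Z)%R.
  by rewrite gez0_abs ?subr_ge0// [RHS]addrC subrK.
exact: driven_mono.
Qed.

(** The first coordinate of [step_innovation] is taken to be the sample point itself with the
    sigma-field [F n]: independence then holds with respect to the whole past, not only to the
    current states. *)
Lemma driven_innovation (n : int) (Z : O -> T) (k2 : R.-pker T ~> T)
    (Q : probability ((T * T) * (T * T))%type R) :
  (n < 0)%R -> adapted (F n) Z ->
  (forall A B, measurable A -> measurable B ->
    Q (A `*` (B `*` setT)) =
    \int[P]_(w in (fun w => (X n w, Z w)) @^-1` A) K n (X n w) B) ->
  (forall A B, measurable A -> measurable B ->
    Q (A `*` (setT `*` B)) =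
    \int[P]_(w in (fun w => (X n w, Z w)) @^-1` A) k2 (Z w) B) ->
  exists (V : O -> R) (g : T * R -> T) (rho : (T * T) * R -> T),
  [/\ [/\ adapted (F (n + 1)%R) V, measurable_fun setT g & measurable_fun setT rho],
    forall E D, F n E -> measurable D -> P (E `&` V @^-1` D) = P E * lam D,
    {ae P, forall w, X (n + 1)%R w = rho ((X n w, Z w), V w)},
    forall W, measurable W ->
      P [set w | W ((X n w, Z w), (X (n + 1)%R w, g (Z w, V w)))] = Q W &
    forall E B, F n E -> measurable B ->
      P (E `&` [set w | B (g (Z w, V w))]) = \int[P]_(w in E) k2 (Z w) B].
Proof.
move=> n0 aZ HQ1 HQ2.
have n10 : (n + 1 <= 0)%R by rewrite -ltzD1 ltrD2r.
have sF := driven_sigma dr n; have Fm := driven_meas dr (ltW n0).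
have aX := driven_X dr (ltW n0).
pose S := g_sigma_algebraType (F n).
have mid := measurable_id_sub sF Fm.
have mE (E : set S) : measurable E <-> F n E by rewrite measurable_gE.
have mX1 := adapted_measurable (driven_meas dr n10) (driven_X dr n10).
have me1 := adapted_measurable (driven_meas dr n10) (driven_eta dr n10).
have mx := (adaptedP sF _).1 aX; have mz := (adaptedP sF _).1 aZ.
have mkx (k : R.-pker T ~> T) (y : S -> T) B : measurable_fun setT y -> measurable B ->
    measurable_fun [set: S] (fun w => k (y w) B).
  by move=> my mB; exact: (measurableT_comp (measurable_kernel k _ mB) my).
have intE (k : R.-pker T ~> T) (y : S -> T) E B : measurable_fun setT y -> F n E -> measurable B ->
    \int[law P mid]_(s in E) k (y s) B = \int[P]_(s in E) k (y s) B.
  by move=> my FE mB; apply: integral_sub => //; exact: mkx.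
have mA A : measurable A -> F n ((fun w => (X n w, Z w)) @^-1` A).
  exact: (adapted_pair sF aX aZ).
have [|A B mA' mB|A B mA' mB|v [g [rho [[mv mg mrho] c1 c2 c3 c4]]]] :=
  @step_innovation R _ _ _ O S T P (law P mid) id mid (X n) Z mx mz (X (n + 1)%R) mX1
    (eta (n + 1)%R) me1 (K n) k2 Q stdT.
- move=> E B D /mE FE mB mD; rewrite preimage_id.
  by apply: etrans (driven_step dr n0 FE mB mD) _; congr (_ * _); rewrite intE.
- by rewrite HQ1// intE//; exact: mA.
- by rewrite HQ2// intE//; exact: mA.
exists (fun w => v ((w, X (n + 1)%R w), eta (n + 1)%R w)), g, rho; split => //.
- split => //; have sF1 := driven_sigma dr (n + 1)%R.
  pose S1 := g_sigma_algebraType (F (n + 1)%R).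
  have mid1 : @measurable_fun _ _ S1 S setT id.
    by move=> _ E /mE FE; rewrite setTI preimage_id measurable_gE//; exact: (driven_incr dr).
  have mX1' : @measurable_fun _ _ S1 T setT (X (n + 1)%R).
    exact/(adaptedP sF1)/(driven_X dr n10).
  have me1' : @measurable_fun _ _ S1 R setT (eta (n + 1)%R).
    exact/(adaptedP sF1)/(driven_eta dr n10).
  apply/(adaptedP sF1).
  exact: (measurableT_comp mv (measurable_fun_pair (measurable_fun_pair mid1 mX1') me1')).
- by move=> E D FE mD; have := c1 _ _ ((mE _).2 FE) mD; rewrite preimage_id.
- move=> E B FE mB; have := c4 _ _ ((mE _).2 FE) mB; rewrite preimage_id => ->.
  by rewrite intE.
Qed.

End driven_facts.

(** * The restarted chain and its coupling with the given one *)

Definition kconst (R : realType) d1 d2 (S : measurableType d1) (T : measurableType d2)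
  (mu : probability T R) : R.-pker S ~> T :=
  kprobability (@measurable_cst _ _ S (pprobability T R) setT mu).

Lemma kconstE (R : realType) d1 d2 (S : measurableType d1) (T : measurableType d2)
  (mu : probability T R) (s : S) B : kconst S mu s B = mu B.
Proof. by []. Qed.

Lemma integral_indep (R : realType) dO dT (O : measurableType dO)
    (T : measurableType dT) (P : probability O R) (mu : probability T R)
    (Z : O -> T) (E : set O) (h : T -> \bar R) :
  measurable_fun setT Z -> measurable E ->
  (forall B, measurable B -> P (E `&` Z @^-1` B) = P E * mu B) ->
  measurable_fun setT h -> (forall y, 0 <= h y) ->
  \int[P]_(w in E) h (Z w) = P E * \int[mu]_y h y.
Proof.
move=> mZ mE EZ mh h0.
have cE c : \int[P]_(w in E) cst c w = P E * c by rewrite integral_cst// muleC.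
have EK B : measurable B ->
    P (E `&` Z @^-1` B) = \int[P]_(w in E) kconst T mu (Z w) B.
  by move=> mB; rewrite EZ//; exact: esym (cE _).
rewrite -cE; exact: (@integral_conditional R _ _ _ O T T P (kconst T mu) Z mZ Z mZ E mE EK h mh h0).
Qed.

(** The supports are replaced by a measurable set of full measure. In this form the coupling also
    applies to [Z n], which has the law of [X n], and passes to an enlarged probability space. *)
Definition order_coupled {R : realType} {dd : dimension} dO (O : measurableType dO)
    (P : probability O R) (X : int -> O -> Rd R dd)
    (K : int -> R.-pker (Rd R dd) ~> (Rd R dd)) :=
  forall n : int, (n < 0)%R ->
  exists (C : R.-pker (Rd R dd * Rd R dd)%type ~> (Rd R dd * Rd R dd)%type) (A : set (Rd R dd)),
  [/\ measurable A, P (X n @^-1` A) = 1 &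
    forall x x', A x -> A x' ->
    [/\ forall B, measurable B -> C (x, x') (B `*` setT) = K n x B,
        forall B, measurable B -> C (x, x') (setT `*` B) = K n x' B &
        forall k : Idx dd,
          ((x k <= x' k)%R -> C (x, x') [set p | (p.1 k <= p.2 k)%R] = 1%E) /\
          ((x' k <= x k)%R -> C (x, x') [set p | (p.2 k <= p.1 k)%R] = 1%E)]].

Section block.
Context {R : realType} {dd : dimension} dO (O : measurableType dO) (P : probability O R)
  (F : int -> set (set O)) (X : int -> O -> Rd R dd)
  (eta : int -> O -> R) (K : int -> R.-pker (Rd R dd) ~> (Rd R dd)).
Notation T := (Rd R dd).
Hypothesis dr : driven P F X eta K.
Hypothesis coupled : order_coupled P X K.

(* One step of the pair [(X, Z)]: [V] is the innovation; [Z] is restarted at time [a] and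
   then follows the kernel of [X] in an order-preserving way. *)
Definition block_step (a n : int) (Z Z' : O -> T) (V : O -> R) :=
  [/\ adapted (F (n + 1)%R) V,
   forall E D, F n E -> measurable D -> P (E `&` V @^-1` D) = P E * lam D,
   exists (g : T * R -> T) (rho : (T * T) * R -> T), [/\ measurable_fun setT g,
     measurable_fun setT rho, Z' = (fun w => g (Z w, V w)) &
     {ae P, forall w, X (n + 1)%R w = rho ((X n w, Z w), V w)}],
   forall E B, F a E -> measurable B ->
     P (E `&` Z' @^-1` B) = P E * P (X (n + 1)%R @^-1` B) &
   (a < n)%R ->
     (forall E B, F n E -> measurable B ->
       P (E `&` Z' @^-1` B) = \int[P]_(w in E) K n (Z w) B) /\
     (forall k, {ae P, forall w, ((X n w k <= Z w k)%R -> (X (n + 1)%R w k <= Z' w k)%R) /\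
                 ((Z w k <= X n w k)%R -> (Z' w k <= X (n + 1)%R w k)%R)})].

Let mX (n : int) : (n <= 0)%R -> measurable_fun setT (X n).
Proof. by move=> n0; exact (adapted_measurable (driven_meas dr n0) (driven_X dr n0)). Qed.

Let mF (n : int) E : (n <= 0)%R -> F n E -> measurable E.
Proof. by move=> n0; exact: (driven_meas dr n0). Qed.

(** The second kernel is constant, equal to the law of [X (a + 1)], and under [Q] the new state is
    independent of everything else: this is the restart. *)
Lemma block_start (a : int) (Z : O -> T) : (a < 0)%R -> adapted (F a) Z ->
  exists Z' V, block_step a a Z Z' V.
Proof.
move=> a0 aZ; have a10 : (a + 1 <= 0)%R by rewrite -ltzD1 ltrD2r.
pose mu := law P (mX a10).
have mZ := adapted_measurable (driven_meas dr (ltW a0)) aZ.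
have mq : measurable_fun setT (fun q : O * T => ((X a q.1, Z q.1), (X (a + 1)%R q.1, q.2))).
  have mfs := @measurable_fst _ _ O T.
  apply: measurable_fun_pair.
    by apply: measurable_fun_pair; [exact: (measurableT_comp (mX (ltW a0)) mfs)|
      exact: (measurableT_comp mZ mfs)].
  by apply: measurable_fun_pair => //; exact: (measurableT_comp (mX a10) mfs).
pose Q := law (pprod P mu) mq.
have aXZ A : measurable A -> F a ((fun w => (X a w, Z w)) @^-1` A).
  exact: (adapted_pair (driven_sigma dr a) (driven_X dr (ltW a0)) aZ).
have QE A B B' : measurable A -> measurable B -> measurable B' -> Q (A `*` (B `*` B')) =
    (\int[P]_(w in (fun w => (X a w, Z w)) @^-1` A) K a (X a w) B) * mu B'.
  move=> mA mB mB'; rewrite -(driven_markov dr a0 (aXZ _ mA) mB).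
  have mAB : measurable ((fun w => (X a w, Z w)) @^-1` A `&` X (a + 1)%R @^-1` B).
    apply: measurableI; first exact: mF (ltW a0) (aXZ _ mA).
    exact: preim_measurable (mX a10) mB.
  apply: etrans _ (pprodX P mu mAB mB'); rewrite /Q lawE; congr (pprod P mu _).
  by apply/seteqP; split => -[w t] /=; [case=> ? []|case=> [[]]].
have [A B mA mB|A B mA mB|V [g [rho [[aV mg mrho] c1 c2 c3 c4]]]] :=
    @driven_innovation R _ O P _ T F X eta K dr (@Rd_standard R dd) a Z (kconst T mu) Q a0 aZ.
- by rewrite QE// probability_setT mule1.
- rewrite QE//; under [RHS]eq_integral do rewrite kconstE.
  have mE := mF (ltW a0) (aXZ _ mA).
  rewrite integral_cst//.
  rewrite muleC; congr (_ * _).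
  rewrite (eq_integral (cst 1)) => [|w _]; last exact: prob_kernel.
  by rewrite integral_cst// mul1e.
exists (fun w => g (Z w, V w)), V; split => //.
- by exists g, rho.
- move=> E B FE mB; rewrite c4//; under eq_integral do rewrite kconstE.
  rewrite integral_cst; last exact: mF (ltW a0) FE.
  by rewrite muleC.
- by rewrite ltxx.
Qed.

(** [Q] is the law of the current pair followed by the coupling kernel. Both current states lie in
    [A] almost surely, having the same law, so the marginals of [Q] are the required ones.
    Independence from [F a] persists because the next state is drawn by a kernel from a state
    independent of [F a]. *)
Lemma block_next (a n : int) (Z : O -> T) : (a < n)%R -> (n < 0)%R -> adapted (F n) Z ->
  (forall E B, F a E -> measurable B -> P (E `&` Z @^-1` B) = P E * P (X n @^-1` B)) ->
  exists Z' V, block_step a n Z Z' V.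
Proof.
move=> an n0 aZ Za; have n10 : (n + 1 <= 0)%R by rewrite -ltzD1 ltrD2r.
have a0 : (a <= 0)%R := ltW (lt_trans an n0).
have mZ := adapted_measurable (driven_meas dr (ltW n0)) aZ.
have mXn := mX (ltW n0).
have mXZ : measurable_fun setT (fun w => (X n w, Z w)) by exact: measurable_fun_pair.
have [C [A [mA PA CA]]] := coupled n0.
have ZX B : measurable B -> P (Z @^-1` B) = P (X n @^-1` B).
  move=> mB; have := Za setT B (filtT (driven_sigma dr a)) mB.
  by rewrite setTI probability_setT mul1e.
have aeA : {ae P, forall w, A (X n w) /\ A (Z w)}.
  have h1 := ae_of_prob1 (preim_measurable mXn mA) PA.
  have h2 := ae_of_prob1 (preim_measurable mZ mA) (etrans (ZX _ mA) PA).
  by apply: filterS2 h1 h2.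
pose Q := kprod (law P mXZ) C.
have aXZ D : measurable D -> F n ((fun w => (X n w, Z w)) @^-1` D).
  exact: (adapted_pair (driven_sigma dr n) (driven_X dr (ltW n0)) aZ).
have QE D W : measurable D -> measurable W ->
    Q (D `*` W) = \int[P]_(w in (fun w => (X n w, Z w)) @^-1` D) C (X n w, Z w) W.
  move=> mD mW; apply: etrans (kprodX (law P mXZ) C mD mW) _.
  by apply: (ge0_integral_law P mXZ mD (measurable_kernel C _ mW)) => p.
have mCW W : measurable W -> measurable_fun setT (fun w => C (X n w, Z w) W).
  by move=> mW; exact: (measurableT_comp (measurable_kernel C _ mW) mXZ).
have mKY (Y : O -> T) B : measurable_fun setT Y -> measurable B ->
    measurable_fun setT (fun w => K n (Y w) B).
  by move=> mY mB; exact: (measurableT_comp (measurable_kernel (K n) _ mB) mY).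
have aeint D (f h : O -> \bar R) : measurable D -> measurable_fun setT f ->
    measurable_fun setT h -> (forall w, 0 <= f w) -> (forall w, 0 <= h w) ->
    (forall w, A (X n w) /\ A (Z w) -> f w = h w) ->
    \int[P]_(w in D) f w = \int[P]_(w in D) h w.
  move=> mD mf mh f0 h0 fh; apply: ge0_ae_eq_integral => //.
  - exact: measurable_funTS.
  - exact: measurable_funTS.
  - by apply: filterS aeA => w Aw _; exact: fh.
have [D B mD mB|D B mD mB|V [g [rho [[aV mg mrho] c1 c2 c3 c4]]]] :=
    @driven_innovation R _ O P _ T F X eta K dr (@Rd_standard R dd) n Z (K n) Q n0 aZ.
- rewrite QE//; last exact: measurableX.
  have mE := preim_measurable mXZ mD.
  apply: aeint => //; [by apply: mCW; exact: measurableX|exact: mKY|].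
  by move=> w [Ax Az]; have [-> //] := CA _ _ Ax Az.
- rewrite QE//; last exact: measurableX.
  have mE := preim_measurable mXZ mD.
  apply: aeint => //; [by apply: mCW; exact: measurableX|exact: mKY|].
  by move=> w [Ax Az]; have [_ -> //] := CA _ _ Ax Az.
pose Z' w := g (Z w, V w).
have aZ' : adapted (F (n + 1)%R) Z'.
  have aZ1 : adapted (F (n + 1)%R) Z by move=> B mB; apply: (driven_incr dr); exact: aZ.
  have sF1 := driven_sigma dr (n + 1)%R.
  exact: (adapted_comp (adapted_pair sF1 aZ1 aV) mg).
have mZ' := adapted_measurable (driven_meas dr n10) aZ'.
have mX1 := mX n10.
(* The exceptional event has the probability that [Q] gives to leaving [D] from [D], which is 0
   because the coupling kernel charges only [D] there. *)
have order (D : set (T * T)) : measurable D ->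
    (forall x x', A x -> A x' -> D (x, x') -> C (x, x') D = 1) ->
    {ae P, forall w, D (X n w, Z w) -> D (X (n + 1)%R w, Z' w)}.
  move=> mD CD; have mDC := measurableC mD.
  exists [set w | (D `*` ~` D) ((X n w, Z w), (X (n + 1)%R w, Z' w))]; split.
  - have mq : measurable_fun setT (fun w => ((X n w, Z w), (X (n + 1)%R w, Z' w))).
      by apply: measurable_fun_pair => //; exact: measurable_fun_pair.
    exact: (preim_measurable mq (measurableX mD mDC)).
  - apply: etrans (c3 _ (measurableX mD mDC)) _; rewrite QE//.
    have mE := preim_measurable mXZ mD.
    rewrite -[RHS](@integral0 _ _ _ P ((fun w => (X n w, Z w)) @^-1` D)).
    apply: ge0_ae_eq_integral => //; first exact: measurable_funTS (mCW _ mDC).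
    apply: filterS aeA => w [Ax Az] Dw.
    have := CD _ _ Ax Az Dw => CD1.
    have := probability_setC (to_prob (measure0 (C (X n w, Z w))) (measure_ge0 (C (X n w, Z w)))
      (@measure_semi_sigma_additive _ _ _ (C (X n w, Z w))) (prob_kernel (s := C) (X n w, Z w))) mD.
    by move=> /= h; apply: etrans h _; rewrite [X in _ - X]CD1 subee.
  - by move=> w /= /not_implyP[].
exists Z', V; split => //.
- by exists g, rho.
- move=> E B FE mB; have FnE := driven_le dr (ltW an) FE.
  rewrite c4//.
  apply: etrans (integral_indep (mu := law P mXn) mZ (mF a0 FE) _ (measurable_kernel (K n) _ mB) _) _.
  + by move=> D mD; rewrite Za.
  + by move=> y.
  congr (_ * _).
  have H := ge0_integral_law P mXn (@measurableT _ T) (measurable_kernel (K n) _ mB) (fun y => measure_ge0 (K n y) B).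
  apply: etrans H _; rewrite preimage_setT.
  have := driven_markov dr n0 (filtT (driven_sigma dr n)) mB.
  by rewrite setTI => ->.
- move=> _; split; first exact: c4.
  move=> k.
  have [mle mge] := @measurable_coord_le R dd k.
  have h1 : {ae P, forall w, (X n w k <= Z w k)%R -> (X (n + 1)%R w k <= Z' w k)%R}.
    apply: (order _ mle) => x x' Ax Ax' /= xx'.
    by have [_ _ /(_ k)[+ _]] := CA _ _ Ax Ax'; apply.
  have h2 : {ae P, forall w, (Z w k <= X n w k)%R -> (Z' w k <= X (n + 1)%R w k)%R}.
    apply: (order _ mge) => x x' Ax Ax' /= xx'.
    by have [_ _ /(_ k)[_ +]] := CA _ _ Ax Ax'; apply.
  by apply: filterS2 h1 h2.
Qed.

End block.

Lemma dep_choice (A : Type) (I : nat -> A -> Prop) (Rl : nat -> A -> A -> Prop) (x0 : A) :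
  I 0%N x0 -> (forall i x, I i x -> exists y, I i.+1 y /\ Rl i x y) ->
  exists f : nat -> A, f 0%N = x0 /\ forall i, I i (f i) /\ Rl i (f i) (f i.+1).
Proof.
move=> I0 step.
have [nxt nxtP] : exists nxt : nat -> A -> A, forall i x, I i x ->
    I i.+1 (nxt i x) /\ Rl i x (nxt i x).
  have H (p : nat * A) : exists y, I p.1 p.2 -> I p.1.+1 y /\ Rl p.1 p.2 y.
    have [/step[y yP]|nI] := pselect (I p.1 p.2); first by exists y.
    by exists p.2.
  have [nxt nxtP] := choice H.
  by exists (fun i x => nxt (i, x)) => i x; exact: (nxtP (i, x)).
pose f := fix f i := if i is j.+1 then nxt j (f j) else x0.
have If i : I i (f i) by elim: i => //= i IH; case: (nxtP _ _ IH).
by exists f; split => // i; split => //; case: (nxtP _ _ (If i)).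
Qed.

Section block_process.
Context {R : realType} {dd : dimension} dO (O : measurableType dO) (P : probability O R)
  (F : int -> set (set O)) (X : int -> O -> Rd R dd)
  (eta : int -> O -> R) (K : int -> R.-pker (Rd R dd) ~> (Rd R dd)).
Notation T := (Rd R dd).
Hypothesis dr : driven P F X eta K.
Hypothesis coupled : order_coupled P X K.

Lemma block_step_adapted (a n : int) (Z Z' : O -> T) (V : O -> R) :
  adapted (F n) Z -> block_step P F X K a n Z Z' V -> adapted (F (n + 1)%R) Z'.
Proof.
move=> aZ [aV _ [g [rho [mg mrho -> _]]] _ _].
have aZ1 : adapted (F (n + 1)%R) Z by move=> B mB; apply: (driven_incr dr); exact: aZ.
exact: (adapted_comp (adapted_pair (driven_sigma dr (n + 1)%R) aZ1 aV) mg).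
Qed.

Lemma block_process (a : int) : (a < 0)%R ->
  exists (Z : int -> O -> T) (V : int -> O -> R), Z a = cst point /\
    forall n : int, (a <= n)%R -> (n < 0)%R ->
      adapted (F n) (Z n) /\ block_step P F X K a n (Z n) (Z (n + 1)%R) (V (n + 1)%R).
Proof.
move=> a0.
(* Independence with the law of [X] is required only after the first step: the initial state is a
   constant, whose law need not be that of [X a]. Beyond time 0 the invariant is empty. *)
pose I i (Z : O -> T) := (a + i%:Z <= 0)%R -> adapted (F (a + i%:Z)%R) Z /\
  ((0 < i)%N -> forall E B, F a E -> measurable B ->
     P (E `&` Z @^-1` B) = P E * P (X (a + i%:Z)%R @^-1` B)).
pose Rl i (Z Z' : O -> T) := (a + i%:Z < 0)%R ->
  exists V, block_step P F X K a (a + i%:Z)%R Z Z' V.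
have [||f [f0 fP]] := @dep_choice (O -> T) I Rl (cst point).
- by move=> _; split => //; exact: (adapted_cst (driven_sigma dr _)).
- move=> i Z; have [ai|ai] := ltP (a + i%:Z)%R 0%R; last first.
    move=> _; exists Z; split; last by rewrite /Rl ltNge ai.
    move=> h; exfalso; move: h; rewrite leNgt intS addrCA.
    by rewrite (le_lt_trans ai)// ltrDr.
  move=> /(_ (ltW ai)) [aZ ZB].
  have [Z' [V st]] : exists Z' V, block_step P F X K a (a + i%:Z)%R Z Z' V.
    case: i => [|i] in ai aZ ZB *; first by rewrite addr0 in ai aZ *; exact: (block_start dr a0 aZ).
    apply: (block_next dr coupled _ ai aZ); last exact: ZB.
    by rewrite ltrDl.
  exists Z'; split; last by move=> _; exists V.
  have e : (a + i.+1%:Z = a + i%:Z + 1)%R by rewrite -addn1 PoszD addrA.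
  move=> _; rewrite e; split; first exact: (block_step_adapted aZ st).
  by move=> _; case: st.
have VH i : exists v, (a + i%:Z < 0)%R ->
    block_step P F X K a (a + i%:Z)%R (f i) (f i.+1) v.
  have [ai|ai] := ltP (a + i%:Z)%R 0%R; last by exists (cst 0%R).
  by have [_ /(_ ai)[v vP]] := fP i; exists v.
have [V VP] := choice VH.
(* [V n] belongs to the step that arrives at time [n], hence the predecessor. *)
exists (fun n => f `|n - a|%N), (fun n => V `|n - a|.-1%N); split.
  by rewrite subrr.
move=> n an n0; pose i := `|n - a|%N.
have ni : n = (a + i%:Z)%R by rewrite /i gez0_abs ?subr_ge0// [RHS]addrC subrK.
have -> : `|(n + 1)%R - a|%N = i.+1.
  have -> : ((n + 1)%R - a = i.+1%:Z :> int)%R by rewrite ni -addn1 PoszD; ring.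
  by [].
rewrite -/i /=; split.
  by have [+ _] := fP i; rewrite /I -ni => /(_ (ltW n0))[].
by have := VP i; rewrite -ni; apply.
Qed.

End block_process.

(** * Backward convergence *)

Definition pr {R : realType} {d} {T : measurableType d} (P : probability T R)
  (A : set T) : R := fine (P A).

Section pr_facts.
Context {R : realType} d (T : measurableType d) (P : probability T R).
Local Open Scope ring_scope.

Lemma prE A : measurable A -> (pr P A)%:E = P A.
Proof. by move=> mA; rewrite /pr fineK//; exact: fin_num_measure. Qed.

Lemma pr_ge0 A : 0 <= pr P A.
Proof. by rewrite /pr fine_ge0. Qed.

Lemma pr_le A B : measurable A -> measurable B -> A `<=` B -> pr P A <= pr P B.
Proof. by move=> mA mB AB; rewrite -lee_fin !prE//; apply: le_measure; rewrite ?inE. Qed.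

Lemma prT : pr P setT = 1.
Proof. by rewrite /pr probability_setT. Qed.

Lemma pr0 : pr P set0 = 0.
Proof. by rewrite /pr measure0. Qed.

Lemma prD A B : measurable A -> measurable B ->
  pr P A = pr P (A `&` B) + pr P (A `\` B).
Proof.
move=> mA mB; apply: EFin_inj; rewrite EFinD !prE//.
- rewrite -measureU//.
  + by rewrite setUIDK.
  + exact: measurableI.
  + exact: measurableD.
  + by rewrite setDE setIACA setICr setI0.
- exact: measurableD.
- exact: measurableI.
Qed.

Lemma prC A : measurable A -> pr P (~` A) = 1 - pr P A.
Proof.
move=> mA; have := prD (@measurableT _ T) mA.
by rewrite prT setTI setTD => ->; rewrite [RHS]addrC addKr.
Qed.

Lemma prUI A B : measurable A -> measurable B ->
  pr P (A `|` B) + pr P (A `&` B) = pr P A + pr P B.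
Proof.
move=> mA mB; rewrite (prD (measurableU _ _ mA mB) mB).
rewrite (_ : (A `|` B) `&` B = B); last by apply/setIidPr; exact: subsetUr.
rewrite (_ : (A `|` B) `\` B = A `\` B); last by rewrite setDUl setDv setU0.
by rewrite (prD mA mB); ring.
Qed.

End pr_facts.

Section backward_convergence.
Context {R : realType} d (O : measurableType d) (P : probability O R).
Context (F : nat -> set (set O)) (A : set O) (G : nat -> set O).
Hypothesis sF : forall j, sigma_algebra setT (F j).
Hypothesis Fm : forall j, F j `<=` measurable.
Hypothesis Fd : forall j, F j.+1 `<=` F j.
Hypothesis mA : measurable A.
Hypothesis tailA : forall E, (forall j, F j E) -> P (A `&` E) = P A * P E.
Local Open Scope ring_scope.

Let c := pr P A.
Let nu E := pr P (A `&` E) - c * pr P E.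
Hypothesis FG : forall j, F j (G j).
Hypothesis Gmax : forall j E, F j E -> nu E <= nu (G j).

Let nuUI E E' : measurable E -> measurable E' ->
  nu (E `|` E') + nu (E `&` E') = nu E + nu E'.
Proof.
move=> mE mE'; have h := prUI P mE mE'.
have := prUI P (measurableI _ _ mA mE) (measurableI _ _ mA mE').
rewrite -setIUr (_ : A `&` E `&` (A `&` E') = A `&` (E `&` E')); last first.
  by rewrite setIACA setIid.
rewrite /nu; move: h.
set a := pr _ _; set b := pr _ _; set c1 := pr _ _; set c2 := pr _ _.
set a' := pr _ _; set b' := pr _ _; set c1' := pr _ _; set c2' := pr _ _.
move=> h h'; have -> : a = c1 + c2 - b by rewrite -h addrK.
have -> : a' = c1' + c2' - b' by rewrite -h' addrK.
ring.
Qed.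

Let Fdecr i j : (i <= j)%N -> F j `<=` F i.
Proof.
elim: j => [|j IH]; first by rewrite leqn0 => /eqP ->.
rewrite leq_eqVlt => /predU1P[->//|]; rewrite ltnS => /IH ij.
by move=> E /Fd; exact: ij.
Qed.

Let H m i := \bigcap_(k in [set k | (m <= k <= m + i)%N]) G k.

Let HS m i : H m i.+1 = G m `&` H m.+1 i.
Proof.
apply/seteqP; split => x.
  move=> Hx; split; first by apply: Hx => /=; rewrite leqnn leq_addr.
  move=> k /= /andP[mk ki]; apply: Hx => /=; rewrite (ltnW mk)/=.
  by rewrite addnS -addSn.
move=> [Gx Hx] k /= /andP[]; rewrite leq_eqVlt => /predU1P[<-//|mk] ki.
by apply: Hx => /=; rewrite mk addSn -addnS.
Qed.

Let FH m i : F m (H m i).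
Proof.
have -> : H m i = \bigcap_k (if (m <= k <= m + i)%N then G k else setT).
  apply/seteqP; split => x Hx k /=; last by move=> kmi; have := Hx k I; rewrite kmi.
  by move=> _; case: ifP => // kmi; exact: Hx.
apply: (filt_bigcap (sF m)) => k; case: ifP => [/andP[mk _]|_]; last exact: (filtT (sF m)).
exact: Fdecr (FG k).
Qed.

(** [nu] is modular. The union of [G m] with the intersection of the later sets is an event of
    [F m], so its [nu] is at most that of [G m]; adding [G m] to the intersection therefore cannot
    decrease [nu]. *)
Let nuH m i : nu (G (m + i)%N) <= nu (H m i).
Proof.
elim: i m => [|i IH] m.
  rewrite addn0 (_ : H m 0 = G m)//; apply/seteqP; split => x.
    by apply => /=; rewrite addn0 leqnn.
  by move=> Gx k /=; rewrite addn0 -eqn_leq => /eqP <-.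
rewrite HS addnS -addSn; apply: le_trans (IH m.+1) _.
have mG := Fm (FG m); have mH := Fm (FH m.+1 i).
have := nuUI mG mH.
have : nu (G m `|` H m.+1 i) <= nu (G m).
  by apply: Gmax; apply: (filtU (sF m)) => //; exact: (Fd (j := m)).
lra.
Qed.

(* If the suprema of the signed measures [nu] over the [F j] stayed above [e], then so would
   [nu] of the lower limit of the maximizing sets, which is a tail event. *)
Lemma backward_convergence (e : R) : 0 < e ->
  exists N, forall j, (N <= j)%N -> forall E, F j E ->
    `|pr P (A `&` E) - pr P A * pr P E| <= e.
Proof.
move=> e0.
have nuT : nu setT = 0 by rewrite /nu setIT prT mulr1 subrr.
have nuC E : measurable E -> nu (~` E) = - nu E.
  move=> mE; have := nuUI mE (measurableC mE).
  by rewrite setUv setICr nuT /nu setI0 !pr0 mulr0 subrr addr0 => /eqP; rewrite eq_sym addrC addr_eq0 => /eqP.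
have [[N NP]|h] := pselect (exists N, nu (G N) <= e).
  exists N => j Nj E FE; rewrite -/c -/(nu E).
  have mE := Fm FE.
  have b E' : F j E' -> nu E' <= e.
    by move=> FE'; apply: le_trans NP; apply: Gmax; exact: Fdecr FE'.
  rewrite ler_norml b// andbT lerNl -nuC//; apply: b. exact: (filtC (sF j)).
have {h} big j : e < nu (G j) by rewrite ltNge; apply/negP => hj; apply: h; exists j.
have bigH m i : e <= nu (H m i) by exact: le_trans (ltW (big _)) (nuH m i).
pose L m := \bigcap_(k in [set k | (m <= k)%N]) G k.
have LE m : L m = \bigcap_i H m i.
  apply/seteqP; split => x Lx; first by move=> i _ k /= /andP[mk _]; exact: Lx.
  by move=> k /= mk; apply: (Lx k I) => /=; rewrite mk leq_addl.
have mH m i : measurable (H m i) by exact: Fm (FH m i).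
have FL m : F m (L m).
  by rewrite LE; exact: (filt_bigcap (sF m)).
have limnu (D : nat -> set O) (D' : set O) : (forall i, measurable (D i)) -> measurable D' ->
    (forall i, e <= nu (D i)) ->
    (P (D i) @[i --> \oo] --> P D')%E ->
    (P (A `&` D i) @[i --> \oo] --> P (A `&` D'))%E -> e <= nu D'.
  move=> mD mD' eD c1 c2.
  have c1' : pr P (D i) @[i --> \oo] --> pr P D'.
    by apply: fine_cvg; rewrite /pr fineK//; exact: fin_num_measure.
  have mAD' := measurableI _ _ mA mD'.
  have c2' : pr P (A `&` D i) @[i --> \oo] --> pr P (A `&` D').
    by apply: fine_cvg; rewrite /pr fineK//; exact: fin_num_measure.
  have c3 : nu (D i) @[i --> \oo] --> nu D'.
    by apply: cvgB => //; exact: cvgMr.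
  have -> : nu D' = limn (fun i => nu (D i)) by apply/esym/cvg_lim.
  by apply: limr_ge; [apply/cvg_ex; exists (nu D')|exact: nearW].
have eL m : e <= nu (L m).
  have nI : nonincreasing_seq (H m).
    move=> i j ij; apply/subsetPset => x Hx k /= /andP[mk ki]; apply: Hx => /=.
    by rewrite mk/= (leq_trans ki)// leq_add2l.
  have nIA : nonincreasing_seq (fun i => A `&` H m i).
    move=> i j ij; apply/subsetPset; apply: setIS; apply/subsetPset; exact: nI.
  apply: (limnu (H m)) => //; first exact: Fm (FL m).
    rewrite LE; apply: nonincreasing_cvg_mu => //.
      by rewrite (le_lt_trans (probability_le1 P _))// ltry.
    by rewrite -LE; exact: Fm (FL m).
  rewrite LE (_ : A `&` _ = \bigcap_i (A `&` H m i)); last first.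
    apply/seteqP; split => [x [Ax Hx] i _|x Hx]; first by split => //; exact: Hx.
    by split => [|i _]; [have [] := Hx 0%N I|have [] := Hx i I].
  apply: nonincreasing_cvg_mu => //.
  - rewrite (le_lt_trans (probability_le1 P _))// ?ltry//; exact: measurableI.
  - by move=> i; exact: measurableI.
  - by apply: bigcapT_measurable => i; exact: measurableI.
pose U := \bigcup_m L m.
have Lmono m : L m `<=` L m.+1 by move=> x Lx k /= mk; apply: Lx => /=; exact: ltnW.
have ndL : nondecreasing_seq L.
  by apply/nondecreasing_seqP => m; apply/subsetPset; exact: Lmono.
(* [L] increases, so the union may start at any index; this puts [U] in every [F j]. *)
have FU j : F j U.
  have -> : U = \bigcup_m L (j + m)%N.
    apply/seteqP; split => x [m _ Lx]; last by exists (j + m)%N.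
    exists m => //; move: Lx; apply/subsetPset; apply: ndL; exact: leq_addl.
  by apply: (filt_bigcup (sF j)) => m; apply: (Fdecr (leq_addr m j)).
have mL m : measurable (L m) by exact: Fm (FL m).
have mU : measurable U by exact: Fm (FU 0%N).
have : e <= nu U.
  apply: (limnu L) => //; first exact: nondecreasing_cvg_mu.
  rewrite /U setI_bigcupr; apply: nondecreasing_cvg_mu => //.
  - by move=> i; exact: measurableI.
  - by apply: bigcupT_measurable => i; exact: measurableI.
  - by move=> i j ij; apply/subsetPset; apply: setIS; apply/subsetPset; exact: ndL.
rewrite /nu /c (_ : pr P (A `&` U) = pr P A * pr P U) ?subrr; first by rewrite leNgt e0.
by apply: EFin_inj; rewrite EFinM !prE//; [exact: tailA|exact: measurableI].
Qed.

End backward_convergence.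

Definition vanishing {R : realType} (u : nat -> R) :=
  forall e : R, (0 < e)%R -> exists N, forall j, (N <= j)%N -> (u j <= e)%R.

Section convergence_of_preimages.
Context {R : realType} dO dS (O : measurableType dO) (S : measurableType dS)
  (P : probability O R) (X : O -> S) (Z : nat -> O -> S).
Hypothesis mX : measurable_fun setT X.
Hypothesis mZ : forall j, measurable_fun setT (Z j).
Hypothesis ZX : forall j B, measurable B -> P (Z j @^-1` B) = P (X @^-1` B).
Local Open Scope ring_scope.

Let cv B := vanishing (fun j => pr P (X @^-1` B `\` Z j @^-1` B)).

Let mXB B : measurable B -> measurable (X @^-1` B).
Proof. exact: preim_measurable. Qed.

Let mZB j B : measurable B -> measurable (Z j @^-1` B).
Proof. exact: preim_measurable. Qed.

Lemma pr_sym_diff j B : measurable B ->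
  pr P (Z j @^-1` B `\` X @^-1` B) = pr P (X @^-1` B `\` Z j @^-1` B).
Proof.
move=> mB; have := prD P (mXB mB) (mZB j mB); have := prD P (mZB j mB) (mXB mB).
rewrite setIC {1}/pr ZX// -/(pr P _) => -> /eqP.
by rewrite (inj_eq (addrI _)) => /eqP.
Qed.

Let cvC B : measurable B -> cv B -> cv (~` B).
Proof.
move=> mB cB e /cB[N NP]; exists N => j /NP; rewrite -pr_sym_diff//.
apply: le_trans; apply: pr_le.
- by apply: measurableD; [apply: mXB|apply: mZB]; exact: measurableC.
- by apply: measurableD; [exact: mZB|exact: mXB].
- by move=> w [/= nX nZ]; split => //; apply: contrapT.
Qed.

Let cvU B B' : measurable B -> measurable B' -> cv B -> cv B' -> cv (B `|` B').
Proof.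
move=> mB mB' cB cB' e e0; have e20 : 0 < e / 2 by rewrite divr_gt0.
have [N NP] := cB _ e20; have [N' NP'] := cB' _ e20.
exists (maxn N N') => j; rewrite geq_max => /andP[/NP h /NP' h'].
have mU := measurableU _ _ mB mB'.
have m1 : measurable (X @^-1` B `\` Z j @^-1` B) by apply: measurableD; [exact: mXB|exact: mZB].
have m2 : measurable (X @^-1` B' `\` Z j @^-1` B') by apply: measurableD; [exact: mXB|exact: mZB].
have m3 : measurable (X @^-1` (B `|` B') `\` Z j @^-1` (B `|` B')).
  by apply: measurableD; [exact: mXB|exact: mZB].
have := prUI P m1 m2; have := pr_ge0 P ((X @^-1` B `\` Z j @^-1` B) `&` (X @^-1` B' `\` Z j @^-1` B')).
have : pr P (X @^-1` (B `|` B') `\` Z j @^-1` (B `|` B')) <=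
    pr P ((X @^-1` B `\` Z j @^-1` B) `|` (X @^-1` B' `\` Z j @^-1` B')).
  apply: pr_le => //; first exact: measurableU.
  by move=> w [[Xw|Xw] nZ]; [left|right]; split => // Zw; apply: nZ; [left|right].
lra.
Qed.

Let cv_bigcup (B : nat -> set S) : (forall i, measurable (B i)) -> (forall i, cv (B i)) ->
  cv (\bigcup_i B i).
Proof.
move=> mB cB; pose D n := \big[setU/set0]_(i < n) B i.
have mD n : measurable (D n) by apply: bigsetU_measurable.
have cD n : cv (D n).
  rewrite /D; elim: n => [|n IH].
    by rewrite big_ord0 => e e0; exists 0%N => j _; rewrite preimage_set0 set0D pr0 ltW.
  by rewrite big_ord_recr; apply: cvU => //; exact: mD.
have mU : measurable (\bigcup_i B i) by exact: bigcupT_measurable.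
have DU : \bigcup_n D n = \bigcup_i B i.
  rewrite /D; apply/seteqP; split => w [i _].
    by rewrite -bigcup_mkord => -[k _ Bk]; exists k.
  by move=> Bi; exists i.+1 => //; rewrite big_ord_recr; right.
move=> e e0; have e20 : 0 < e / 2 by rewrite divr_gt0.
have mE n : measurable (X @^-1` (\bigcup_i B i `\` D n)) by apply: mXB; exact: measurableD.
have lim0 : pr P (X @^-1` (\bigcup_i B i `\` D n)) @[n --> \oo] --> 0.
  have -> : 0 = pr P (\bigcap_n X @^-1` (\bigcup_i B i `\` D n)).
    rewrite (_ : \bigcap_n _ = set0) ?pr0//; apply/seteqP; split => // w Hw.
    have [[i _ Bi] _] := Hw 0%N I; have [_ /=] := Hw i.+1 I; apply.
    by rewrite /D big_ord_recr; right.
  apply: fine_cvg; rewrite prE//; last exact: bigcapT_measurable.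
  apply: nonincreasing_cvg_mu => //.
  - by rewrite (le_lt_trans (probability_le1 P _))// ltry.
  - exact: bigcapT_measurable.
  - move=> n p np; apply/subsetPset => w [Uw nD]; split => // Dw; apply: nD.
    by move: Dw; apply: subset_bigsetU.
have [n Pn] : exists n, pr P (X @^-1` (\bigcup_i B i `\` D n)) <= e / 2.
  move/cvgrPdist_le : lim0 => /(_ _ e20)[n _ /(_ n (leqnn n))].
  rewrite sub0r normrN => /(le_trans (ler_norm _)) ?; by exists n.
have [N NP] := cD n _ e20; exists N => j /NP h.
have m1 : measurable (X @^-1` D n `\` Z j @^-1` D n) by apply: measurableD; [exact: mXB|exact: mZB].
have m3 : measurable (X @^-1` (\bigcup_i B i) `\` Z j @^-1` (\bigcup_i B i)).
  by apply: measurableD; [exact: mXB|exact: mZB].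
have := prUI P m1 (mE n).
have := pr_ge0 P ((X @^-1` D n `\` Z j @^-1` D n) `&` (X @^-1` (\bigcup_i B i `\` D n))).
have : pr P (X @^-1` (\bigcup_i B i) `\` Z j @^-1` (\bigcup_i B i)) <=
    pr P ((X @^-1` D n `\` Z j @^-1` D n) `|` X @^-1` (\bigcup_i B i `\` D n)).
  apply: pr_le => //; first exact: measurableU.
  move=> w [/= Uw nU]; have [Dw|Dw] := pselect (D n (X w)); [left|right] => //.
  by split => //= Dz; apply: nU; rewrite /= -DU; exists n.
lra.
Qed.

(** The sets along which the preimages converge form a sigma-algebra: complements because equal laws
    make the two differences equally probable, countable unions by cutting the union at a finite
    stage. *)
Lemma preimage_cvg (G : set (set S)) : @measurable _ S = <<s G >> ->
  (forall B, G B -> cv B) -> forall B, measurable B -> cv B.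
Proof.
move=> mG GP B mB; suff : <<s G >> `<=` [set B | measurable B /\ cv B].
  by move=> /(_ B); rewrite -mG => /(_ mB)[].
apply: smallest_sub; last first.
  by move=> D GD; split; [rewrite mG; exact: sub_sigma_algebra|exact: GP].
split.
- by split => // e e0; exists 0%N => j _; rewrite preimage_set0 set0D pr0 ltW.
- by move=> D [mD cD]; rewrite setTD; split; [exact: measurableC|exact: cvC].
- move=> D HD; split; first by apply: bigcupT_measurable => i; case: (HD i).
  by apply: cv_bigcup => i; case: (HD i).
Qed.

End convergence_of_preimages.

(** * Iterated kernels and conditional probabilities *)

Section iterated_kernel.
Context {R : realType} dT (T : measurableType dT) (K : int -> R.-pker T ~> T).

Fixpoint iker (n : int) (i : nat) (B : set T) (x : T) : \bar R :=
  if i is j.+1 then \int[K n x]_y iker (n + 1)%R j B y else (\1_B x)%:E.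

Lemma iker_ge0 n i B x : 0 <= iker n i B x.
Proof. by elim: i n x => [|i IH] n x /=; [rewrite lee_fin|exact: integral_ge0]. Qed.

Lemma measurable_iker n i B : measurable B -> measurable_fun setT (iker n i B).
Proof.
move=> mB; elim: i n => [|i IH] n /=.
  exact/measurable_EFinP/measurable_indic.
apply: measurable_fun_integral_kernel => //; first exact: measurable_kernel.
by move=> y; exact: iker_ge0.
Qed.

Section markov_iteration.
Context dO (O : measurableType dO) (P : probability O R) (F : int -> set (set O))
  (Y : int -> O -> T) (N : int).
Hypothesis Fm : forall n : int, (n <= N)%R -> F n `<=` measurable.
Hypothesis Fle : forall n p : int, (n <= p)%R -> (p <= N)%R -> F n `<=` F p.

Lemma markov_iker (n : int) (i : nat) E B : (n + i%:Z <= N)%R ->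
  (forall m : int, (n <= m)%R -> (m <= N)%R -> measurable_fun setT (Y m)) ->
  (forall (m : int) E' B', (n <= m)%R -> (m < N)%R -> F m E' -> measurable B' ->
    P (E' `&` Y (m + 1)%R @^-1` B') = \int[P]_(w in E') K m (Y m w) B') ->
  F n E -> measurable B ->
  P (E `&` Y (n + i%:Z)%R @^-1` B) = \int[P]_(w in E) iker n i B (Y n w).
Proof.
elim: i n E => [|i IH] n E niN mY YK FE mB.
  rewrite addr0 in niN *; have mE := Fm niN FE; have mYB := preim_measurable (mY n (lexx n) niN) mB.
  rewrite setIC; apply: etrans (esym (integral_indic P mE mYB)) _.
  by [].
have ni : (n + i.+1%:Z = n + 1 + i%:Z :> int)%R by rewrite -add1n PoszD addrA.
have n1N : (n + 1 <= N)%R.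
  by apply: le_trans niN; rewrite lerD2l lez_nat.
have nN : (n < N)%R by rewrite -lezD1.
rewrite ni in niN *; rewrite (IH (n + 1)%R).
- have m1 : measurable_fun setT (Y n) by apply: mY => //; exact: ltW.
  have m2 : measurable_fun setT (Y (n + 1)%R) by apply: mY => //; rewrite lerDl.
  have mE := Fm (ltW nN) FE.
  have YE B' : measurable B' ->
      P (E `&` Y (n + 1)%R @^-1` B') = \int[P]_(w in E) K n (Y n w) B' by exact: YK.
  exact: (@integral_conditional R _ _ _ O T T P (K n) (Y n) m1 (Y (n + 1)%R) m2 E mE YE
    (iker (n + 1) i B) (measurable_iker _ _ mB) (iker_ge0 _ _ _)).
- by [].
- by move=> m nm mN; apply: mY => //; apply: le_trans nm; rewrite lerDl.
- by move=> m E' B' nm mN FE' mB'; apply: YK => //; apply: le_trans nm; rewrite lerDl.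
- by move: FE; apply: Fle => //; rewrite lerDl.
- by [].
Qed.

End markov_iteration.
End iterated_kernel.

Section conditional_probability_bounds.
Context {R : realType} dO (O : measurableType dO) (P : probability O R)
  (F : set (set O)).
Hypothesis sF : sigma_algebra setT F.
Hypothesis Fm : F `<=` measurable.
Context (W : set O) (u : O -> \bar R).
Hypothesis mW : measurable W.
Hypothesis mu : measurable_fun setT u.
Hypothesis u0 : forall w, 0 <= u w.
Hypothesis uW : forall E, F E -> P (E `&` W) = \int[P]_(w in E) u w.

(* Hahn decomposition of [E |-> P (W `&` E) - c P E], of density [u - c]. *)
Lemma superlevel_max (c : R) : (0 <= c)%R -> F [set w | (c%:E < u w)%E] ->
  forall E, F E -> (pr P (W `&` E) - c * pr P E <=
    pr P (W `&` [set w | (c%:E < u w)%E]) - c * pr P [set w | (c%:E < u w)%E])%R.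
Proof.
move=> c0; set D := [set w | _] => FD E FE.
have mD := Fm FD; have mE := Fm FE.
have FED : F (E `\` D) by rewrite setDE; apply: (filtI sF) => //; exact: (filtC sF).
have FDE : F (D `\` E) by rewrite setDE; apply: (filtI sF) => //; exact: (filtC sF).
have cint E' : measurable E' -> \int[P]_(w in E') cst c%:E w = (c * pr P E')%:E.
  by move=> mE'; rewrite integral_cst// EFinM prE.
have h1 : (pr P (W `&` (E `\` D)) <= c * pr P (E `\` D))%R.
  rewrite -lee_fin -cint; last exact: Fm.
  rewrite prE; last by apply: measurableI => //; exact: Fm.
  rewrite setIC uW//; apply: ge0_le_integral => //.
  - exact: Fm.
  - exact: measurable_funTS.
  - by move=> w [_ /negP]; rewrite -leNgt.
have h2 : (c * pr P (D `\` E) <= pr P (W `&` (D `\` E)))%R.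
  rewrite -lee_fin -cint; last exact: Fm.
  rewrite prE; last by apply: measurableI => //; exact: Fm.
  rewrite setIC uW//; apply: ge0_le_integral => //.
  - exact: Fm.
  - exact: measurable_funTS.
  - by move=> w [/= /ltW].
have := prD P mE mD; have := prD P mD mE; rewrite (setIC D E).
have := prD P (measurableI _ _ mW mE) mD; have := prD P (measurableI _ _ mW mD) mE.
rewrite -!setIDA -!setIA (setIC D E) => -> -> -> ->.
lra.
Qed.

End conditional_probability_bounds.

(** * Convergence of the coupled chain *)

(** Uniform over [D]. Only two times occur, so the property transfers to an enlarged space; for a
    chain, [superlevel_max] recovers from it the events of the whole past, by taking for [D] a
    superlevel set of an iterated kernel. *)
Definition mixing {R : realType} dO (O : measurableType dO) (P : probability O R)
    dT (T : measurableType dT) (X : int -> O -> T) (b : int) :=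
  forall B, measurable B -> forall e : R, (0 < e)%R -> exists N, forall j, (N <= j)%N ->
    forall D, measurable D ->
    (`|pr P (X b @^-1` B `&` X (b - j%:Z)%R @^-1` D) -
       pr P (X b @^-1` B) * pr P (X (b - j%:Z)%R @^-1` D)| <= e)%R.

Section coupling_convergence.
Context {R : realType} {dd : dimension} dO (O : measurableType dO) (P : probability O R)
  (F : int -> set (set O)) (X : int -> O -> Rd R dd)
  (eta : int -> O -> R) (K : int -> R.-pker (Rd R dd) ~> (Rd R dd)).
Notation T := (Rd R dd).
Hypothesis dr : driven P F X eta K.

Definition block (a : int) (Z : int -> O -> T) (V : int -> O -> R) :=
  forall n : int, (a <= n)%R -> (n < 0)%R ->
      adapted (F n) (Z n) /\ block_step P F X K a n (Z n) (Z (n + 1)%R) (V (n + 1)%R).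

Section one_block.
Variables (a : int) (Z : int -> O -> T) (V : int -> O -> R).
Hypothesis blk : block a Z V.

Lemma block_adapted (n : int) : (a < n)%R -> (n <= 0)%R -> adapted (F n) (Z n).
Proof.
move=> an n0; have -> : n = (n - 1 + 1)%R by rewrite subrK.
have an1 : (a <= n - 1)%R by rewrite -ltzD1 subrK.
have n10 : (n - 1 < 0)%R by rewrite -lezD1 subrK.
have [aZ st] := blk an1 n10; exact: (block_step_adapted dr aZ st).
Qed.

Lemma block_indep (n : int) E B : (a < n)%R -> (n <= 0)%R -> F a E -> measurable B ->
  P (E `&` Z n @^-1` B) = P E * P (X n @^-1` B).
Proof.
move=> an n0; have -> : n = (n - 1 + 1)%R by rewrite subrK.
have an1 : (a <= n - 1)%R by rewrite -ltzD1 subrK.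
have n10 : (n - 1 < 0)%R by rewrite -lezD1 subrK.
by have [_ [_ _ _ + _]] := blk an1 n10; apply.
Qed.

Lemma block_law (n : int) B : (a < n)%R -> (n <= 0)%R -> measurable B ->
  P (Z n @^-1` B) = P (X n @^-1` B).
Proof.
move=> an n0 mB; have := block_indep an n0 (filtT (driven_sigma dr a)) mB.
by rewrite setTI probability_setT mul1e.
Qed.

Lemma block_order (n : int) (i : nat) (k : Idx dd) : (a < n)%R -> (n + i%:Z <= 0)%R ->
  {ae P, forall w,
     ((X n w k <= Z n w k)%R -> (X (n + i%:Z)%R w k <= Z (n + i%:Z)%R w k)%R) /\
     ((Z n w k <= X n w k)%R -> (Z (n + i%:Z)%R w k <= X (n + i%:Z)%R w k)%R)}.
Proof.
move=> an; elim: i => [|i IH] ni0.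
  by rewrite addr0; apply: nearW.
have ni : (n + i.+1%:Z = n + i%:Z + 1 :> int)%R by rewrite -addn1 PoszD addrA.
rewrite ni in ni0 *; have ni1 : (n + i%:Z < 0)%R by rewrite -lezD1.
have an2 : (a < n + i%:Z)%R by rewrite (lt_le_trans an)// lerDl.
have [_ [_ _ _ _ /(_ an2)[_ /(_ k) h]]] := blk (ltW an2) ni1.
by apply: filterS2 (IH (ltW ni1)) h => w [h1 h2] [h3 h4]; split => [/h1/h3|/h2/h4].
Qed.

End one_block.

(** The restart is at time [b - j - 1], one step before [s], so that at [s] the chain [Z] already
    has the law of [X] and the order is decided. One error [e] comes from [X] on the event where [Z]
    is the smaller, the other from [Z] on the complement. *)
Lemma coupling_bound (b : int) (j : nat) (Z : int -> O -> T) V (k : Idx dd) (t e : R) :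
  (b <= 0)%R -> block (b - j%:Z - 1)%R Z V ->
  (forall D, measurable D ->
    (`|pr P (X b @^-1` [set x | (t < x k)%R] `&` X (b - j%:Z)%R @^-1` D) -
       pr P (X b @^-1` [set x | (t < x k)%R]) * pr P (X (b - j%:Z)%R @^-1` D)| <= e)%R) ->
  (pr P (X b @^-1` [set x | (t < x k)%R] `\` Z b @^-1` [set x | (t < x k)%R]) <= e + e)%R.
Proof.
set B := [set x : T | _]; set s := (b - j%:Z)%R => b0 blk He.
have mB : measurable B by exact: measurable_coord_gt.
have sj : (s + j%:Z = b)%R by rewrite /s subrK.
have sb : (s <= b)%R by rewrite -sj lerDl.
have as' : (s - 1 < s)%R by rewrite ltrBlDr ltrDl.
have mXm (m : int) : (m <= b)%R -> measurable_fun setT (X m).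
  move=> mb; have m0 := le_trans mb b0.
  exact: (adapted_measurable (driven_meas dr m0) (driven_X dr m0)).
have mZm (m : int) : (s <= m)%R -> (m <= b)%R -> measurable_fun setT (Z m).
  move=> sm mb; have m0 := le_trans mb b0.
  exact: (adapted_measurable (driven_meas dr m0) (block_adapted blk (lt_le_trans as' sm) m0)).
have Fm (n : int) : (n <= b)%R -> F n `<=` measurable.
  by move=> nb; apply: (driven_meas dr); exact: le_trans nb b0.
have Fle (n p : int) : (n <= p)%R -> (p <= b)%R -> F n `<=` F p.
  by move=> np _; exact: (driven_le dr).
pose u x := iker K s j B x.
have mu : measurable_fun setT u by exact: measurable_iker.
have u0 x : 0 <= u x by exact: iker_ge0.
have XW E : F s E -> P (E `&` X b @^-1` B) = \int[P]_(w in E) u (X s w).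
  move=> FE; rewrite -[b in X b @^-1` _]sj.
  apply: (markov_iker Fm Fle); rewrite ?sj//.
  - by move=> m _ mb; exact: mXm.
  - move=> m E' B' _ mb FE' mB'.
    exact: (driven_markov dr (lt_le_trans mb b0) FE' mB').
have ZW E : F s E -> P (E `&` Z b @^-1` B) = \int[P]_(w in E) u (Z s w).
  move=> FE; rewrite -[b in Z b @^-1` _]sj.
  apply: (markov_iker Fm Fle); rewrite ?sj//.
  move=> m E' B' sm mb FE' mB'.
  have am := lt_le_trans as' sm; have m0 := lt_le_trans mb b0.
  by have [_ [_ _ _ _ /(_ am)[+ _]]] := blk _ (ltW am) m0; apply.
pose W1 := X b @^-1` B; pose W2 := Z b @^-1` B.
have mW1 : measurable W1 by exact: preim_measurable (mXm _ (lexx b)) mB.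
have mW2 : measurable W2 by exact: preim_measurable (mZm _ sb (lexx b)) mB.
pose c := pr P W1.
have s0 : (s <= 0)%R by exact: le_trans sb b0.
have aXs : adapted (F s) (X s) by exact: (driven_X dr).
have aZs : adapted (F s) (Z s) by exact: (block_adapted blk).
have mXs := mXm _ sb; have mZs := mZm _ (lexx s) sb.
have sF := driven_sigma dr s.
pose D := [set x | (c%:E < u x)%E].
have mD : measurable D.
  by rewrite -[D]setTI; apply: emeasurable_fun_o_infty.
have cW2 : pr P W2 = c.
  by rewrite /pr (block_law blk (lt_le_trans as' sb) b0 mB).
have c0 : (0 <= c)%R by exact: pr_ge0.
have mux (Y : O -> T) : measurable_fun setT Y -> measurable_fun setT (u \o Y).
  by move=> mY; exact: measurableT_comp.
have maxX E : F s E -> (pr P (W1 `&` E) - c * pr P E <= e)%R.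
  move=> FE.
  apply: le_trans (superlevel_max sF (Fm _ sb) mW1 (mux _ mXs) (fun w => u0 _) XW c0 (aXs _ mD) FE) _.
  by apply: le_trans (He D mD); exact: ler_norm.
have lawZ := block_law blk as' s0.
(* [Z s] and [X s] have the same law, and from either the probability of reaching [B] is the same
   function [u]; so the superlevel set [D] gives the same excess for both. *)
have maxZ E : F s E -> (pr P (W2 `&` E) - c * pr P E <= e)%R.
  move=> FE.
  apply: le_trans (superlevel_max sF (Fm _ sb) mW2 (mux _ mZs) (fun w => u0 _) ZW c0 (aZs _ mD) FE) _.
  apply: le_trans (He D mD); apply: le_trans (ler_norm _).
  rewrite le_eqVlt; apply/orP; left; apply/eqP; congr (_ - c * _)%R; last first.
    by rewrite /pr; congr fine; exact: (lawZ D mD).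
  rewrite /pr; congr fine; rewrite setIC; apply: etrans (ZW _ (aZs _ mD)) _.
  rewrite [in RHS]setIC; apply: etrans _ (esym (XW _ (aXs _ mD))).
  have h1 := ge0_integral_law P mXs mD mu u0; have h2 := ge0_integral_law P mZs mD mu u0.
  rewrite -[LHS]h2 -[RHS]h1; apply: eq_measure_integral => B' mB' _.
  exact: (lawZ B' mB').
pose L := [set w | (X s w k <= Z s w k)%R].
have FL : F s L.
  have [mle _] := @measurable_coord_le R dd k.
  exact: (adapted_pair sF aXs aZs mle).
have mL : measurable L by exact: Fm FL.
have FLc : F s (~` L) by exact: filtC.
have mLc := Fm _ sb _ FLc.
have b0' := b0; rewrite -sj in b0'.
have := block_order blk k as' b0'; rewrite sj => ord.
have null1 : pr P ((W1 `\` W2) `&` L) = 0%R.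
  rewrite /pr (_ : P _ = 0)//; apply/negligibleP.
    by apply: measurableI => //; exact: measurableD.
  apply: negligibleS ord => w [[W1w nW2] Lw] [/(_ Lw) h _]; apply: nW2.
  by rewrite /W2 /B /=; apply: lt_le_trans h.
have null2 : pr P ((~` L `&` W2) `\` W1) = 0%R.
  rewrite /pr (_ : P _ = 0)//; apply/negligibleP.
    by apply: measurableD => //; exact: measurableI.
  apply: negligibleS ord => w [[/negP + W2w] nW1] [_ h].
  rewrite -ltNge => /ltW /h h'; apply: nW1.
  by rewrite /W1 /B /=; apply: lt_le_trans h'.
have m12 : measurable (W1 `\` W2) by exact: measurableD.
have e1 := prD P m12 mL.
have e2 := prD P (measurableI _ _ mLc mW2) mW1.
have e3 := prD P (measurableI _ _ mLc mW1) mW2.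
have e4 := prD P mW2 mL.
have e5 := prC P mL.
(* [W2] has probability [c], so the upper bound for [W2] on [L] is a lower bound for [W2] on the
   complement of [L]. There [W2] is almost surely contained in [W1], and the difference is
   controlled by the two bounds. *)
have e6 := maxX _ FLc.
have e7 := maxZ _ FL.
have s1 : (W1 `\` W2 `\` L = ~` L `&` W1 `\` W2)%classic.
  by rewrite !setDE setIC setIA.
have s2 : (~` L `&` W2 `&` W1 = ~` L `&` W1 `&` W2)%classic by rewrite -setIA (setIC W2) setIA.
have s3 : (W2 `\` L = ~` L `&` W2)%classic by rewrite setDE setIC.
rewrite s1 null1 in e1; rewrite s2 null2 in e2; rewrite cW2 s3 in e4.
rewrite (setIC W1) in e6; rewrite e5 in e6.
have e8 : (c * (1 - pr P L) = c - c * pr P L)%R by rewrite mulrBr mulr1.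
rewrite e8 in e6; rewrite -/W1 -/W2.
lra.
Qed.

End coupling_convergence.

Section block_limits.
Context {R : realType} {dd : dimension} dO (O : measurableType dO) (P : probability O R)
  (F : int -> set (set O)) (X : int -> O -> Rd R dd)
  (eta : int -> O -> R) (K : int -> R.-pker (Rd R dd) ~> (Rd R dd)).
Notation T := (Rd R dd).
Hypothesis dr : driven P F X eta K.

Lemma block_cvg (b : int) (Z : nat -> int -> O -> T) V : (b <= 0)%R ->
  mixing P X b -> (forall j, block P F X K (b - j%:Z - 1)%R (Z j) (V j)) ->
  forall B, measurable B -> vanishing (fun j => pr P (X b @^-1` B `\` Z j b @^-1` B)).
Proof.
move=> b0 mix blk.
have ab j : (b - j%:Z - 1 < b)%R by rewrite -addrA -opprD ltrBlDr ltrDl.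
have mX : measurable_fun setT (X b).
  exact: (adapted_measurable (driven_meas dr b0) (driven_X dr b0)).
have mZ j : measurable_fun setT (Z j b).
  exact: (adapted_measurable (driven_meas dr b0) (block_adapted dr (blk j) (ab j) b0)).
have ZX j B : measurable B -> P (Z j b @^-1` B) = P (X b @^-1` B).
  exact: (block_law dr (blk j) (ab j) b0).
(* Generators are used twice, coordinate preimages here and open rays of the line below, to arrive
   at the half-spaces of [coupling_bound]. *)
apply: (preimage_cvg mX mZ ZX (G := @coord_sets R dd)) => // B [k [C [mC ->]]].
have mXk := measurableT_comp (measurable_coord k) mX.
have mZk j := measurableT_comp (measurable_coord k) (mZ j).
have ZXk j D : measurable D ->
    P ((fun w => Z j b w k) @^-1` D) = P ((fun w => X b w k) @^-1` D).
  by move=> mD; exact: (ZX j _ (preim_measurable (measurable_coord k) mD)).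
apply: (preimage_cvg mXk mZk ZXk (RGenOInfty.measurableE R)) mC => _ [t ->].
have mB := @measurable_coord_gt R dd k t.
move=> e e0; have e20 : (0 < e / 2)%R by rewrite divr_gt0.
have [N NP] := mix _ mB _ e20; exists N => j /NP {}NP.
have := coupling_bound (k := k) (t := t) dr b0 (blk j) NP.
have -> : (e / 2 + e / 2 = e)%R by rewrite -splitr.
apply: le_trans; rewrite le_eqVlt; apply/orP; left; apply/eqP; congr (pr P (_ `\` _)).
- by apply/seteqP; split => w /=; rewrite in_itv/= andbT.
- by apply/seteqP; split => w /=; rewrite in_itv/= andbT.
Qed.

(** On the event [E], which belongs to [F n], [X] enters [B] at the next step with conditional
    probability above [q + e] and [Z] with conditional probability at most [q]. Hence [X] enters
    without [Z] on a proportion at least [e] of [E]. *)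
Lemma level_bound (n : int) (Z : int -> O -> T) V (a : int) (B : set T) (q e : R) :
  (n < 0)%R -> (a < n)%R -> block P F X K a Z V -> measurable B -> (0 <= q)%R -> (0 < e)%R ->
  let h x := K n x B in
  (e * pr P [set w | ((q + e)%:E < h (X n w))%E /\ (h (Z n w) <= q%:E)%E] <=
   pr P (X (n + 1)%R @^-1` B `\` Z (n + 1)%R @^-1` B))%R.
Proof.
move=> n0 an blk mB q0 e0; cbv zeta; set h := fun x => K n x B; set E := [set w | _].
have n10 : (n + 1 <= 0)%R by rewrite lezD1.
have an1 : (a < n + 1)%R by rewrite (lt_trans an)// ltrDl.
have mh : measurable_fun setT h by exact: measurable_kernel.
have aX := driven_X dr (ltW n0); have aZ := block_adapted dr blk an (ltW n0).
have Fm := driven_meas dr (ltW n0); have sF := driven_sigma dr n.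
have FE : F n E.
  apply: (filtI sF).
  - apply: (aX [set x | ((q + e)%:E < h x)%E]).
    by rewrite -[X in measurable X]setTI; exact: emeasurable_fun_o_infty.
  - apply: (aZ [set x | (h x <= q%:E)%E]).
    by rewrite -[X in measurable X]setTI; exact: emeasurable_fun_infty_c.
have mE := Fm _ FE.
have mX := adapted_measurable Fm aX; have mZ := adapted_measurable Fm aZ.
have mX1 : measurable_fun setT (X (n + 1)%R).
  exact: (adapted_measurable (driven_meas dr n10) (driven_X dr n10)).
have mZ1 : measurable_fun setT (Z (n + 1)%R).
  exact: (adapted_measurable (driven_meas dr n10) (block_adapted dr blk an1 n10)).
have mXB := preim_measurable mX1 mB; have mZB := preim_measurable mZ1 mB.
have [_ [_ _ _ _ /(_ an)[/(_ E B FE mB) hZ _]]] := blk n (ltW an) n0.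
have hX := driven_markov dr n0 FE mB.
have cE c : \int[P]_(w in E) cst c%:E w = (c * pr P E)%:E.
  by rewrite integral_cst// EFinM prE.
have lX : ((q + e) * pr P E <= pr P (E `&` X (n + 1)%R @^-1` B))%R.
  rewrite -lee_fin -cE prE; last exact: measurableI.
  rewrite [leRHS]hX; apply: ge0_le_integral => //.
  - by move=> w _; rewrite lee_fin addr_ge0// ltW.
  - exact: (measurable_funTS (measurableT_comp mh mX)).
  - by move=> w [/ltW].
have lZ : (pr P (E `&` Z (n + 1)%R @^-1` B) <= q * pr P E)%R.
  rewrite -lee_fin -cE prE; last exact: measurableI.
  rewrite [leLHS]hZ; apply: ge0_le_integral => //.
  - exact: (measurable_funTS (measurableT_comp mh mZ)).
  - by move=> w [].
have m1 := measurableI _ _ mE mXB.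
have d1 := prD P m1 mZB.
have d2 : (pr P (E `&` X (n + 1)%R @^-1` B `&` Z (n + 1)%R @^-1` B) <=
    pr P (E `&` Z (n + 1)%R @^-1` B))%R.
  by apply: pr_le; [exact: measurableI|exact: measurableI|move=> w [[]]].
have d3 : (pr P ((E `&` X (n + 1)%R @^-1` B) `\` Z (n + 1)%R @^-1` B) <=
    pr P (X (n + 1)%R @^-1` B `\` Z (n + 1)%R @^-1` B))%R.
  by apply: pr_le; [exact: measurableD|exact: measurableD|move=> w [[]]].
lra.
Qed.

(* The threshold [q] is relaxed to [q + e], where [e] is chosen so that the law of
   [K n (X n) B] puts little mass on the gap. *)
Lemma level_cvg (n : int) (Z : nat -> int -> O -> T) V (B : set T) (q : R) : (n < 0)%R ->
  (forall j, block P F X K (n - 1 - j%:Z)%R (Z j) (V j)) ->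
  measurable B ->
  vanishing (fun j => pr P (X (n + 1)%R @^-1` B `\` Z j (n + 1)%R @^-1` B)) ->
  let D := [set x | (q%:E < K n x B)%E] in
  vanishing (fun j => pr P (X n @^-1` D `\` Z j n @^-1` D)).
Proof.
move=> n0 blk mB van D e e0.
have an j : (n - 1 - j%:Z < n)%R by rewrite -addrA -opprD ltrBlDr ltrDl.
have mX : measurable_fun setT (X n).
  exact: (adapted_measurable (driven_meas dr (ltW n0)) (driven_X dr (ltW n0))).
have mZ j : measurable_fun setT (Z j n).
  exact: (adapted_measurable (driven_meas dr (ltW n0)) (block_adapted dr (blk j) (an j) (ltW n0))).
have [q0|q0] := ltP q 0%R.
  exists 0%N => j _; rewrite (_ : _ `\` _ = set0) ?pr0 ?ltW//.
  apply/seteqP; split => // w [_]; apply; rewrite /D /=.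
  by apply: lt_le_trans (measure_ge0 _ _); rewrite lte_fin.
have mh : measurable_fun setT (fun x => K n x B) by exact: measurable_kernel.
have mlevel c : measurable [set x | (c%:E < K n x B)%E].
  by rewrite -[X in measurable X]setTI; exact: emeasurable_fun_o_infty.
have mlevel' c : measurable [set x | (K n x B <= c%:E)%E].
  by rewrite -[X in measurable X]setTI; exact: emeasurable_fun_infty_c.
(* The gap between the thresholds [q] and [q + 1/(i+1)]: these events decrease to the empty set,
   since a finite value above [q] exceeds [q] by some [1/(i+1)]. *)
pose G i := X n @^-1` (D `\` [set x | ((q + i.+1%:R^-1)%:E < K n x B)%E]).
have mG i : measurable (G i).
  by apply: preim_measurable => //; apply: measurableD; exact: mlevel.
have G0 : \bigcap_i G i = set0.
  apply/seteqP; split => // w Gw.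
  have [Dw _] := Gw 0%N I.
  have fin := kernel_fin_num (K n) (X n w) mB.
  pose r := fine (K n (X n w) B); have rE : K n (X n w) B = r%:E by rewrite fineK.
  move: Dw; rewrite /D /= rE lte_fin -subr_gt0 => qr.
  have [i _ /(_ i (leqnn i))] := near_infty_natSinv_lt (PosNum qr).
  move=> /= ir; have [_] := Gw i I; apply; rewrite /= rE lte_fin.
  by rewrite -ltrBrDl.
have [i Gi] : exists i, (pr P (G i) <= e / 2)%R.
  have lim0 : (pr P (G i) @[i --> \oo] --> (0 : R))%R.
    rewrite -(pr0 P) -G0; apply: fine_cvg; rewrite prE; last exact: bigcapT_measurable.
    apply: nonincreasing_cvg_mu => //.
    - by rewrite (le_lt_trans (probability_le1 P _))// ltry.
    - exact: bigcapT_measurable.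
    - move=> i j ij; apply/subsetPset => w [Dw nw]; split => //= h; apply: nw => /=.
      apply: le_lt_trans h; rewrite lee_fin lerD2l lef_pV2 ?posrE ?ltr0n//.
      by rewrite ler_nat.
  have e20 : (0 < e / 2)%R by rewrite divr_gt0.
  move/cvgrPdist_le : lim0 => /(_ _ e20)[i _ /(_ i (leqnn i))].
  by rewrite sub0r normrN => /(le_trans (ler_norm _)) ?; exists i.
pose d : R := (i.+1%:R^-1)%R; have d0 : (0 < d)%R by rewrite invr_gt0.
have ed0 : (0 < d * (e / 2))%R by rewrite mulr_gt0// divr_gt0.
have [N NP] := van _ ed0; exists N => j /NP {}NP.
have := level_bound n0 (an j) (blk j) mB q0 d0; cbv zeta; set E := [set w | _] => bd.
have mE : measurable E.
  apply: measurableI; first exact: (preim_measurable mX (mlevel (q + d)%R)).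
  exact: (preim_measurable (mZ j) (mlevel' q)).
have {}bd : (pr P E <= e / 2)%R by rewrite -(ler_pM2l d0); exact: le_trans bd NP.
have mD : measurable D by exact: mlevel.
have sub : (pr P (X n @^-1` D `\` Z j n @^-1` D) <= pr P (G i `|` E))%R.
  apply: pr_le.
  - by apply: measurableD; [exact: preim_measurable mX mD|exact: preim_measurable (mZ j) mD].
  - exact: measurableU.
  - move=> w [Dw nD]; have [h|h] := pselect ((q + d)%:E < K n (X n w) B)%E.
      by right; split => //=; rewrite leNgt; exact/negP.
    by left; split.
have := prUI P (mG i) mE; have := pr_ge0 P (G i `&` E).
lra.
Qed.

End block_limits.

(* If countably many sets separating points have preimages in [G] up to null sets, then
   [X] is a.s. equal to a [G]-measurable function, by [graph_fun]. *)
Lemma adapted_version (R : realType) dO (O : measurableType dO) (P : probability O R)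
    dT (T : measurableType dT) (G : set (set O)) (X : O -> T) (A : set T)
    (B : nat -> set T) (E : nat -> set O) :
  sigma_algebra setT G -> G `<=` measurable -> standard_space R T ->
  measurable_fun setT X -> measurable A -> P (X @^-1` A) = 1 ->
  (forall i, measurable (B i)) -> (forall i, G (E i)) ->
  (forall i, {ae P, forall w, B i (X w) <-> E i w}) ->
  (forall x y, A x -> A y -> (forall i, B i x <-> B i y) -> x = y) ->
  exists2 X' : O -> T, adapted G X' & {ae P, forall w, X w = X' w}.
Proof.
move=> sG Gm stdT mX mA PA mB GE BE sep.
pose S := g_sigma_algebraType G.
have mid : @measurable_fun _ _ O S setT id := measurable_id_sub sG Gm.
have mg : @measurable_fun _ _ O (S * T)%type setT (fun w => (w, X w)).
  exact: (@measurable_fun_pair _ _ _ O S T _ _ mid mX).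
pose Q := law P mg.
pose D i := ((E i `*` B i) `|` (~` E i `*` ~` B i)) : set (S * T).
have mE i : @measurable _ S (E i) by rewrite measurable_gE.
have mD i : measurable (D i).
  apply: measurableU; apply: measurableX.
  - exact: (mE i).
  - exact: (mB i).
  - exact: (measurableC (mE i)).
  - exact: (measurableC (mB i)).
pose Gr := (setT `*` A) `&` \bigcap_i D i.
have mGr : measurable Gr.
  by apply: measurableI; [exact: measurableX|exact: bigcapT_measurable].
have GrE w : A (X w) -> (forall i, B i (X w) <-> E i w) -> Gr (w, X w).
  move=> AX BEw; split => // i _; have [Ew|Ew] := pselect (E i w).
    by left; split => //=; exact/BEw.
  by right; split => //= /BEw.
have QGr : Q Gr = 1.
  apply: (prob1_of_ae (preim_measurable mg mGr)).
  have h1 := ae_of_prob1 (preim_measurable mX mA) PA.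
  have h2 : {ae P, forall w, forall i, B i (X w) <-> E i w} by exact: ae_foralln.
  by apply: filterS2 h1 h2 => w; exact: GrE.
have [w y y' [[_ Ay] Dy] [[_ Ay'] Dy']|phi mphi phiE] := graph_fun stdT mGr QGr.
  apply: sep => // i; have := Dy i I; have := Dy' i I.
  by rewrite /D => -[[/= ? ?]|[/= ? ?]] [[/= ? ?]|[/= ? ?]].
exists phi; first exact/(adaptedP sG).
have mneq : measurable [set p : S * T | p.2 = phi p.1].
  by apply: (measurable_eq_standard stdT) => //; exact: (measurableT_comp mphi (@measurable_fst _ _ S T)).
apply: (ae_of_prob1 (preim_measurable mg mneq)).
exact: (prob1_of_ae mneq phiE).
Qed.

(** * Supports and separation of states *)

Section indices.
Context (dd : dimension).

Lemma enum_boxes : exists en : nat -> option (seq (Idx dd * (rat * rat))),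
  forall s, exists i, en i = Some s.
Proof.
case: dd => [n|] /=.
  exists (fun i => unpickle i : option (seq ('I_n * (rat * rat)))) => s.
  by exists (pickle s); rewrite pickleK.
exists (fun i => unpickle i : option (seq (nat * (rat * rat)))) => s.
by exists (pickle s); rewrite pickleK.
Qed.

Lemma enum_coord2 : exists en : nat -> option (Idx dd * (rat * rat)),
  forall p, exists i, en i = Some p.
Proof.
case: dd => [n|] /=.
  exists (fun i => unpickle i : option ('I_n * (rat * rat))) => s.
  by exists (pickle s); rewrite pickleK.
exists (fun i => unpickle i : option (nat * (rat * rat))) => s.
by exists (pickle s); rewrite pickleK.
Qed.

Lemma finite_set_Idx (J : set (Idx dd)) : finite_set J ->
  exists s : seq (Idx dd), forall p : Idx dd -> bool, all p s <-> (forall k, J k -> p k).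
Proof.
case: dd J => [n|] /= J /finite_seqP[s ->]; exists s => p; split.
- by move=> /allP ps k /= ks; exact: ps.
- by move=> ps; apply/allP => k ks; exact: ps.
- by move=> /allP ps k /= ks; exact: ps.
- by move=> ps; apply/allP => k ks; exact: ps.
Qed.

End indices.

Section support.
Context {R : realType} {dd : dimension} dO (O : measurableType dO) (P : probability O R).
Notation T := (Rd R dd).

(** Remove the countably many rational boxes that are null for the law of [Y]. If a basic
    neighbourhood of a remaining point were null, a rational box around the point inside it would be
    null and would have been removed. *)
Lemma support_carrier (Y : O -> T) : measurable_fun setT Y ->
  exists A : set T, [/\ measurable A, P (Y @^-1` A) = 1 & forall x, A x -> in_support P Y x].
Proof.
move=> mY; have [en en_surj] := enum_boxes dd.
pose box (s : seq (Idx dd * (rat * rat))) : set T :=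
  [set x | all (fun p => (ratr p.2.1 < x p.1)%R && (x p.1 < ratr p.2.2)%R) s].
have mbox s : measurable (box s).
  elim: s => [|p s IH]; first by rewrite (_ : box [::] = setT)//; apply/seteqP; split.
  rewrite (_ : box (p :: s) = [set x | (ratr p.2.1 < x p.1)%R] `&`
    [set x | (x p.1 < ratr p.2.2)%R] `&` box s); last first.
    by apply/seteqP; split => x /=; [case/andP => /andP[]|case=> -[a b] c; rewrite /box /= a b].
  have mk := measurable_coord p.1.
  apply: measurableI => //; apply: measurableI; first exact: measurable_coord_gt.
  by rewrite -[X in measurable X]setTI; exact: measurable_fun_ltr.
pose N i : set T := if en i is Some s then
  (if P (Y @^-1` box s) == 0 then box s else set0) else set0.
have mN i : measurable (N i) by rewrite /N; case: (en i) => // s; case: ifP.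
have PN i : P (Y @^-1` N i) = 0.
  by rewrite /N; case: (en i) => [s|]; [case: ifP => [/eqP//|_]|];
    rewrite preimage_set0 measure0.
exists (~` \bigcup_i N i); split.
- by apply: measurableC; exact: bigcupT_measurable.
- apply: prob1_of_ae.
    by apply: preim_measurable => //; apply: measurableC; exact: bigcupT_measurable.
  have h : {ae P, forall w, forall i, ~ N i (Y w)}.
    apply: ae_foralln => i; exists (Y @^-1` N i); split => //.
    - exact: preim_measurable.
    - exact: PN.
    - by move=> w /= /contrapT.
  by apply: filterS h => w Nw [i _]; exact: Nw.
- move=> x Nx J e finJ e0; rewrite lt_neqAle measure_ge0 andbT; apply/negP => /eqP P0.
  have [s sP] := finite_set_Idx finJ.
  have H (k : Idx dd) : exists ab : rat * rat, [/\ (x k - e < ratr ab.1)%R, (ratr ab.1 < x k)%R,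
      (x k < ratr ab.2)%R & (ratr ab.2 < x k + e)%R].
    have : (x k - e < x k)%R by rewrite ltrBlDr ltrDl.
    move=> /rat_in_itvoo[a]; rewrite in_itv/= => /andP[a1 a2].
    have : (x k < x k + e)%R by rewrite ltrDl.
    by move=> /rat_in_itvoo[b]; rewrite in_itv/= => /andP[b1 b2]; exists (a, b).
  have [ab abP] := choice H.
  pose s' := [seq (k, ab k) | k <- s].
  have boxx : box s' x.
    rewrite /box /= all_map; apply/sP => k _ /=.
    by have [_ -> -> _] := abP k.
  have sub : box s' `<=` [set y | forall k, J k -> (`|y k - x k| < e)%R].
    move=> y; rewrite /box /= all_map => /sP h k /h /= /andP[y1 y2].
    have [a1 _ _ b2] := abP k; rewrite ltr_norml; apply/andP; split; lra.
  have P0' : P (Y @^-1` box s') = 0.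
    have mJ : measurable [set w | forall k, J k -> (`|Y w k - x k| < e)%R].
      rewrite (_ : [set w | _] = Y @^-1` [set y | all (fun k => `|y k - x k| < e)%R s]).
        apply: preim_measurable => //; elim: (s) => [|k s1 IH].
          by rewrite (_ : [set _ | _] = setT)//; apply/seteqP; split.
        rewrite (_ : [set _ | _] = [set y : T | (`|y k - x k| < e)%R] `&`
            [set y : T | all (fun k => `|y k - x k| < e)%R s1]); last first.
          by apply/seteqP; split => y /=; [move=> /andP[]|move=> [-> ->]].
        apply: measurableI => //; rewrite -[X in measurable X]setTI.
        apply: measurable_fun_ltr => //; apply: measurableT_comp => //.
        by apply: measurable_funB => //; exact: measurable_coord.
      by apply/seteqP; split => w /=; [move=> h; apply/sP|move=> /sP].
    apply/eqP; rewrite -measure_le0 [X in _ <= X](_ : 0 = P [set w | forall k, J k -> (`|Y w k - x k| < e)%R])//.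
    by apply: le_measure; rewrite ?inE//; [exact: preim_measurable|move=> w; exact: sub].
  have [i iP] := en_surj s'; apply: Nx; exists i => //.
  by rewrite /N iP P0' eqxx.
Qed.

End support.

Lemma ae_iff_subset (R : realType) d (T : measurableType d) (m : probability T R)
    (U V : set T) : measurable U -> measurable V -> m U = m V ->
  {ae m, forall p, U p -> V p} -> {ae m, forall p, U p <-> V p}.
Proof.
move=> mU mV UV sub.
have UmV : pr m (U `\` V) = 0%R.
  rewrite /pr (_ : m _ = 0)//; apply/negligibleP; first exact: measurableD.
  by apply: negligibleS sub => w /= [Uw nV] /(_ Uw).
have VmU : m (V `\` U) = 0.
  rewrite -prE; last exact: measurableD.
  have := prD m mU mV; have := prD m mV mU.
  rewrite UmV (setIC V U) addr0 => h1 h2; congr EFin.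
  have h3 : pr m U = pr m V by rewrite /pr UV.
  by apply: (@addrI _ (pr m (U `&` V))); rewrite -h1 addr0 -h2.
have h : {ae m, forall p, V p -> U p}.
  exists (V `\` U); split => //; first exact: measurableD.
  by move=> p /= /not_implyP.
by apply: filterS2 sub h.
Qed.

Section separation.
Context {R : realType} {dd : dimension}.
Notation T := (Rd R dd).

(** For each coordinate and rational level, the order makes one of two events almost surely
    contained in the other; equal probabilities make them almost surely equal. The direction may
    depend on the coordinate. Countably many such events determine both points, so the coupling
    lives on the diagonal. *)
Lemma kernel_separation (kx kx' : {measure set T -> \bar R})
    (C : {measure set (T * T) -> \bar R}) : C setT = 1 ->
  (forall B, measurable B -> C (B `*` setT) = kx B) ->
  (forall B, measurable B -> C (setT `*` B) = kx' B) ->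
  (forall k, C [set p | (p.1 k <= p.2 k)%R] = 1 \/ C [set p | (p.2 k <= p.1 k)%R] = 1) ->
  (forall k (q : rat), kx [set y | (ratr q < y k)%R] = kx' [set y | (ratr q < y k)%R]) ->
  forall B, measurable B -> kx B = kx' B.
Proof.
move=> C1 Cx Cx' ord eqk.
pose m := to_prob (measure0 C) (measure_ge0 C) (@measure_semi_sigma_additive _ _ _ C) C1.
have mE A : m A = C A by [].
have mray k (q : rat) : measurable [set y : T | (ratr q < y k)%R].
  exact: measurable_coord_gt.
have aekq k (q : rat) : {ae m, forall p, (ratr q < p.1 k)%R <-> (ratr q < p.2 k)%R}.
  pose U := [set y : T | (ratr q < y k)%R] `*` [set: T].
  pose V := [set: T] `*` [set y : T | (ratr q < y k)%R].
  have mU : measurable U by exact: measurableX.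
  have mV : measurable V by exact: measurableX.
  have UV : m U = m V by rewrite !mE Cx// Cx'.
  have [mle mge] := @measurable_coord_le R dd k.
  have [h|h] := ord k.
  - have h' := @ae_of_prob1 _ _ _ m _ mle h.
    have sub : {ae m, forall p, U p -> V p}.
      by apply: filterS h' => p /= p12 [/= qp _]; split => //=; exact: lt_le_trans p12.
    apply: filterS (ae_iff_subset mU mV UV sub) => p [h1 h2]; split => hp.
      by case: h1.
    by case: h2.
  - have h' := @ae_of_prob1 _ _ _ m _ mge h.
    have sub : {ae m, forall p, V p -> U p}.
      by apply: filterS h' => p /= p12 [/= _ qp]; split => //=; exact: lt_le_trans p12.
    apply: filterS (ae_iff_subset mV mU (esym UV) sub) => p [h1 h2]; split => hp.
      by case: h2.
    by case: h1.
have [en en_surj] := @enum_coord dd.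
have ae12 : {ae m, forall p, p.1 = p.2}.
  pose st i (p : T * T) := if en i is Some (k, q) then
    ((ratr q < p.1 k)%R <-> (ratr q < p.2 k)%R) else True.
  have : {ae m, forall p, forall i, st i p}.
    apply: ae_foralln => i; rewrite /st; case: (en i) => [[k q]|]; first exact: aekq.
    exact: nearW.
  apply: filterS => p stp; apply/funext => k; apply: eq_ratr_lt => q.
  by have [i iP] := en_surj (k, q); have := stp i; rewrite /st iP.
move=> B mB; rewrite -Cx// -Cx'//; rewrite -2!mE; apply: eq_prob_ae.
- exact: measurableX.
- exact: measurableX.
- by apply: filterS ae12 => -[x y] /= ->; split => -[].
Qed.

End separation.

(** Equal probabilities make both differences between [W] and [Z j] small, and intersecting with [A]
    does not enlarge them. *)
Lemma vanishing_indep (R : realType) dO (O : measurableType dO) (P : probability O R)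
    (A W : set O) (Z : nat -> set O) (c : R) :
  measurable A -> measurable W -> (forall j, measurable (Z j)) ->
  (forall j, pr P (Z j) = pr P W) ->
  (forall j, pr P (A `&` Z j) = c)%R ->
  vanishing (fun j => pr P (W `\` Z j)) -> pr P (A `&` W) = c.
Proof.
move=> mA mW mZ ZW AZ van; apply/eqP; rewrite -subr_eq0 -normr_le0.
apply/ler_addgt0Pl => e e0; rewrite addr0; have [N NP] := van _ e0.
have {}NP := NP N (leqnn N).
have sd : pr P (Z N `\` W) = pr P (W `\` Z N).
  have := prD P mW (mZ N); have := prD P (mZ N) mW; rewrite setIC ZW => -> /eqP.
  by rewrite (inj_eq (addrI _)) => /eqP.
have h1 := prD P (measurableI _ _ mA mW) (mZ N).
have h2 := prD P (measurableI _ _ mA (mZ N)) mW.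
have h3 : (pr P ((A `&` W) `\` Z N) <= pr P (W `\` Z N))%R.
  by apply: pr_le; [apply: measurableD => //; exact: measurableI|exact: measurableD|move=> w [[]]].
have h4 : (pr P ((A `&` Z N) `\` W) <= pr P (Z N `\` W))%R.
  by apply: pr_le; [apply: measurableD => //; exact: measurableI|exact: measurableD|move=> w [[]]].
have := pr_ge0 P ((A `&` W) `\` Z N); have := pr_ge0 P ((A `&` Z N) `\` W).
rewrite AZ -setIA (setIC (Z N)) setIA in h2; rewrite sd in h4.
by move=> g1 g2; rewrite ler_norml; apply/andP; split; lra.
Qed.

(** * From time [n + 1] to time [n] *)

Section previous_time.
Context {R : realType} {dd : dimension} dO (O : measurableType dO) (P : probability O R)
  (F : int -> set (set O)) (X : int -> O -> Rd R dd)
  (eta : int -> O -> R) (K : int -> R.-pker (Rd R dd) ~> (Rd R dd)).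
Notation T := (Rd R dd).
Hypothesis dr : driven P F X eta K.
Hypothesis coupled : order_coupled P X K.
Variable n : int.
Hypothesis n0 : (n < 0)%R.
Hypothesis separated : exists A : set T, [/\ measurable A, P (X n @^-1` A) = 1 &
  forall x y, A x -> A y -> (forall k (q : rat),
    K n x [set z | (ratr q < z k)%R] = K n y [set z | (ratr q < z k)%R]) -> x = y].

Let mX : measurable_fun setT (X n).
Proof. exact: (adapted_measurable (driven_meas dr (ltW n0)) (driven_X dr (ltW n0))). Qed.

Let mray k (q : rat) : measurable [set y : T | (ratr q < y k)%R].
Proof. exact: measurable_coord_gt. Qed.

Let level (k : Idx dd) (q c : rat) : set T :=
  [set x | (ratr c)%:E < K n x [set y | (ratr q < y k)%R]].

Let mlevel k q c : measurable (level k q c).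
Proof.
rewrite -[X in measurable X]setTI; apply: emeasurable_fun_o_infty => //.
exact: measurable_kernel.
Qed.

Let levels := [set D | exists k q c, D = level k q c].

(** This is [adapted_version] for the identity of the state space under the law of [X n]: the levels
    with rational data are countably many and separate the points of a set of full measure. *)
Lemma level_generation (B : set T) : measurable B ->
  exists B', <<s levels >> B' /\ {ae P, forall w, B (X n w) <-> B' (X n w)}.
Proof.
move=> mB; have [A [mA PA Asep]] := separated.
have [en en_surj] := @enum_coord2 dd.
pose Lv i := if en i is Some (k, (q, c)) then level k q c else setT.
have mLv i : measurable (Lv i) by rewrite /Lv; case: (en i) => [[k [q c]]|].
have sG : sigma_algebra setT <<s levels >> by exact: smallest_sigma_algebra.
have Gm : <<s levels >> `<=` measurable.
  apply: smallest_sub; first exact: sigma_algebra_measurable.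
  by move=> _ [k [q [c ->]]].
have GL i : <<s levels >> (Lv i).
  rewrite /Lv; case: (en i) => [[k [q c]]|]; last exact: (filtT sG).
  by apply: sub_sigma_algebra; exists k, q, c.
have [|||X' aX' X'E] := @adapted_version R _ T (law P mX) _ T <<s levels >> id A Lv Lv sG Gm
    (@Rd_standard R dd) (@measurable_id _ T setT) mA _ mLv GL.
- by rewrite lawE.
- by move=> i; exact: nearW.
- move=> x y Ax Ay Lxy; apply: Asep => // k q.
  have fin z := kernel_fin_num (K n) z (mray k q).
  rewrite -(fineK (fin x)) -(fineK (fin y)); congr EFin; apply: eq_ratr_lt => c.
  have [i iP] := en_surj (k, (q, c)); have := Lxy i.
  by rewrite /Lv iP /level /= -(fineK (fin x)) -(fineK (fin y)) !lte_fin.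
exists (X' @^-1` B); split; first exact: aX'.
have meq : measurable [set x | x = X' x].
  apply: (measurable_eq_standard (@Rd_standard R dd)) => //.
  exact: (adapted_measurable Gm aX').
have := ae_of_prob1 (preim_measurable mX meq) (etrans (esym (lawE _ _ _)) (prob1_of_ae meq X'E)).
by apply: filterS => w /= <-.
Qed.

Lemma previous_cvg (Z : nat -> int -> O -> T) V :
  mixing P X (n + 1)%R -> (forall j, block P F X K (n - 1 - j%:Z)%R (Z j) (V j)) ->
  forall B, measurable B -> vanishing (fun j => pr P (X n @^-1` B `\` Z j n @^-1` B)).
Proof.
move=> mix blk.
have an j : (n - 1 - j%:Z < n)%R by rewrite -addrA -opprD ltrBlDr ltrDl.
have mZ j : measurable_fun setT (Z j n).
  exact: (adapted_measurable (driven_meas dr (ltW n0)) (block_adapted dr (blk j) (an j) (ltW n0))).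
have n10 : (n + 1 <= 0)%R by rewrite lezD1.
have a0 : (n - 1 < 0)%R by rewrite (lt_trans _ n0)// ltrBlDr ltrDl.
have van1 B : measurable B ->
    vanishing (fun j => pr P (X (n + 1)%R @^-1` B `\` Z j (n + 1)%R @^-1` B)).
  (* [Za] only serves to shift the index. *)
  have [Za [Va [_ blka]]] := block_process dr coupled n0.
  pose Z1 j := if j is i.+1 then Z i else Za.
  pose V1 j := if j is i.+1 then V i else Va.
  have blk1 j : block P F X K ((n + 1) - j%:Z - 1)%R (Z1 j) (V1 j).
    case: j => [|j] /=; first by rewrite subr0 addrK.
    have -> : ((n + 1) - j.+1%:Z - 1 = n - 1 - j%:Z :> int)%R by rewrite -addn1 PoszD; ring.
    exact: blk.
  move=> mB e e0; have [N NP] := block_cvg dr n10 mix blk1 mB e0.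
  by exists N => j Nj; exact: (NP j.+1 (leqW Nj)).
move=> B mB.
have [B' [GB' BB']] := level_generation mB.
have sG : sigma_algebra setT <<s levels >> by exact: smallest_sigma_algebra.
have Gm : <<s levels >> `<=` @measurable _ T.
  apply: smallest_sub; first exact: sigma_algebra_measurable.
  by move=> _ [k [q [c ->]]].
pose S := g_sigma_algebraType levels.
have mXS : @measurable_fun _ _ O S setT (X n).
  by move=> _ D GD; rewrite setTI; apply: (preim_measurable mX); exact: Gm.
have mZS j : @measurable_fun _ _ O S setT (Z j n).
  by move=> _ D GD; rewrite setTI; apply: (preim_measurable (mZ j)); exact: Gm.
have ZX j D : measurable D -> P (Z j n @^-1` D) = P (X n @^-1` D).
  exact: (block_law dr (blk j) (an j) (ltW n0)).
have vanS : forall D : set S, measurable D ->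
    vanishing (fun j => pr P (X n @^-1` D `\` Z j n @^-1` D)).
  apply: (preimage_cvg mXS mZS _ (G := levels)) => //.
    by move=> j D GD; exact: (ZX j D (Gm _ GD)).
  by move=> _ [k [q [c ->]]]; exact: (level_cvg dr (ratr c) n0 blk (mray k q) (van1 _ (mray k q))).
have mB' := Gm _ GB'.
move=> e e0; have [N NP] := vanS _ GB' _ e0; exists N => j /NP; apply: le_trans.
rewrite le_eqVlt; apply/orP; left; apply/eqP; rewrite /pr; congr fine.
have mXB := preim_measurable mX mB; have mXB' := preim_measurable mX mB'.
have mZB := preim_measurable (mZ j) mB; have mZB' := preim_measurable (mZ j) mB'.
(* The agreement of [B] and [B'] is almost sure for the law of [X n], which is also the law of
   [Z j n]. *)
have BB'Z : {ae P, forall w, B (Z j n w) <-> B' (Z j n w)}.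
  pose E := (B `&` B') `|` (~` B `&` ~` B').
  have mE : measurable E.
    by apply: measurableU; apply: measurableI => //; exact: measurableC.
  have EE x : E x <-> (B x <-> B' x).
    split; first by move=> [[]|[]].
    by move=> [h1 h2]; have [Bx|Bx] := pselect (B x); [left|right]; split => //=; auto.
  have PE : P (Z j n @^-1` E) = 1.
    apply: etrans (ZX j _ mE) _; apply: (prob1_of_ae (preim_measurable mX mE)).
    by apply: filterS BB' => w /EE.
  by apply: filterS (ae_of_prob1 (preim_measurable (mZ j) mE) PE) => w /EE.
apply: eq_prob_ae; [exact: measurableD|exact: measurableD|].
apply: filterS2 BB' BB'Z => w h h'; split => -[h1 h2]; split.
- exact/h.
- by move=> /= /h'.
- exact/h.
- by move=> /= /h'.
Qed.

Lemma previous_indep (A : set O) : mixing P X (n + 1)%R ->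
  (forall a : int, (a < n)%R -> F a A) ->
  forall B, measurable B -> P (A `&` X n @^-1` B) = P A * P (X n @^-1` B).
Proof.
move=> mix FA B mB.
have an j : (n - 1 - j%:Z < n)%R by rewrite -addrA -opprD ltrBlDr ltrDl.
have H j : exists ZV : (int -> O -> T) * (int -> O -> R),
    block P F X K (n - 1 - j%:Z)%R ZV.1 ZV.2.
  have [Z [V [_ blk]]] := block_process dr coupled (lt_trans (an j) n0).
  by exists (Z, V).
have [ZV blk] := choice H.
have van := previous_cvg mix blk mB.
have n1 : (n - 1 <= 0)%R by rewrite ltW// (lt_trans _ n0)// ltrBlDr ltrDl.
have n1n : (n - 1 < n)%R by rewrite ltrBlDr ltrDl.
have mA : measurable A := driven_meas dr n1 (FA _ n1n).
have mXB := preim_measurable mX mB.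
have mZB j : measurable ((ZV j).1 n @^-1` B).
  have aZ := block_adapted dr (blk j) (an j) (ltW n0).
  exact: (preim_measurable (adapted_measurable (driven_meas dr (ltW n0)) aZ) mB).
rewrite -!prE//; last exact: measurableI.
rewrite -EFinM; congr EFin; apply: (vanishing_indep mA mXB mZB _ _ van) => j.
- by rewrite /pr (block_law dr (blk j) (an j) (ltW n0) mB).
- rewrite /pr (block_indep (blk j) (an j) (ltW n0) (FA _ (an j)) mB) fineM//.
  + exact: (fin_num_measure P _ mA).
  + exact: (fin_num_measure P _ mXB).
Qed.

End previous_time.

(** * The tail of a Markov chain *)

Lemma measure_eq_sub (R : realType) d (T : measurableType d)
    (m1 m2 : {measure set T -> \bar R}) (G : set (set T)) :
  G `<=` measurable -> setI_closed G -> (forall A, G A -> m1 A = m2 A) ->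
  m1 setT = m2 setT -> m1 setT < +oo ->
  forall A, <<s G >> A -> m1 A = m2 A.
Proof.
move=> Gm GI m12 mT fin A; rewrite -setI_closed_g_dynkin_g_sigma_algebra//.
suff : <<d G >> `<=` [set E | measurable E /\ m1 E = m2 E] by move=> /(_ A) h /h[].
have le1 E (m : {measure set T -> \bar R}) : m setT < +oo -> measurable E -> m E \is a fin_num.
  move=> mf mE; rewrite ge0_fin_numE//; apply: le_lt_trans mf.
  by apply: le_measure; rewrite ?inE.
have fin2 : m2 setT < +oo by rewrite -mT.
apply: smallest_sub; last by move=> E GE; split; [exact: Gm|exact: m12].
split.
- by [].
- move=> E [mE eE]; split; first exact: measurableC.
  have h (m : {measure set T -> \bar R}) : m setT < +oo -> m (~` E) = m setT - m E.
    move=> mf; rewrite -(setUv E) measureU//; last by rewrite setICr.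
      by rewrite addeAC subee ?add0e// le1.
    exact: measurableC.
  by rewrite !h// mT eE.
- move=> D tD HD; have mD k : measurable (D k) by case: (HD k).
  split; first exact: bigcupT_measurable.
  rewrite !measure_bigcup//.
  by apply: eq_eseriesr => k _; case: (HD k).
Qed.

Lemma indep_sub (R : realType) d (O : measurableType d) (P : probability O R)
    (G : set (set O)) (A : set O) :
  G `<=` measurable -> setI_closed G -> measurable A ->
  (forall E, G E -> P (A `&` E) = P A * P E) ->
  forall E, <<s G >> E -> P (A `&` E) = P A * P E.
Proof.
move=> Gm GI mA GE E sE.
have PA0 : (0 <= pr P A)%R by exact: pr_ge0.
pose m1 : {measure set O -> \bar R} := mrestr P mA.
pose m2 : {measure set O -> \bar R} := mscale (NngNum PA0) P.
have m2E C : m2 C = P A * P C by rewrite /m2 /= /mscale /= prE.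
have : m1 E = m2 E.
  apply: (measure_eq_sub Gm GI) => //.
  - by move=> C cC; rewrite m2E /m1 /= /mrestr setIC; exact: GE.
  - by rewrite m2E probability_setT mule1 /m1 /= /mrestr setTI.
  - rewrite /m1 /= /mrestr setTI; exact: le_lt_trans (probability_le1 P mA) (ltry _).
by rewrite m2E /m1 /= /mrestr setIC.
Qed.

Section natural_filtration.
Context {R : realType} dO (O : measurableType dO) dT (T : measurableType dT)
  (X : int -> O -> T).

(** A generating class closed under intersection. The sets are indexed by times rather than by
    positions in the list, so that two cylinders are intersected time by time and repetitions in the
    list are harmless. *)
Definition cylinder (m : int) : set (set O) := [set E | exists (s : seq int) (B : int -> set T),
  [/\ forall n, n \in s -> (n <= m)%R, forall n, measurable (B n) &
      E = \bigcap_(n in [set` s]) X n @^-1` B n]].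

Lemma natfilt_sigma (n : int) : sigma_algebra setT (natfilt X n).
Proof. exact: smallest_sigma_algebra. Qed.

Lemma natfilt_adapted (n m : int) : (m <= n)%R -> adapted (natfilt X n) (X m).
Proof. by move=> mn B mB; apply: sub_sigma_algebra; exists m; split => //; exists B. Qed.

Lemma natfilt_le (n m : int) : (m <= n)%R -> natfilt X m `<=` natfilt X n.
Proof.
move=> mn; apply: sub_sigma_algebra2 => _ [p [pm [B mB ->]]].
by exists p; split; [exact: le_trans mn|exists B].
Qed.

Lemma cylinder_natfilt (m : int) : natfilt X m = <<s cylinder m >>.
Proof.
apply/seteqP; split.
  apply: sub_sigma_algebra2 => _ [n [nm [B mB ->]]].
  exists [:: n], (fun _ => B); split => //; first by move=> p; rewrite inE => /eqP ->.
  by apply/seteqP; split => w /=; [move=> Bw p /=; rewrite inE => /eqP ->|apply; rewrite /= inE].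
apply: smallest_sub; first exact: natfilt_sigma.
move=> _ [s [B [sm mB ->]]].
have := @fin_bigcap_measurable _ (g_sigma_algebraType (natfilt X m)) _ [set` s]
  (fun n => X n @^-1` B n) (finite_seq s).
rewrite (measurable_gE (natfilt_sigma m)); apply => n /= ns.
exact: (natfilt_adapted (sm _ ns)).
Qed.

Lemma cylinderI (m : int) : setI_closed (cylinder m).
Proof.
move=> _ _ [s [B [sm mB ->]]] [s' [B' [sm' mB' ->]]].
exists (s ++ s'), (fun n => (if n \in s then B n else setT) `&` (if n \in s' then B' n else setT)).
split.
- by move=> n; rewrite mem_cat => /orP[/sm|/sm'].
- by move=> n; apply: measurableI; case: ifP.
- apply/seteqP; split => w.
    by move=> [h h'] n /= _; split; case: ifP => // ns; [exact: h|exact: h'].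
  move=> h; split => n /= ns.
    have := h n; rewrite /= mem_cat ns/= => /(_ isT)[]; by [].
  have := h n; rewrite /= mem_cat ns orbT => /(_ isT)[]; by [].
Qed.

Lemma tailf_natfilt A (n : int) : tailf (natfilt X) A -> natfilt X n A.
Proof.
move=> tA; have [n0|n0] := leP n 0%R; first exact: tA.
by apply: (natfilt_le (ltW n0)); exact: tA.
Qed.

Hypothesis mX : forall n : int, (n <= 0)%R -> measurable_fun setT (X n).

Lemma natfilt_measurable (n : int) : (n <= 0)%R -> natfilt X n `<=` measurable.
Proof.
move=> n0; apply: smallest_sub; first exact: sigma_algebra_measurable.
by move=> _ [m [mn [B mB ->]]]; apply: preim_measurable => //; apply: mX; exact: le_trans n0.
Qed.

Lemma cylinder_measurable (n : int) : (n <= 0)%R -> cylinder n `<=` measurable.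
Proof.
move=> n0 E cE; apply: (natfilt_measurable n0); rewrite cylinder_natfilt.
exact: sub_sigma_algebra.
Qed.

Lemma natfilt_indep (P : probability O R) (A : set O) (n : int) : (n <= 0)%R -> measurable A ->
  (forall E, cylinder n E -> P (A `&` E) = P A * P E) ->
  forall E, natfilt X n E -> P (A `&` E) = P A * P E.
Proof.
move=> n0 mA cyl E; rewrite cylinder_natfilt.
exact: (indep_sub (cylinder_measurable n0) (@cylinderI n) mA cyl).
Qed.

End natural_filtration.

Definition tail_indep {R : realType} dO (O : measurableType dO) (P : probability O R)
    dT (T : measurableType dT) (X : int -> O -> T) (n : int) :=
  forall A B, tailf (natfilt X) A -> measurable B ->
    P (A `&` X n @^-1` B) = P A * P (X n @^-1` B).

Section tail_independence.
Context {R : realType} dO (O : measurableType dO) (P : probability O R)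
  dT (T : measurableType dT) (X : int -> O -> T) (K : int -> R.-pker T ~> T).
Hypothesis XK : markov_with P X K.

Let mX (n : int) : (n <= 0)%R -> measurable_fun setT (X n).
Proof. by case: XK => + _; apply. Qed.

Let XKE (n : int) E B : (n < 0)%R -> natfilt X n E -> measurable B ->
  P (E `&` X (n + 1)%R @^-1` B) = \int[P]_(w in E) K n (X n w) B.
Proof. by move=> n0 FE mB; have [_ /(_ n n0)[_ _]] := XK; apply. Qed.

(** [backward_convergence] with the natural filtration read backwards from [b]. The maximizing sets
    are superlevel sets of the conditional probability of the event at time [b], which the Markov
    property expresses by an iterated kernel. *)
Lemma markov_mixing (b : int) : (b <= 0)%R -> tail_indep P X b -> mixing P X b.
Proof.
move=> b0 ind B mB e e0.
pose F j := natfilt X (b - j%:Z)%R.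
have bj (j : nat) : (b - j%:Z <= b)%R by rewrite lerBlDr lerDl.
have bj0 j : (b - j%:Z <= 0)%R by exact: le_trans (bj j) b0.
pose A := X b @^-1` B; have mA : measurable A by exact: preim_measurable (mX b0) mB.
pose u j w := iker K (b - j%:Z)%R j B (X (b - j%:Z)%R w).
have Fm (n : int) : (n <= b)%R -> natfilt X n `<=` measurable.
  by move=> nb; apply: natfilt_measurable => //; exact: le_trans b0.
have uA j E : F j E -> P (E `&` A) = \int[P]_(w in E) u j w.
  move=> FE; have bE : (b - j%:Z + j%:Z = b)%R by rewrite subrK.
  have := markov_iker (K := K) (P := P) (Y := X) Fm (fun n p np _ => natfilt_le np)
    (n := (b - j%:Z)%R) (i := j) (E := E) (B := B).
  rewrite bE; apply => //.
  - by move=> m _ mb; apply: mX; exact: le_trans b0.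
  - by move=> m E' B' _ mb; apply: XKE; exact: lt_le_trans b0.
pose G j := [set w | (pr P A)%:E < u j w].
have FG j : F j (G j).
  apply: (natfilt_adapted (X := X) (lexx _) (B := [set x | (pr P A)%:E < iker K (b - j%:Z)%R j B x])).
  rewrite -[X in measurable X]setTI; apply: emeasurable_fun_o_infty => //.
  exact: measurable_iker.
have [|||||N NP] := @backward_convergence R _ O P F A G _ _ _ mA _ FG _ e e0.
- by move=> j; exact: natfilt_sigma.
- by move=> j; exact: Fm.
- move=> j; apply: natfilt_le; rewrite lerD2l lerN2 lez_nat; exact: leqnSn.
- move=> E FE; rewrite setIC muleC; apply: ind => // n n0.
  (* The sigma-fields at the times [b - j] reach arbitrarily far back, so their intersection is the
     whole tail. *)
  have /natfilt_le : (b - `|b - n|%N%:Z <= n)%R.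
    by rewrite lerBlDr -lerBlDl; exact: lez_abs.
  by apply; exact: FE.
- move=> j E FE.
  have muj : measurable_fun setT (u j).
    apply: (measurableT_comp (f := iker K (b - j%:Z)%R j B)); first exact: measurable_iker.
    exact: mX.
  have u0 w : 0 <= u j w by exact: iker_ge0.
  exact: (superlevel_max (natfilt_sigma X (b - j%:Z)%R) (Fm _ (bj j)) mA muj u0 (uA j)
    (pr_ge0 P A) (FG j) FE).
by exists N => j Nj D mD; apply: (NP j Nj); exact: natfilt_adapted.
Qed.

Let window (i : nat) (B : int -> set T) : set O :=
  \bigcap_(k in `I_i.+1) X (- k%:Z)%R @^-1` B (- k%:Z)%R.

Let windowS i B : window i.+1 B = X (- i.+1%:Z)%R @^-1` B (- i.+1%:Z)%R `&` window i B.
Proof.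
apply/seteqP; split => w.
  move=> h; split; first by apply: h => /=.
  by move=> k /= ki; apply: h => /=; exact: ltnW.
move=> [h1 h2] k /=; rewrite ltnS leq_eqVlt => /predU1P[->//|ki].
by apply: h2.
Qed.

Let cylinder_window E : cylinder X 0%R E ->
  exists i (B : int -> set T), (forall n, measurable (B n)) /\ E = window i B.
Proof.
move=> [s [B [s0 mB ->]]].
exists (\max_(n <- s) `|n|%N)%N, (fun n => if n \in s then B n else setT); split.
  by move=> n; case: ifP.
apply/seteqP; split => w h.
  by move=> k /= _; case: ifPn => // ks; exact: h.
move=> n /= ns; have nk : n = (- `|n|%N%:Z)%R by rewrite lez0_abs ?opprK// s0.
have := h `|n|%N; rewrite -nk ns; apply => /=.
rewrite ltnS; exact: (@leq_bigmax_seq _ s xpredT absz n ns isT).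
Qed.

(** Given the past of its first time, a window of consecutive times has a conditional probability
    that depends on the first state only: [u] is multiplied by the indicator of the new set after
    one application of the kernel. *)
Let window_cond i B : (forall n, measurable (B n)) ->
  exists u : T -> \bar R, [/\ measurable_fun setT u, forall x, 0 <= u x &
    forall D, natfilt X (- i%:Z)%R D -> P (D `&` window i B) = \int[P]_(w in D) u (X (- i%:Z)%R w)].
Proof.
move=> mB; elim: i => [|i [u [mu u0 uE]]].
  exists (fun x => (\1_(B 0%R) x)%:E); split.
  - exact/measurable_EFinP/measurable_indic.
  - by move=> x; rewrite lee_fin.
  - move=> D FD; have mD := natfilt_measurable mX (lexx 0%R) FD.
    have -> : window 0 B = X 0%R @^-1` B 0%R.
      by apply/seteqP; split => w; [move=> /(_ 0%N)/=; exact|move=> Bw k /=; rewrite ltnS leqn0 => /eqP ->].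
    rewrite setIC; apply: etrans (esym (integral_indic P mD (preim_measurable (mX (lexx 0%R)) (mB 0%R)))) _.
    by [].
have i1 : (- i.+1%:Z < 0)%R by [].
have ii : (- i.+1%:Z + 1 = - i%:Z :> int)%R by rewrite -addn1 PoszD; ring.
have mX1 := mX (ltW i1).
have i0 : (- i%:Z <= 0)%R by rewrite oppr_le0.
have mX0 := mX i0.
set n := (- i.+1%:Z)%R in i1 ii mX1 *.
pose h x := \int[K n x]_y u y.
have mh : measurable_fun setT h.
  by apply: measurable_fun_integral_kernel => // U mU; exact: measurable_kernel.
have h0 x : 0 <= h x by exact: integral_ge0.
exists (fun x => (\1_(B n) x)%:E * h x); split.
- by apply: emeasurable_funM => //; exact/measurable_EFinP/measurable_indic.
- by move=> x; apply: mule_ge0 => //; rewrite lee_fin.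
- move=> D FD.
  have FDB : natfilt X n (D `&` X n @^-1` B n).
    apply: (filtI (natfilt_sigma X n)) => //; exact: natfilt_adapted.
  have mD := natfilt_measurable mX (ltW i1) FD.
  have mDB := natfilt_measurable mX (ltW i1) FDB.
  rewrite windowS setIA uE; last first.
    by apply: natfilt_le FDB; rewrite -ii lerDl.
  have PE B' : measurable B' ->
      P (D `&` X n @^-1` B n `&` X (- i%:Z)%R @^-1` B') =
      \int[P]_(w in D `&` X n @^-1` B n) K n (X n w) B'.
    by move=> mB'; rewrite -ii; exact: XKE.
  apply: etrans (@integral_conditional R _ _ _ O T T P (K n) (X n) mX1 (X (- i%:Z)%R) mX0 _ mDB PE u mu u0) _.
  rewrite integral_mkcondr; apply: eq_integral => w _.
  rewrite patchE indicE; have -> : (w \in X n @^-1` B n) = (X n w \in B n) by apply/idP/idP; rewrite !inE.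
  by case: (X n w \in B n); rewrite ?mul1e ?mul0e.
Qed.

(** The probability of a window on a tail event [A] is the integral over [A] of a function of the
    first state, so independence of that one state from [A] suffices. Then [A] is independent of the
    whole process, hence of itself, and its probability solves [p = p * p]. *)
Lemma tail_indep_kolmogorovian : (forall n : int, (n <= 0)%R -> tail_indep P X n) ->
  kolmogorovian P (natfilt X).
Proof.
move=> ind A tA; have FA : natfilt X 0%R A by exact: tA.
have mA := natfilt_measurable mX (lexx 0%R) FA.
have cyl E : cylinder X 0%R E -> P (A `&` E) = P A * P E.
  move=> /cylinder_window[i [B [mB ->]]].
  have [u [mu u0 uE]] := window_cond i mB.
  have i0 : (- i%:Z <= 0)%R by rewrite oppr_le0.
  have mXi := mX i0.
  have key D : natfilt X (- i%:Z)%R D -> (forall B', measurable B' ->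
      P (D `&` X (- i%:Z)%R @^-1` B') = P D * law P mXi B') ->
      P (D `&` window i B) = P D * \int[law P mXi]_y u y.
    move=> FD indD; rewrite uE//.
    exact: (integral_indep mXi (natfilt_measurable mX i0 FD) indD mu u0).
  rewrite key; [|exact: tailf_natfilt|by move=> B' mB'; rewrite lawE; exact: ind].
  congr (_ * _).
  have := key setT (filtT (natfilt_sigma X _)).
  rewrite setTI probability_setT mul1e => -> // B' mB'.
  by rewrite setTI mul1e lawE.
have := natfilt_indep mX (lexx 0%R) mA cyl FA.
rewrite setIid -!prE// -EFinM => -[] /eqP; rewrite -subr_eq0 -{1}(mulr1 (pr P A)) -mulrBr mulf_eq0 subr_eq0.
by move=> /orP[/eqP ->|/eqP <-]; [left|right].
Qed.

Lemma kolmogorovian_tail_indep (n : int) : (n <= 0)%R ->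
  kolmogorovian P (natfilt X) -> tail_indep P X n.
Proof.
move=> n0 kol A B tA mB.
have mA := natfilt_measurable mX (lexx 0%R) (tA _ (lexx 0%R)).
have mXB := preim_measurable (mX n0) mB.
have [PA|PA] := kol A tA; rewrite PA.
  rewrite mul0e; apply: (@subset_measure0 _ _ _ P _ A) => //; exact: measurableI.
rewrite mul1e; apply: eq_prob_ae => //; first exact: measurableI.
by apply: filterS (ae_of_prob1 mA PA) => w Aw; split => [[]|].
Qed.

Lemma cond_law_tail_indep (n : int) : (n <= 0)%R ->
  cond_law_is_law P (tailf (natfilt X)) (X n) -> tail_indep P X n.
Proof.
move=> n0 [Kc [[_ KcG KcE] aeK]] A B tA mB; rewrite KcE//.
have mA := natfilt_measurable mX (lexx 0%R) (tA _ (lexx 0%R)).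
have mK : measurable_fun setT (fun w => Kc w B).
  move=> _ U mU; rewrite setTI; apply: (natfilt_measurable mX (lexx 0%R)).
  by apply: KcG => //.
rewrite muleC; apply: etrans _ (integral_cst P mA (P (X n @^-1` B))).
apply: ge0_ae_eq_integral => //; first exact: measurable_funTS.
by apply: filterS aeK => w + _; exact.
Qed.

Lemma tail_indep_cond_law (n : int) : (n <= 0)%R ->
  tail_indep P X n -> cond_law_is_law P (tailf (natfilt X)) (X n).
Proof.
move=> n0 ind; exists (fun _ => law P (mX n0)); split.
  split.
  - by move=> _; exact: probability_setT.
  - move=> B mB U mU m m0.
    have [h|h] := pselect (U (law P (mX n0) B)).
      rewrite (_ : _ @^-1` _ = setT); last by apply/seteqP; split.
      exact: (filtT (natfilt_sigma X m)).
    rewrite (_ : _ @^-1` _ = set0); last by apply/seteqP; split.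
    exact: (filt0 (natfilt_sigma X m)).
  - move=> A B tA mB.
    have mA := natfilt_measurable mX (lexx 0%R) (tA _ (lexx 0%R)).
    rewrite ind// [RHS]integral_cst// muleC lawE; by [].
by apply: nearW => w B mB; rewrite lawE.
Qed.

End tail_independence.

(** * Adjoining independent uniform noise *)

Section integral_measure.
Context {R : realType} d (T : measurableType d) (m : {measure set T -> \bar R})
  (h : T -> \bar R) (mh : measurable_fun setT h) (h0 : forall x, 0 <= h x).

Definition integral_fun & measurable_fun setT h & (forall x, 0 <= h x) :=
  fun A => \int[m]_(x in A) h x.

Let integral_fun0 : integral_fun mh h0 set0 = 0.
Proof. by rewrite /integral_fun integral_set0. Qed.

Let integral_fun_ge0 A : 0 <= integral_fun mh h0 A.
Proof. exact: integral_ge0. Qed.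

Let integral_fun_sigma_additive : semi_sigma_additive (integral_fun mh h0).
Proof.
move=> F mF tF mUF; rewrite /integral_fun; apply: cvg_toP.
  apply: ereal_nondecreasing_is_cvgn => i j ij.
  by apply: lee_sum_nneg_natr => // k _ _; exact: integral_ge0.
by rewrite ge0_integral_bigcup//; exact: measurable_funTS.
Qed.

HB.instance Definition _ := isMeasure.Build _ _ _ (integral_fun mh h0)
  integral_fun0 integral_fun_ge0 integral_fun_sigma_additive.

End integral_measure.

Section extension.
Context {R : realType} dO (O : measurableType dO) (P : probability O R)
  dT (T : measurableType dT) (X : int -> O -> T) (K : int -> R.-pker T ~> T).
Hypothesis XK : markov_with P X K.
Context (f g : R -> R).
Hypothesis mf : measurable_fun setT f.
Hypothesis mg : measurable_fun setT g.
Hypothesis fgE : forall W, measurable W ->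
  lam ((fun u => (f u, g u)) @^-1` W) = pprod lam lam W.

Let mX (n : int) : (n <= 0)%R -> measurable_fun setT (X n).
Proof. by case: XK => + _; apply. Qed.

(** A single uniform variable yields the noise at all times: [f] and [g] split it into two
    independent uniform ones, [f] gives the noise of the current time and [g] is handed on to the
    preceding time. So [tau n] carries all the noise up to [n], the sigma-fields it generates
    increase with [n], and the noise at [n + 1] is independent of [tau n]. Positive times are frozen
    at 0. *)
Let tau (n : int) (u : R) : R := iter `|Num.min n 0|%N g u.

Let tauS (n : int) u : (n < 0)%R -> tau n u = g (tau (n + 1)%R u).
Proof.
move=> n0; have n10 : (n + 1 <= 0)%R by rewrite lezD1.
rewrite /tau !min_l// ?(ltW n0)//; rewrite -iterS; congr iter.
by apply/eqP; rewrite -eqz_nat intS !lez0_abs ?(ltW n0)//; apply/eqP; ring.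
Qed.

Let mtau (n : int) : measurable_fun setT (tau n).
Proof.
rewrite /tau; elim: (`|_|)%N => [|i IH]; first exact: measurable_id.
exact: (measurableT_comp mg IH).
Qed.

Let tau_law (n : int) D : measurable D -> lam (tau n @^-1` D) = lam D.
Proof.
rewrite /tau; elim: (`|_|)%N D => [//|i IH] D mD.
have mgD := preim_measurable mg mD.
have -> : lam ((fun u => iter i.+1 g u) @^-1` D) = lam ((fun u => iter i g u) @^-1` (g @^-1` D)) by [].
rewrite IH//; have mTD : measurable ([set: R] `*` D) by exact: measurableX.
transitivity (lam ((fun u => (f u, g u)) @^-1` ([set: R] `*` D))).
  by congr (lam _); apply/seteqP; split => // u [].
by rewrite fgE// pprodX// probability_setT mul1e.
Qed.

Let gens (n : int) : set (set (O * R)) := [set W | exists E D,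
  [/\ natfilt X n E, measurable D & W = fst @^-1` E `&` (fun w => tau n w.2) @^-1` D]].

Definition extended_filtration (n : int) := <<s gens n >>.

Let gens_meas (n : int) : (n <= 0)%R -> gens n `<=` measurable.
Proof.
move=> n0 _ [E [D [FE mD ->]]]; apply: measurableI.
  exact: (preim_measurable measurable_fst (natfilt_measurable mX n0 FE)).
exact: (preim_measurable (measurableT_comp (mtau n) (@measurable_snd _ _ O R)) mD).
Qed.

Let gensI (n : int) : setI_closed (gens n).
Proof.
move=> _ _ [E [D [FE mD ->]]] [E' [D' [FE' mD' ->]]].
exists (E `&` E'), (D `&` D'); split; [exact: (filtI (natfilt_sigma X n))|exact: measurableI|].
by rewrite setIACA.
Qed.

Let gens_natfilt (n : int) E : natfilt X n E -> gens n (fst @^-1` E).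
Proof. by move=> FE; exists E, setT; split => //; rewrite preimage_setT setIT. Qed.

Let P' := pprod P lam.

Let rectE E D : measurable E -> measurable D ->
  P' (fst @^-1` E `&` snd @^-1` D) = P E * lam D.
Proof.
move=> mE mD; rewrite -[RHS](pprodX P lam mE mD); congr (P' _).
Qed.

Lemma extended_driven : driven P' extended_filtration (fun n w => X n w.1)
  (fun n w => f (tau n w.2)) K.
Proof.
split.
- by move=> n; exact: smallest_sigma_algebra.
- move=> n n0; apply: smallest_sub; last exact: gens_meas.
  exact: sigma_algebra_measurable.
- move=> n; apply: sub_sigma_algebra2 => _ [E [D [FE mD ->]]].
  have FE' : natfilt X (n + 1)%R E by apply: natfilt_le FE; rewrite lerDl.
  have [n0|n0] := leP 0%R n.
    exists E, D; split => //; congr (_ `&` _); apply/seteqP.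
    by split => w /=; rewrite /tau !min_r// (le_trans n0)// lerDl.
  exists E, (g @^-1` D); split => //; first exact: preim_measurable.
  by apply/seteqP; split => w [/= ? +]; rewrite (tauS _ n0) => ?; split.
- move=> n n0 B mB; apply: sub_sigma_algebra.
  exact: (gens_natfilt (natfilt_adapted (X := X) (lexx n) mB)).
- move=> n n0 D mD; apply: sub_sigma_algebra; exists setT, (f @^-1` D); split.
  + exact: (filtT (natfilt_sigma X n)).
  + exact: preim_measurable.
  + by rewrite preimage_setT setTI.
- move=> n E B D n0 FE mB mD.
  have n10 : (n + 1 <= 0)%R by rewrite lezD1.
  have mW : measurable ((fun w : O * R => X (n + 1)%R w.1) @^-1` B `&`
      (fun w => f (tau (n + 1)%R w.2)) @^-1` D).
    apply: measurableI.
      exact: (preim_measurable (measurableT_comp (mX n10) (@measurable_fst _ _ O R)) mB).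
    exact: (preim_measurable (measurableT_comp (measurableT_comp mf (mtau _)) (@measurable_snd _ _ O R)) mD).
  pose h (w : O * R) := K n (X n w.1) B.
  have mh : measurable_fun setT h.
    apply: (measurableT_comp (measurable_kernel (K n) _ mB)).
    exact: (measurableT_comp (mX (ltW n0)) (@measurable_fst _ _ O R)).
  have h0 w : 0 <= h w by [].
  have lD0 : (0 <= pr lam D)%R by exact: pr_ge0.
  (* Both sides of the one-step identity are finite measures in the event [E], so it suffices to
     compare them on the rectangles [gens]. *)
  pose m1 : {measure set (O * R) -> \bar R} := mrestr P' mW.
  pose m2 : {measure set (O * R) -> \bar R} := mscale (NngNum lD0) (integral_fun P' mh h0).
  have m1E C : m1 C = P' (C `&` ((fun w : O * R => X (n + 1)%R w.1) @^-1` B `&`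
      (fun w => f (tau (n + 1)%R w.2)) @^-1` D)) by [].
  have m2E C : m2 C = (\int[P']_(w in C) h w) * lam D.
    by rewrite /m2 /= /mscale /= prE// muleC.
  rewrite -setIA -m1E -m2E.
  have m12 W : gens n W -> m1 W = m2 W.
    move=> [E' [D' [FE' mD' ->]]].
    have mE' := natfilt_measurable mX (ltW n0) FE'.
    have mXB := preim_measurable (mX n10) mB.
    have mhO : measurable_fun setT (fun x => K n (X n x) B).
      exact: (measurableT_comp (measurable_kernel (K n) _ mB) (mX (ltW n0))).
    rewrite m1E m2E.
    (* The product of [lam D] and [lam D'] is the probability that the two parts of [tau (n + 1)],
       the noise at [n + 1] and [tau n], fall in [D] and [D']. *)
    transitivity (P (E' `&` X (n + 1)%R @^-1` B) * (lam D * lam D')).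
      have mDD : measurable (D `*` D') by exact: measurableX.
      have mfg : measurable_fun setT (fun u => (f u, g u)) by exact: measurable_fun_pair.
      have mV := preim_measurable mfg mDD.
      rewrite -(pprodX lam lam mD mD') -fgE// -(tau_law (n + 1)%R mV).
      rewrite -rectE; [|exact: measurableI|exact: (preim_measurable (mtau _) mV)].
      congr (P' _); apply/seteqP; split => -[x u] /=; rewrite (tauS _ n0).
        by move=> [[? ?] [? ?]].
      by move=> [[? ?] [? ?]].
    rewrite muleCA [RHS]muleC; congr (_ * _).
    have mG : measurable ((fun w : O * R => tau n w.2) @^-1` D').
      exact: (preim_measurable (measurableT_comp (mtau n) (@measurable_snd _ _ O R)) mD').
    rewrite (setIC (fst @^-1` E')) integral_mkcondr.
    have [_ /(_ n n0)[_ _ ->//]] := XK.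
    rewrite [X in X * _ = _]integral_mkcond.
    have mp : measurable_fun setT ((fun x => K n (X n x) B) \_ E').
      exact/(measurable_restrictT _ mE').1/measurable_funTS.
    have p0 x : 0 <= ((fun x => K n (X n x) B) \_ E') x.
      by rewrite patchE; case: ifP.
    have ind C : measurable C -> P' ((fun w : O * R => tau n w.2) @^-1` D' `&` fst @^-1` C) =
        P' ((fun w : O * R => tau n w.2) @^-1` D') * P C.
      move=> mC; have mtD := preim_measurable (mtau n) mD'.
      have e1 := rectE mC mtD; have e2 := rectE (@measurableT _ O) mtD.
      rewrite preimage_setT setTI probability_setT mul1e in e2.
      by rewrite setIC; apply: etrans e1 _; rewrite muleC; congr (_ * _); rewrite -e2.
    have := integral_indep (@measurable_fst _ _ O R) mG ind mp p0.
    have e2 := rectE (@measurableT _ O) (preim_measurable (mtau n) mD').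
    rewrite preimage_setT setTI probability_setT mul1e tau_law// in e2.
    have -> : P' ((fun w : O * R => tau n w.2) @^-1` D') = lam D' by rewrite -e2.
    rewrite muleC => <-; apply: eq_integral => w _.
    rewrite !patchE; congr (if _ then _ else _); by apply/idP/idP; rewrite !inE.
  have GT : gens n setT by rewrite -(preimage_setT fst); apply: gens_natfilt; exact: (filtT (natfilt_sigma X n)).
  apply: (measure_eq_sub (gens_meas (ltW n0)) (@gensI n) m12 _ _ FE); first exact: m12.
  by rewrite m1E setTI; exact: le_lt_trans (probability_le1 P' mW) (ltry _).
Qed.

Lemma extended_natfilt (n : int) E : natfilt X n E -> extended_filtration n (fst @^-1` E).
Proof. by move=> FE; apply: sub_sigma_algebra; exact: gens_natfilt. Qed.

End extension.

Section monotone_chain.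
Context {R : realType} {dd : dimension} dO (O : measurableType dO) (P : probability O R)
  (X : int -> O -> Rd R dd) (K : int -> R.-pker (Rd R dd) ~> (Rd R dd)).
Notation T := (Rd R dd).
Hypothesis XK : markov_with P X K.
Hypothesis mono : monotonic P X K.
Hypothesis ident : identifiable P X K.

Let mX (n : int) : (n <= 0)%R -> measurable_fun setT (X n).
Proof. by case: XK => + _; apply. Qed.

Let P' := pprod P lam.
Let X' (n : int) (w : O * R) := X n w.1.

Lemma pprod_fst (A : set O) : measurable A -> P' (fst @^-1` A) = P A.
Proof.
move=> mA; have := pprodX P lam mA (@measurableT _ R).
rewrite probability_setT mule1 => <-; congr (P' _).
by apply/seteqP; split => w // [].
Qed.

Lemma driven_extension : exists (F : int -> set (set (O * R))) (eta : int -> O * R -> R),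
  driven P' F X' eta K /\ forall n E, natfilt X n E -> F n (fst @^-1` E).
Proof.
have [f [g [mf mg fgE]]] := split_lam R.
exists (extended_filtration X g), (fun (n : int) w => f (iter `|Num.min n 0|%N g w.2)); split.
  exact: (extended_driven XK mf mg fgE).
exact: extended_natfilt.
Qed.

Lemma mixing_extension (n : int) : (n <= 0)%R -> mixing P X n -> mixing P' X' n.
Proof.
move=> n0 mix B mB e e0; have [N NP] := mix B mB e e0; exists N => j Nj D mD.
have nj : (n - j%:Z <= 0)%R by rewrite (le_trans _ n0)// lerBlDr lerDl.
have m1 := preim_measurable (mX n0) mB; have m2 := preim_measurable (mX nj) mD.
have prE' A : measurable A -> pr P' (fst @^-1` A) = pr P A.
  by move=> mA; rewrite /pr pprod_fst.
have := NP j Nj D mD.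
by rewrite -(prE' _ (measurableI _ _ m1 m2)) -(prE' _ m1) -(prE' _ m2).
Qed.

Lemma coupled_extension : order_coupled P' X' K.
Proof.
move=> n n0; have [C CP] := mono n0.
have [A [mA PA AS]] := support_carrier P (mX (ltW n0)).
exists C, A; split => //.
- by rewrite -PA -[RHS]pprod_fst//; exact: preim_measurable (mX (ltW n0)) mA.
- by move=> x x' /AS Ax /AS Ax'; exact: CP.
Qed.

Lemma separated_extension (n : int) : (n < 0)%R ->
  exists A : set T, [/\ measurable A, P' (X' n @^-1` A) = 1 &
  forall x y, A x -> A y -> (forall k (q : rat),
    K n x [set z | (ratr q < z k)%R] = K n y [set z | (ratr q < z k)%R]) -> x = y].
Proof.
move=> n0; have [C CP] := mono n0.
have [A [mA PA AS]] := support_carrier P (mX (ltW n0)).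
exists A; split => //.
- by rewrite -PA -[RHS]pprod_fst//; exact: preim_measurable (mX (ltW n0)) mA.
- move=> x y /AS Ax /AS Ay eqk; apply: (ident n0) => //.
  have [C1 C2 ord] := CP _ _ Ax Ay.
  apply: (kernel_separation (C := C (x, y)) _ C1 C2 _ eqk); first exact: prob_kernel.
  by move=> k; have [xy|/ltW yx] := leP (x k) (y k); [left; exact: (ord k).1|right; exact: (ord k).2].
Qed.

Lemma tail_indep_previous (n : int) : (n < 0)%R ->
  tail_indep P X (n + 1)%R -> tail_indep P X n.
Proof.
move=> n0 ind A B tA mB; have n10 : (n + 1 <= 0)%R by rewrite lezD1.
have mix := mixing_extension n10 (markov_mixing XK n10 ind).
have [F [eta [dr FE]]] := driven_extension.
have FA (a : int) : (a < n)%R -> F a (fst @^-1` A).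
  by move=> _; apply: FE; exact: tailf_natfilt.
have := previous_indep dr coupled_extension n0 (separated_extension n0) mix FA mB.
have mA := natfilt_measurable mX (lexx 0%R) (tA _ (lexx 0%R)).
have mXB := preim_measurable (mX (ltW n0)) mB.
by rewrite (pprod_fst mA) (pprod_fst mXB) (pprod_fst (measurableI _ _ mA mXB)).
Qed.

Lemma tail_indep_all : tail_indep P X 0%R -> forall n : int, (n <= 0)%R -> tail_indep P X n.
Proof.
move=> ind0 n n0; have -> : n = (- `|n|%N%:Z)%R by rewrite lez0_abs ?opprK.
elim: (`|n|)%N => [|i IH]; first by rewrite oppr0.
apply: tail_indep_previous => //.
by have -> : (- i.+1%:Z + 1 = - i%:Z :> int)%R by rewrite -addn1 PoszD; ring.
Qed.

End monotone_chain.

(** * Kolmogorov's zero-one law *)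

Section independent_sequence.
Context {R : realType} dO (O : measurableType dO) (P : probability O R) (xi : int -> O -> R).
Hypothesis mxi : forall n : int, (n <= 0)%R -> measurable_fun setT (xi n).
Hypothesis ind : mutually_independent P xi.

(** A cylinder up to [n] and one after [n] have disjoint sets of times, so they merge into one
    family to which mutual independence applies. Duplicates are removed because that property is
    stated for distinct times. *)
Lemma future_indep (n : int) (s : seq int) (B : int -> set R) : (n <= 0)%R ->
  (forall m, m \in s -> (n < m)%R /\ (m <= 0)%R) -> (forall m, measurable (B m)) ->
  let C := \bigcap_(m in [set` s]) xi m @^-1` B m in
  forall E, natfilt xi n E -> P (C `&` E) = P C * P E.
Proof.
move=> n0 sn mB C.
have C0 : cylinder xi 0%R C by exists s, B; split => // m /sn[].
have mC := cylinder_measurable mxi (lexx 0%R) C0.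
apply: (natfilt_indep mxi n0 mC) => _ [s' [B' [sn' mB' ->]]].
pose D m := if m \in undup s then B m else B' m.
have mD m : measurable (D m) by rewrite /D; case: ifP.
have disj m : m \in undup s' -> m \notin undup s.
  rewrite !mem_undup => /sn' mn; apply/negP => /sn[nm _].
  by move: nm; rewrite ltNge mn.
have e1 : C = \bigcap_(m in [set` undup s]) xi m @^-1` B m.
  by apply/seteqP; split => w h m /= ms; apply: h => /=; rewrite ?mem_undup// -mem_undup.
have e2 : \bigcap_(m in [set` s']) xi m @^-1` B' m =
    \bigcap_(m in [set` undup s']) xi m @^-1` B' m.
  by apply/seteqP; split => w h m /= ms; apply: h => /=; rewrite ?mem_undup// -mem_undup.
have e3 : (\bigcap_(m in [set` undup s]) xi m @^-1` B m) `&`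
    (\bigcap_(m in [set` undup s']) xi m @^-1` B' m) =
    \bigcap_(m in [set` undup s ++ undup s']) xi m @^-1` D m.
  apply/seteqP; split => w.
    move=> [h h'] m /=; rewrite mem_cat /D => /orP[ms|ms].
      by rewrite ms; exact: h.
    by rewrite (negbTE (disj _ ms)); exact: h'.
  move=> h; split => m /= ms.
    have /h : [set` undup s ++ undup s'] m by rewrite /= mem_cat ms.
    by rewrite /D ms.
  have /h : [set` undup s ++ undup s'] m by rewrite /= mem_cat ms orbT.
  by rewrite /D (negbTE (disj _ ms)).
have s0 m : m \in undup s -> (m <= 0)%R by rewrite mem_undup => /sn[].
have s0' m : m \in undup s' -> (m <= 0)%R by rewrite mem_undup => /sn' h; exact: le_trans n0.
rewrite e1 e2 e3 !ind ?undup_uniq//.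
- rewrite big_cat/=; congr (_ * _); apply: eq_big_seq => m ms.
    by rewrite /D ms.
  by rewrite /D (negbTE (disj _ ms)).
- rewrite cat_uniq !undup_uniq/= andbT; apply/hasPn => m; exact: disj.
- by move=> m; rewrite mem_cat => /orP[/s0|/s0'].
Qed.

End independent_sequence.

Section path_space.
Context {R : realType} dT (T : measurableType dT).

(** Path space serves to carry an event of one process to a copy of it on another probability space.
    Only nonpositive times generate its sigma-field, those at which laws are compared. *)
Definition paths := g_sigma_algebraType [set A : set (int -> T) |
  exists m : int, (m <= 0)%R /\ exists2 B : set T, measurable B & A = (fun x => x m) @^-1` B].

Definition proj (n : int) (x : paths) : T := x n.

Lemma natfilt_path d (O : measurableType d) (Y : int -> O -> T) (n : int) A :
  natfilt Y n A -> exists2 D, natfilt proj n D & A = (fun w m => Y m w) @^-1` D.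
Proof.
move: A; apply: smallest_sub.
  have sG := natfilt_sigma proj n; split.
  - by exists set0; [exact: (filt0 sG)|rewrite preimage_set0].
  - by move=> _ [D GD ->]; exists (~` D); [exact: (filtC sG)|rewrite setTD preimage_setC].
  - move=> E HE; have /choice[D ED] : forall i, exists D, natfilt proj n D /\ E i = (fun w m => Y m w) @^-1` D.
      by move=> i; have [D ? ?] := HE i; exists D.
    exists (\bigcup_i D i).
      by apply: (filt_bigcup sG) => i; have [] := ED i.
    by rewrite preimage_bigcup; apply: eq_bigcupr => i _; have [] := ED i.
move=> _ [m [mn [B mB ->]]]; exists (proj m @^-1` B) => //.
exact: (natfilt_adapted (X := proj) mn mB).
Qed.

Lemma path_natfilt d (O : measurableType d) (Y : int -> O -> T) (n : int) D :
  natfilt proj n D -> natfilt Y n ((fun w m => Y m w) @^-1` D).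
Proof.
move: D; apply: smallest_sub.
  have sG := natfilt_sigma Y n; split.
  - by rewrite /= preimage_set0; exact: (filt0 sG).
  - by move=> D /= GD; rewrite setTD preimage_setC; exact: (filtC sG).
  - by move=> D /= GD; rewrite preimage_bigcup; exact: (filt_bigcup sG).
by move=> _ [m [mn [B mB ->]]]; exact: (natfilt_adapted (X := Y) mn mB).
Qed.

Lemma path_measurable d (O : measurableType d) (Y : int -> O -> T) :
  (forall n : int, (n <= 0)%R -> measurable_fun setT (Y n)) ->
  measurable_fun setT ((fun w m => Y m w) : O -> paths).
Proof.
move=> mY _ D mD; rewrite setTI; apply: (natfilt_measurable mY (lexx 0%R)).
exact: (path_natfilt (n := 0%R) mD).
Qed.

Lemma path_law d1 (O1 : measurableType d1) (P1 : probability O1 R) (Y1 : int -> O1 -> T)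
    d2 (O2 : measurableType d2) (P2 : probability O2 R) (Y2 : int -> O2 -> T) D :
  (forall n : int, (n <= 0)%R -> measurable_fun setT (Y1 n)) ->
  (forall n : int, (n <= 0)%R -> measurable_fun setT (Y2 n)) ->
  same_law P1 Y1 P2 Y2 -> natfilt proj 0%R D ->
  P1 ((fun w m => Y1 m w) @^-1` D) = P2 ((fun w m => Y2 m w) @^-1` D).
Proof.
move=> m1 m2 sl FD.
have mp1 := path_measurable m1; have mp2 := path_measurable m2.
apply: (measure_eq_pi (T := paths) (m1 := law P1 mp1) (m2 := law P2 mp2)
  (G := cylinder proj 0%R)) => //.
- exact: (cylinder_natfilt proj 0%R).
- exact: cylinderI.
- exists [::], (fun=> setT); split => //; by apply/seteqP; split.
- move=> _ [s [B [s0 mB ->]]]; exact: (sl s B s0 mB).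
- exact: le_lt_trans (probability_le1 _ _) (ltry _).
Qed.

End path_space.

(** A tail event is, for each [n], the preimage of a path event [D n] of the coordinates up to [n],
    and [D n] varies with [n]. The symmetric difference of [D 0] and [D n] has empty preimage under
    [X], hence is null for the copy. So the copied event agrees almost surely with an event of the
    independent sequence up to [n], for every [n]; it is independent of every cylinder and thus of
    itself. *)
Lemma standard_kolmogorovian (R : realType) dO (O : measurableType dO) (P : probability O R)
    dT (T : measurableType dT) (X : int -> O -> T) :
  (forall n : int, (n <= 0)%R -> measurable_fun setT (X n)) ->
  standard P X -> kolmogorovian P (natfilt X).
Proof.
move=> mX [d2 [S2 [P' [X' [xi [mX' mxi sl ind [sub _]]]]]]] A tA.
have H (n : int) : exists D, natfilt (@proj _ T) n D /\ A = (fun w m => X m w) @^-1` D.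
  have FA : natfilt X n A by exact: tailf_natfilt.
  by have [D ? ?] := natfilt_path FA; exists D.
have {H}[D DP] := choice H.
pose A' n := (fun w m => X' m w) @^-1` D n.
have D0 (n : int) : (n <= 0)%R -> natfilt (@proj _ T) 0%R (D n).
  by move=> n0; apply: natfilt_le n0 _ _; have [] := DP n.
have mA' (n : int) : (n <= 0)%R -> measurable (A' n).
  by move=> n0; apply: (natfilt_measurable mX' (lexx 0%R)); exact: path_natfilt (D0 n n0).
have PA' (n : int) : (n <= 0)%R -> P A = P' (A' n).
  by move=> n0; rewrite -(path_law mX mX' sl (D0 n n0)) -(DP n).2.
have A'0 (n : int) : (n <= 0)%R -> {ae P', forall w, A' 0%R w <-> A' n w}.
  move=> n0; pose S := (D 0%R `&` ~` D n) `|` (D n `&` ~` D 0%R).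
  have sG := natfilt_sigma (@proj _ T) 0%R.
  have FS : natfilt (@proj _ T) 0%R S.
    apply: (filtU sG); apply: (filtI sG); try apply: (filtC sG); exact: D0.
  exists ((fun w m => X' m w) @^-1` S); split.
  - by apply: (natfilt_measurable mX' (lexx 0%R)); exact: path_natfilt.
  - rewrite -(path_law mX mX' sl FS) (_ : _ @^-1` S = set0) ?measure0//.
    apply/seteqP; split => // w.
    have e1 := (DP 0%R).2; have e2 := (DP n).2.
    have h1 : A w <-> D 0%R (fun m => X m w) by rewrite {1}e1.
    have h2 : A w <-> D n (fun m => X m w) by rewrite {1}e2.
    by move=> [[/h1 ? /= nD]|[/h2 ? /= nD]]; apply: nD; [exact/h2|exact/h1].
  - move=> w /= nA; have [a0|a0] := pselect (D 0%R (fun m => X' m w)).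
      by left; split => //= an; apply: nA; split.
    by right; split => //=; apply: contrapT => an; apply: nA; split => // /a0.
have xiA' (n : int) : (n <= 0)%R -> natfilt xi n (A' n).
  by move=> n0; apply: sub => //; apply: path_natfilt; have [] := DP n.
have cyl E : cylinder xi 0%R E -> P' (A' 0%R `&` E) = P' (A' 0%R) * P' E.
  move=> cE; have mE := cylinder_measurable mxi (lexx 0%R) cE.
  move: cE => [s [B [s0 mB EE]]].
  (* A time strictly before all those of [s], also when [s] is empty. *)
  pose n : int := (- (\max_(m <- s) `|m|%N).+1%:Z)%R.
  have n0 : (n <= 0)%R by rewrite oppr_le0.
  have sn m : m \in s -> (n < m)%R /\ (m <= 0)%R.
    move=> ms; have m0 := s0 _ ms; split => //.
    have mk : m = (- `|m|%N%:Z)%R by rewrite lez0_abs ?opprK.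
    rewrite mk ltrN2 ltz_nat ltnS.
    exact: (@leq_bigmax_seq _ s xpredT absz m ms isT).
  have -> : P' (A' 0%R `&` E) = P' (A' n `&` E).
    apply: eq_prob_ae; [apply: measurableI => //; exact: mA'|apply: measurableI => //; exact: mA'|].
    by apply: filterS (A'0 n n0) => w h; split => -[/h].
  have -> : P' (A' 0%R) = P' (A' n) by rewrite -!PA'.
  rewrite setIC muleC EE; exact: (future_indep mxi ind n0 sn mB (xiA' n n0)).
have := natfilt_indep mxi (lexx 0%R) (mA' _ (lexx 0%R)) cyl (xiA' _ (lexx 0%R)).
rewrite (PA' _ (lexx 0%R)) setIid -(prE P' (mA' _ (lexx 0%R))) -EFinM => -[] /eqP.
rewrite -subr_eq0 -{1}(mulr1 (pr P' _)) -mulrBr mulf_eq0 subr_eq0.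
by move=> /orP[/eqP ->|/eqP <-]; [left|right].
Qed.

(** * Immersion *)

Lemma null_of_integral (R : realType) d (T : measurableType d) (m : {measure set T -> \bar R})
    (N : set T) (f : T -> R) : measurable N -> measurable_fun setT f ->
  (forall x, N x -> (0 < f x)%R) -> \int[m]_(x in N) (f x)%:E <= 0 -> m N = 0.
Proof.
move=> mN mf f0 le0.
have i0 : \int[m]_(x in N) `|(f x)%:E| = 0.
  apply/eqP; rewrite eq_le integral_ge0// andbT; apply: le_trans le0.
  rewrite le_eqVlt; apply/orP; left; apply/eqP; apply: eq_integral => x; rewrite inE => Nx.
  by rewrite gee0_abs// lee_fin ltW// f0.
have mfN : measurable_fun N (EFin \o f) by exact/measurable_funTS/measurable_EFinP.
have /(ae_eq_integral_abs m mN mfN)[A [mA A0 NA]] := i0.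
apply: (subset_measure0 mN mA _ A0) => x Nx; apply: NA => /= /(_ Nx) [] fx0.
by have := f0 x Nx; rewrite fx0 ltxx.
Qed.

(* Layer cake: a factor [0 <= psi <= 1] is the integral of the indicators of [t <= psi]. *)
Lemma cexp_mul (R : realType) d (O : measurableType d) (P : probability O R)
    (G : set (set O)) (u v : O -> \bar R) (psi : O -> R) :
  sigma_algebra setT G -> G `<=` measurable ->
  measurable_fun setT u -> measurable_fun setT v ->
  (forall w, 0 <= u w) -> (forall w, 0 <= v w) ->
  (forall E, G E -> \int[P]_(w in E) u w = \int[P]_(w in E) v w) ->
  sub_measurable G psi -> (forall w, 0 <= psi w <= 1)%R ->
  forall E, G E -> \int[P]_(w in E) ((psi w)%:E * u w) = \int[P]_(w in E) ((psi w)%:E * v w).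
Proof.
move=> sG Gm mu mv u0 v0 uv Gpsi psi01 E GE.
have mpsi : measurable_fun setT psi by move=> _ B mB; rewrite setTI; apply: Gm; exact: Gpsi.
have key (h : O -> \bar R) : measurable_fun setT h -> (forall w, 0 <= h w) ->
    \int[P]_(w in E) ((psi w)%:E * h w) =
    \int[lam]_t \int[P]_(w in E `&` [set w | (t <= psi w)%R]) h w.
  move=> mh h0.
  pose W := [set p : O * R | E p.1 /\ (p.2 <= psi p.1)%R].
  have mW : measurable W by exact: (measurable_subgraph (Gm _ GE) mpsi).
  pose H (p : O * R) := (\1_W p)%:E * h p.1.
  have mH : measurable_fun setT H.
    apply: emeasurable_funM; first exact/measurable_EFinP/measurable_indic.
    exact: (measurableT_comp mh (@measurable_fst _ _ O R)).
  have H0 p : 0 <= H p by apply: mule_ge0 => //; rewrite lee_fin.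
  have inner w : \int[lam]_t H (w, t) = ((fun w => (psi w)%:E * h w) \_ E) w.
    have mt : measurable [set t : R | (t <= psi w)%R] by rewrite -set_itvNyc; exact: measurable_itv.
    rewrite patchE; case: ifPn => wE.
      rewrite -(lam_le (psi01 w)).
      transitivity (\int[lam]_t ((\1_[set t : R | (t <= psi w)%R] t)%:E * h w)).
        apply: eq_integral => t _; rewrite /H; congr (_%:E * _); rewrite !indicE; congr ((nat_of_bool _)%:R)%R.
        by apply/idP/idP; rewrite !inE /W //=; [case|split => //; rewrite inE in wE].
      rewrite ge0_integralZr//; last exact/measurable_EFinP/measurable_indic.
      by rewrite integral_indic// setIT.
    rewrite integral0_eq// => t _; rewrite /H indicE memNset ?mul0e// => -[/= Ew _].
    by move: wE; rewrite mem_set.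
  rewrite integral_mkcond -(eq_integral _ _ (fun w _ => inner w)).
  rewrite (fubini_tonelli H)//; apply: eq_integral => t _.
  rewrite [RHS]integral_mkcond; apply: eq_integral => w _; rewrite patchE /H /= indicE.
  have -> : ((w, t) \in W) = (w \in E `&` [set w | (t <= psi w)%R]) by apply/idP/idP; rewrite !inE.
  by case: ifP => _; rewrite ?mul1e ?mul0e.
rewrite (key u mu u0) (key v mv v0); apply: eq_integral => t _; apply: uv; apply: (filtI sG GE).
have -> : [set w | (t <= psi w)%R] = psi @^-1` `[t, +oo[%classic.
  by apply/seteqP; split => w /=; rewrite in_itv/= andbT.
by apply: Gpsi; exact: measurable_itv.
Qed.

Section conditional_expectation.
Context {R : realType} dO (O : measurableType dO) (P : probability O R).

(** Integrating [g] over the events [g < 0] and [g > 1], which belong to [G], shows that both are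
    null. Truncation yields the bounds that [cexp_mul] requires. *)
Lemma cexp_bounded_version (G : set (set O)) (b : set O) (g : O -> R) :
  G `<=` measurable -> measurable b -> cexp_version P G (\1_b) g ->
  exists g' : O -> R, [/\ sub_measurable G g', forall w, (0 <= g' w <= 1)%R,
    {ae P, forall w, g w = g' w} &
    forall E, G E -> \int[P]_(w in E) (g' w)%:E = P (E `&` b)].
Proof.
move=> Gm mb [Gg ig gE].
have mg : measurable_fun setT g by move=> _ B mB; rewrite setTI; apply: Gm; exact: Gg.
have gEb E : G E -> \int[P]_(w in E) (g w)%:E = P (E `&` b).
  move=> GE; rewrite gE// integral_indic//; last exact: Gm.
  by rewrite setIC.
have G1 : G [set w | (g w < 0)%R].
  have -> : [set w | (g w < 0)%R] = g @^-1` `]-oo, 0%R[%classic.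
    by apply/seteqP; split => w /=; rewrite in_itv.
  by apply: Gg; exact: measurable_itv.
have G2 : G [set w | (1 < g w)%R].
  have -> : [set w | (1 < g w)%R] = g @^-1` `]1%R, +oo[%classic.
    by apply/seteqP; split => w /=; rewrite in_itv/= andbT.
  by apply: Gg; exact: measurable_itv.
have N1 : P [set w | (g w < 0)%R] = 0.
  apply: (null_of_integral (f := fun w => - g w)%R); first exact: Gm.
  - exact: measurableT_comp.
  - by move=> w; rewrite oppr_gt0.
  - rewrite -[leLHS]oppeK -integral_ge0N; last by move=> w /= /ltW; rewrite lee_fin oppr_ge0.
    under eq_integral do rewrite -EFinN opprK.
    by rewrite gEb// oppe_le0.
have N2 : P [set w | (1 < g w)%R] = 0.
  have m2 := Gm _ G2.
  apply: (null_of_integral (f := fun w => g w - 1)%R) => //.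
  - exact: measurable_funB.
  - by move=> w; rewrite subr_gt0.
  - have fin : P [set w | (1 < g w)%R] \is a fin_num by exact: fin_num_measure.
    rewrite -(leeD2lE _ _ fin) adde0.
    rewrite -[X in X + _](mul1e (P _)) -integral_cst// -ge0_integralD//; last 2 first.
    + by move=> w /ltW; rewrite lee_fin subr_ge0.
    + by apply/measurable_funTS/measurable_EFinP; exact: measurable_funB.
    rewrite (eq_integral (fun w => (g w)%:E)); last first.
      by move=> w _; rewrite /= -EFinD addrC subrK.
    rewrite gEb//; apply: le_measure; rewrite ?inE//; exact: measurableI.
pose g' w := Num.min (Num.max (g w) 0%R) 1%R.
have ae : {ae P, forall w, g w = g' w}.
  exists ([set w | (g w < 0)%R] `|` [set w | (1 < g w)%R]); split.
  - by apply: measurableU; exact: Gm.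
  - by apply: null_set_setU => //; exact: Gm.
  - move=> w /= ngg; have [g0|g0] := ltP (g w) 0%R; first by left.
    have [g1|g1] := ltP 1%R (g w); first by right.
    by exfalso; apply: ngg; rewrite /g' max_l// min_l.
have mg' : measurable_fun setT g'.
  by apply: measurable_minr => //; exact: measurable_maxr.
exists g'; split => //.
- have mc : measurable_fun setT (fun x : R => Num.min (Num.max x 0%R) 1%R).
    by apply: measurable_minr => //; exact: measurable_maxr.
  by move=> U mU; exact: (Gg _ (preim_measurable mc mU)).
- by move=> w; rewrite /g' le_min ler01 le_max lexx orbT/= ge_min lexx orbT.
- move=> E GE; rewrite -gEb//; apply: ae_eq_integral; first exact: Gm.
  + exact/measurable_funTS/measurable_EFinP.
  + exact/measurable_funTS/measurable_EFinP.
  + by apply: filterS ae => w -> _.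
Qed.

(** Both given versions are replaced by bounded ones. Integrating [g'] over the intersection of [A]
    and [a] gives the probability of the triple intersection, and there the indicator of [a] may be
    replaced by [f'], since [g'] is measurable at time [n]. *)
Lemma markov_immersed dT (T : measurableType dT) (Y : int -> O -> T) (K : int -> R.-pker T ~> T)
    (G : int -> set (set O)) :
  (forall n : int, (n <= 0)%R -> sigma_algebra setT (G n)) ->
  (forall n : int, (n <= 0)%R -> G n `<=` measurable) ->
  (forall n : int, (n <= 0)%R -> natfilt Y n `<=` G n) ->
  (forall n : int, (n <= 0)%R -> measurable_fun setT (Y n)) ->
  (forall (n : int) E B, (n < 0)%R -> G n E -> measurable B ->
    P (E `&` Y (n + 1)%R @^-1` B) = \int[P]_(w in E) K n (Y n w) B) ->
  immersed P (natfilt Y) G.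
Proof.
move=> sG Gm YG mY YK; split => [//|n n0 a b Ya Gb f g fv gv].
have n10 : (n + 1 <= 0)%R by rewrite lezD1.
have ma := natfilt_measurable mY n10 Ya; have mb := Gm _ (ltW n0) _ Gb.
have sC := natfilt_sigma Y n; have Cm := natfilt_measurable mY (ltW n0).
have [f' [Cf f01 ff' fE]] := cexp_bounded_version Cm ma fv.
have [g' [Cg g01 gg' gE]] := cexp_bounded_version Cm mb gv.
have subm (h : O -> R) : sub_measurable (natfilt Y n) h -> measurable_fun setT h.
  by move=> Ch _ B mB; rewrite setTI; apply: Cm; exact: Ch.
have mf' := subm _ Cf; have mg' := subm _ Cg.
have [Cf0 _ _] := fv; have [Cg0 _ _] := gv.
have mf := subm _ Cf0; have mg := subm _ Cg0.
have mfg : measurable_fun setT (f \* g)%R by exact: measurable_funM.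
have mfg' : measurable_fun setT (f' \* g')%R by exact: measurable_funM.
have fg : {ae P, forall w, (f \* g)%R w = (f' \* g')%R w}.
  by apply: filterS2 ff' gg' => w /= -> ->.
have eg0 w : 0 <= (g' w)%:E by rewrite lee_fin; case/andP: (g01 w).
have ef0 w : 0 <= (f' w)%:E by rewrite lee_fin; case/andP: (f01 w).
have meg := (measurable_EFinP _ _).2 mg'; have mef := (measurable_EFinP _ _).2 mf'.
(* [g'] is also a conditional probability of [b] given the larger sigma-field at time [n + 1]. *)
have key : forall a', natfilt Y (n + 1)%R a' -> P (a' `&` b) = \int[P]_(w in a') (g' w)%:E.
  pose Pi := [set a' | exists E B, [/\ natfilt Y n E, measurable B & a' = E `&` Y (n + 1)%R @^-1` B]].
  have Pim : Pi `<=` measurable.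
    move=> _ [E [B [CE mB ->]]]; apply: measurableI; first exact: Cm.
    exact: preim_measurable (mY _ n10) mB.
  have PiI : setI_closed Pi.
    move=> _ _ [E [B [CE mB ->]]] [E' [B' [CE' mB' ->]]]; exists (E `&` E'), (B `&` B').
    split; [exact: (filtI sC)|exact: measurableI|by rewrite setIACA].
  have PiT : Pi setT.
    by exists setT, setT; split => //; [exact: (filtT sC)|rewrite preimage_setT setIT].
  have sub : natfilt Y (n + 1)%R `<=` <<s Pi >>.
    apply: sub_sigma_algebra2 => _ [m [mn [B mB ->]]].
    have [mn'|nm] := leP m n.
      exists (Y m @^-1` B), setT; split => //; first exact: (natfilt_adapted (X := Y)).
      by rewrite preimage_setT setIT.
    have -> : m = (n + 1)%R by apply/eqP; rewrite eq_le mn/= lezD1.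
    by exists setT, B; split => //; [exact: (filtT sC)|rewrite setTI].
  pose m1 : {measure set O -> \bar R} := mrestr P mb.
  pose m2 : {measure set O -> \bar R} := integral_fun P meg eg0.
  have m12 : forall a', Pi a' -> m1 a' = m2 a'.
    move=> _ [E [B [CE mB ->]]].
    have -> : m1 (E `&` Y (n + 1)%R @^-1` B) = P ((E `&` b) `&` Y (n + 1)%R @^-1` B).
      by rewrite /m1 /= /mrestr setIAC.
    have -> : m2 (E `&` Y (n + 1)%R @^-1` B) =
      \int[P]_(w in E `&` Y (n + 1)%R @^-1` B) (g' w)%:E by [].
    have mYB := preim_measurable (mY _ n10) mB.
    have mE := Cm _ CE.
    pose h y := fine (K n y B).
    have hE y : (h y)%:E = K n y B by rewrite fineK// kernel_fin_num.
    have mh : measurable_fun setT h.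
      by apply: measurableT_comp => //; exact: measurable_kernel.
    have h01 w : (0 <= h (Y n w) <= 1)%R.
      rewrite /h fine_ge0//= -lee_fin hE -(prob_kernel (s := K n) (Y n w)).
      by apply: le_measure; rewrite ?inE.
    have Ch : sub_measurable (natfilt Y n) (h \o Y n).
      by move=> U mU; exact: (natfilt_adapted (X := Y) (lexx n) (preim_measurable mh mU)).
    have mhY : measurable_fun setT (fun w => (h (Y n w))%:E).
      exact/measurable_EFinP/(subm _ Ch).
    (* Conditioning on [G n] brings in [h] of [Y n]. This factor is measurable for [natfilt Y n], so
       the indicator of [b] may be replaced by [g']; then the conditioning of the next state is
       undone, with [g'] as the factor. *)
    rewrite YK//; last by apply: (filtI (sG _ (ltW n0))) => //; exact: (YG _ (ltW n0)).
    transitivity (\int[P]_(w in E) ((h (Y n w))%:E * (\1_b w)%:E)).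
      rewrite integral_mkcondr; apply: eq_integral => w _; rewrite patchE indicE hE.
      by case: ifP; rewrite ?mule1 ?mule0.
    have ind0 (D : set O) w : 0 <= (\1_D w : R)%:E by rewrite lee_fin.
    have mind (D : set O) : measurable D -> measurable_fun setT (fun w => (\1_D w : R)%:E).
      by move=> mD; exact/measurable_EFinP/measurable_indic.
    have h0 w : 0 <= (h (Y n w))%:E by rewrite lee_fin; case/andP: (h01 w).
    transitivity (\int[P]_(w in E) ((h (Y n w))%:E * (g' w)%:E)).
      have bg E' : natfilt Y n E' -> \int[P]_(w in E') (\1_b w)%:E = \int[P]_(w in E') (g' w)%:E.
        move=> CE'; rewrite gE// integral_indic//; [by rewrite setIC|exact: Cm].
      exact: (cexp_mul sC Cm (mind _ mb) meg (ind0 b) eg0 bg Ch h01 CE).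
    transitivity (\int[P]_(w in E) ((g' w)%:E * (\1_(Y (n + 1)%R @^-1` B) w)%:E)).
      under eq_integral do rewrite muleC.
      have hb E' : natfilt Y n E' -> \int[P]_(w in E') (h (Y n w))%:E =
          \int[P]_(w in E') (\1_(Y (n + 1)%R @^-1` B) w)%:E.
        move=> CE'; rewrite integral_indic//; last exact: Cm.
        transitivity (P (E' `&` Y (n + 1)%R @^-1` B)); last by rewrite setIC.
        rewrite YK//; last exact: (YG _ (ltW n0)).
        by apply: eq_integral => w _; rewrite hE.
      exact: (cexp_mul sC Cm mhY (mind _ mYB) h0 (ind0 _) hb Cg g01 CE).
    rewrite [RHS]integral_mkcondr; apply: eq_integral => w _; rewrite patchE indicE.
    by case: ifP; rewrite ?mule1 ?mule0.
  move=> a' /sub sa'.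
  have := measure_eq_sub Pim PiI m12 (m12 _ PiT) _ sa'.
  rewrite /m1 /m2 /= /mrestr /integral_fun; apply.
  by rewrite setTI; exact: le_lt_trans (probability_le1 P mb) (ltry _).
split.
- have : @measurable_fun _ _ (g_sigma_algebraType (natfilt Y n)) _ setT (f \* g)%R.
    apply: measurable_funM => _ B mB; rewrite setTI measurable_gE//; [exact: Cf0|exact: Cg0].
  move=> h U mU; have := h (@measurableT _ (g_sigma_algebraType (natfilt Y n))) U mU.
  by rewrite setTI measurable_gE.
- apply/integrableP; split; first exact/measurable_EFinP.
  apply: (@le_lt_trans _ _ (\int[P]_w (cst 1 w))); last first.
    by rewrite integral_cst// mul1e; exact: le_lt_trans (probability_le1 P measurableT) (ltry _).
  rewrite (ge0_ae_eq_integral (g := fun w => `|((f' \* g')%R w)%:E|))//.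
  + apply: ge0_le_integral => //.
    * by apply: measurableT_comp => //; exact/measurable_EFinP.
    * move=> w _ /=; have /andP[f0 f1] := f01 w; have /andP[g0 g1] := g01 w.
      by rewrite lee_fin ger0_norm ?mulr_ge0// mulr_ile1.
  + by apply: measurableT_comp => //; exact/measurable_EFinP.
  + by apply: measurableT_comp => //; exact/measurable_EFinP.
  + by apply: filterS fg => w /= h _; rewrite h.
- move=> A CA; have mA := Cm _ CA.
  transitivity (\int[P]_(w in A) ((f' \* g')%R w)%:E).
    apply: ae_eq_integral => //.
    + exact/measurable_funTS/measurable_EFinP.
    + exact/measurable_funTS/measurable_EFinP.
    + by apply: filterS fg => w /= h _; rewrite h.
  have mab := measurableI _ _ ma mb.
  rewrite integral_indic//; transitivity (P ((A `&` a) `&` b)); last by rewrite (setIC (a `&` b)) setIA.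
  rewrite key; last first.
    by apply: (filtI (natfilt_sigma Y _)) => //; apply: natfilt_le CA; rewrite lerDl.
  have ia E : natfilt Y n E -> \int[P]_(w in E) (f' w)%:E = \int[P]_(w in E) (\1_a w)%:E.
    move=> CE; rewrite fE// integral_indic//; [by rewrite setIC|exact: Cm].
  have mia : measurable_fun setT (fun w => (\1_a w : R)%:E).
    exact/measurable_EFinP/measurable_indic.
  have ia0 w : 0 <= (\1_a w : R)%:E by rewrite lee_fin.
  transitivity (\int[P]_(w in A) ((g' w)%:E * (f' w)%:E)).
    by apply: eq_integral => w _; rewrite /= mulrC EFinM.
  rewrite (cexp_mul sC Cm mef mia ef0 ia0 ia Cg g01 CA).
  rewrite [RHS]integral_mkcondr; apply: eq_integral => w _; rewrite patchE indicE.
  by case: ifP; rewrite ?mule1 ?mule0.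
Qed.

End conditional_expectation.

(** * Innovations generating the chain *)

(** With errors [e N i] summable in [i], the union over [i] of the approximations covers [W] almost
    surely, because one of the errors is as small as desired, and exceeds [W] by at most [1/(N+1)],
    the sum of the errors. The intersection over [N] removes the excess. *)
Lemma approximable_event (R : realType) dO (O : measurableType dO) (P : probability O R)
    (G : set (set O)) (W : set O) : sigma_algebra setT G -> G `<=` measurable -> measurable W ->
  (forall e : R, (0 < e)%R -> exists E, [/\ G E, (pr P (W `\` E) <= e)%R & (pr P (E `\` W) <= e)%R]) ->
  exists E, G E /\ {ae P, forall w, W w <-> E w}.
Proof.
move=> sG Gm mW appr.
pose e (N i : nat) : R := (N.+1%:R^-1 / (2 ^ i.+1)%:R)%R.
have e0 N i : (0 < e N i)%R by rewrite divr_gt0// ltr0n expn_gt0.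
have H (p : nat * nat) : exists E, [/\ G E, (pr P (W `\` E) <= e p.1 p.2)%R & (pr P (E `\` W) <= e p.1 p.2)%R].
  exact: appr.
have [E EP] := choice H.
have GE N i : G (E (N, i)) by have [] := EP (N, i).
pose Fn N := \bigcup_i E (N, i).
have GF N : G (Fn N) by exact: (filt_bigcup sG).
have GL : G (\bigcap_N Fn N) by exact: (filt_bigcap sG).
have null (A : set O) : measurable A -> (forall r : R, (0 < r)%R -> (pr P A <= r)%R) -> P A = 0.
  move=> mA h; rewrite -prE//; congr EFin; apply/eqP; rewrite eq_le pr_ge0 andbT.
  by apply/ler_addgt0Pl => r r0; rewrite addr0; exact: h.
have n1 N : P (W `\` Fn N) = 0.
  apply: null => [|r r0]; first by apply: measurableD => //; exact: Gm.
  have [i ir] : exists i, (e N i <= r)%R.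
    have [i _ /(_ i (leqnn i))] := near_infty_natSinv_lt (PosNum r0).
    move=> /= ir; exists i; apply: le_trans (ltW ir); rewrite /e.
    rewrite -[leRHS]mul1r; apply: ler_pM => //; first by rewrite invf_le1// ler1n.
    by rewrite lef_pV2 ?posrE ?ltr0n ?expn_gt0// ler_nat ltnW// ltn_expl.
  apply: le_trans ir; have [_ h _] := EP (N, i); apply: le_trans h; apply: pr_le.
  - by apply: measurableD => //; exact: Gm.
  - by apply: measurableD => //; exact: Gm.
  - by move=> w [Ww nF]; split => // Ew; apply: nF; exists i.
have n2 : P (\bigcap_N Fn N `\` W) = 0.
  apply: null => [|r r0]; first by apply: measurableD => //; exact: Gm.
  have [N _ /(_ N (leqnn N))] := near_infty_natSinv_lt (PosNum r0).
  move=> /= Nr; apply: le_trans (ltW Nr).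
  have mEW i : measurable (E (N, i) `\` W) by apply: measurableD => //; exact: Gm.
  have mU : measurable (\bigcup_i (E (N, i) `\` W)) by exact: bigcupT_measurable.
  apply: (@le_trans _ _ (pr P (\bigcup_i (E (N, i) `\` W)))).
    apply: pr_le => //; first by apply: measurableD => //; exact: Gm.
    by move=> w [h nW]; have [i _ Ei] := h N I; exists i.
  rewrite -lee_fin prE//.
  apply: le_trans (generalized_Boole_inequality P mEW mU) _.
  apply: (@le_trans _ _ (\sum_(i <oo) (e N i)%:E)).
    apply: lee_nneseries => [i _ _|i _]; first exact: measure_ge0.
    have [_ _ h] := EP (N, i); rewrite -lee_fin prE in h; last exact: mEW.
    exact: h.
  rewrite /e; have N0 : (0 <= N.+1%:R^-1 :> R)%R by [].
  by have := epsilon_trick0 xpredT N0; apply.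
exists (\bigcap_N Fn N); split => //.
exists (\bigcup_N (W `\` Fn N) `|` (\bigcap_N Fn N `\` W)); split.
- apply: measurableU; last by apply: measurableD => //; exact: Gm.
  by apply: bigcupT_measurable => N; apply: measurableD => //; exact: Gm.
- apply: null_set_setU => //.
  + by apply: bigcupT_measurable => N; apply: measurableD => //; exact: Gm.
  + by apply: measurableD => //; exact: Gm.
  + apply/negligibleP; first by apply: bigcupT_measurable => N; apply: measurableD => //; exact: Gm.
    apply: negligible_bigcup => N; apply/negligibleP; last exact: n1.
    by apply: measurableD => //; exact: Gm.
- move=> w /= nW; have [Ww|Ww] := pselect (W w).
    left; apply: contrapT => h; apply: nW; split => // _ N _.
    by apply: contrapT => nF; apply: h; exists N.
  by right; split => //; apply: contrapT => h; apply: nW; split.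
Qed.

Lemma bounded_uniform (Q : nat -> nat -> Prop) :
  (forall q N N', Q q N -> (N <= N')%N -> Q q N') -> (forall q, exists N, Q q N) ->
  forall L, exists N, forall q, (q < L)%N -> Q q N.
Proof.
move=> mono ex; elim=> [|L [N NP]]; first by exists 0%N.
have [N' N'P] := ex L; exists (maxn N N') => q; rewrite ltnS leq_eqVlt => /predU1P[->|qL].
  exact: mono N'P (leq_maxr _ _).
exact: mono (NP _ qL) (leq_maxl _ _).
Qed.

Section innovations.
Context {R : realType} {dd : dimension} dO (O : measurableType dO) (P : probability O R)
  (F : int -> set (set O)) (X : int -> O -> Rd R dd)
  (eta : int -> O -> R) (K : int -> R.-pker (Rd R dd) ~> (Rd R dd)).
Notation T := (Rd R dd).
Hypothesis dr : driven P F X eta K.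
Hypothesis coupled : order_coupled P X K.
Hypothesis mix : forall n : int, (n <= 0)%R -> mixing P X n.

Let mX (n : int) : (n <= 0)%R -> measurable_fun setT (X n).
Proof. by move=> n0; exact (adapted_measurable (driven_meas dr n0) (driven_X dr n0)). Qed.

Definition noise_gens (V : int -> O -> R) (m n : int) : set (set O) :=
  [set A | exists p : int, [/\ (m < p)%R, (p <= n)%R &
     exists2 B : set R, measurable B & A = V p @^-1` B]].

Definition noise (V : int -> O -> R) (m n : int) := <<s noise_gens V m n >>.

Definition innovation (V : int -> O -> R) (n : int) := adapted (F n) (V n) /\
  forall E D, F (n - 1)%R E -> measurable D -> P (E `&` V n @^-1` D) = P E * lam D.

Lemma noise_sigma V m n : sigma_algebra setT (noise V m n).
Proof. exact: smallest_sigma_algebra. Qed.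

Lemma noise_adapted V (m p n : int) : (m < p)%R -> (p <= n)%R -> adapted (noise V m n) (V p).
Proof. by move=> mp pn B mB; apply: sub_sigma_algebra; exists p; split => //; exists B. Qed.

Lemma noise_filt V (m n : int) : (forall p : int, (m < p)%R -> (p <= n)%R -> innovation V p) ->
  noise V m n `<=` F n.
Proof.
move=> inV; apply: smallest_sub; first exact: (driven_sigma dr n).
move=> _ [p [mp pn [B mB ->]]]; have [aV _] := inV p mp pn.
by apply: (driven_le dr pn); exact: aV.
Qed.

Lemma noise_le V V' (m m' n n' : int) : (forall p : int, (m < p)%R -> V' p = V p) ->
  (m' <= m)%R -> (n <= n')%R -> noise V m n `<=` noise V' m' n'.
Proof.
move=> VV m'm nn'; apply: sub_sigma_algebra2 => _ [p [mp pn [B mB ->]]].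
exists p; split; [exact: le_lt_trans mp|exact: le_trans nn'|].
by exists B => //; rewrite VV.
Qed.

(** Adding one time: [V (n + 1)] is independent of [F n], which contains both [E] and the noise up
    to [n]. *)
Lemma noise_indep V (m : int) (i : nat) : (m + i%:Z <= 0)%R ->
  (forall p : int, (m < p)%R -> (p <= m + i%:Z)%R -> innovation V p) ->
  forall E D, F m E -> noise V m (m + i%:Z)%R D -> P (E `&` D) = P E * P D.
Proof.
elim: i => [|i IH] mi inV E D FE ND.
  rewrite addr0 in mi ND *; have mE := driven_meas dr mi FE.
  apply: (indep_sub (G := [set setT]) _ _ mE _ _) => //.
  - by move=> _ ->.
  - by move=> _ _ -> ->; rewrite /= setIT.
  - by move=> _ ->; rewrite setIT probability_setT mule1.
  - move: D ND; apply: sub_sigma_algebra2 => A [p [mp pm _]].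
    by move: mp; rewrite ltNge pm.
have ni : (m + i.+1%:Z = m + i%:Z + 1 :> int)%R by rewrite -addn1 PoszD addrA.
rewrite ni in mi inV ND; set n := (m + i%:Z)%R in IH mi inV ND ni.
have mn : (m <= n)%R by rewrite /n lerDl.
have n0 : (n <= 0)%R by apply: le_trans mi; rewrite lerDl.
have inVn (p : int) : (m < p)%R -> (p <= n)%R -> innovation V p.
  by move=> mp pn; apply: inV => //; apply: le_trans pn _; rewrite lerDl.
have mE := driven_meas dr (le_trans mn n0) FE.
have [aV VI] : innovation V (n + 1)%R.
  by apply: inV => //; rewrite (le_lt_trans mn)// ltrDl.
rewrite addrK in VI.
have mV := adapted_measurable (driven_meas dr mi) aV.
have Nn D' : noise V m n D' -> F n D' by exact: noise_filt.
pose Pi := [set A | exists D1 B, [/\ noise V m n D1, measurable B & A = D1 `&` V (n + 1)%R @^-1` B]].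
have PVl B : measurable B -> P (V (n + 1)%R @^-1` B) = lam B.
  move=> mB; have := VI _ _ (filtT (driven_sigma dr n)) mB.
  by rewrite setTI probability_setT mul1e.
apply: (indep_sub (G := Pi) _ _ mE) => //.
- move=> _ [D1 [B [ND1 mB ->]]]; apply: measurableI; first exact: (driven_meas dr n0 (Nn _ ND1)).
  exact: preim_measurable.
- move=> _ _ [D1 [B [ND1 mB ->]]] [D2 [B' [ND2 mB' ->]]]; exists (D1 `&` D2), (B `&` B').
  split; [exact: (filtI (noise_sigma V m n))|exact: measurableI|by rewrite setIACA].
- move=> _ [D1 [B [ND1 mB ->]]].
  rewrite setIA VI//; last first.
    by apply: (filtI (driven_sigma dr n)); [exact: (driven_le dr mn)|exact: Nn].
  by rewrite IH// VI//; [rewrite muleA|exact: Nn].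
- move: D ND; apply: sub_sigma_algebra2 => _ [p [mp pn [B mB ->]]].
  have [pn'|np] := leP p n.
    exists (V p @^-1` B), setT; split => //.
      exact: (noise_adapted mp pn').
    by rewrite preimage_setT setIT.
  have -> : p = (n + 1)%R by apply/eqP; rewrite eq_le pn/= lezD1.
  by exists setT, B; split => //; [exact: (filtT (noise_sigma V m n))|rewrite setTI].
Qed.

(** The innovations after [m], together with [X m], determine the later states almost surely. The
    auxiliary [Z] is chosen anew at each time, because several blocks may follow one another after
    [m]. *)
Definition innovated (m : int) (V : int -> O -> R) :=
  (forall p : int, (m < p)%R -> (p <= 0)%R -> innovation V p) /\
  (forall n : int, (m <= n)%R -> (n < 0)%R -> exists (Z : O -> T) (rho : (T * T) * R -> T),
    [/\ adapted (noise V m n) Z, measurable_fun setT rho &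
        {ae P, forall w, X (n + 1)%R w = rho ((X n w, Z w), V (n + 1)%R w)}]).

Lemma innovated_fun (m : int) V (i : nat) : innovated m V -> (m + i%:Z <= 0)%R ->
  exists psi : T * g_sigma_algebraType (noise_gens V m (m + i%:Z)%R) -> T,
    measurable_fun setT psi /\ {ae P, forall w, X (m + i%:Z)%R w = psi (X m w, w)}.
Proof.
move=> [inV rec]; elim: i => [|i IH] mi.
  by rewrite addr0; exists fst; split; [exact: measurable_fst|exact: nearW].
have ni : (m + i.+1%:Z = m + i%:Z + 1 :> int)%R by rewrite -addn1 PoszD addrA.
rewrite ni in mi *; set n := (m + i%:Z)%R in IH mi ni *.
have n0 : (n < 0)%R by rewrite -lezD1.
have mn : (m <= n)%R by rewrite /n lerDl.
have [psi [mpsi psiE]] := IH (ltW n0).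
have [Z [rho [aZ mrho rhoE]]] := rec n mn n0.
pose S := g_sigma_algebraType (noise_gens V m n).
pose S1 := g_sigma_algebraType (noise_gens V m (n + 1)%R).
have NN : noise V m n `<=` noise V m (n + 1)%R by apply: noise_le => //; rewrite lerDl.
have mid : @measurable_fun _ _ S1 S setT id.
  by move=> _ A mA; rewrite setTI preimage_id; exact: NN.
have ms : measurable_fun setT (fun q : T * S1 => (q.2 : S)).
  exact: (measurableT_comp mid (@measurable_snd _ _ T S1)).
have mZ : measurable_fun setT (fun q : T * S1 => Z q.2).
  have mZS : @measurable_fun _ _ S T setT Z by move=> _ A mA; rewrite setTI; exact: aZ.
  exact: (measurableT_comp mZS ms).
have mV : measurable_fun setT (fun q : T * S1 => V (n + 1)%R q.2).
  have mVS : @measurable_fun _ _ S1 R setT (V (n + 1)%R).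
    move=> _ A mA; rewrite setTI; apply: (noise_adapted (V := V)) => //.
    by rewrite (le_lt_trans mn)// ltrDl.
  exact: (measurableT_comp mVS (@measurable_snd _ _ T S1)).
have mp : measurable_fun setT (fun q : T * S1 => psi (q.1, q.2)).
  apply: (measurableT_comp mpsi); exact: (measurable_fun_pair (@measurable_fst _ _ T S1) ms).
exists (fun q => rho ((psi (q.1, q.2), Z q.2), V (n + 1)%R q.2)); split.
  exact: (measurableT_comp mrho (measurable_fun_pair (measurable_fun_pair mp mZ) mV)).
by apply: filterS2 psiE rhoE => w <- ->.
Qed.

Section prepend_block.
Variables (a m : int) (V Vb : int -> O -> R) (Z : int -> O -> T).
Hypothesis am : (a < m)%R.
Hypothesis m0 : (m <= 0)%R.
Hypothesis inV : innovated m V.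
Hypothesis Za : Z a = cst point.
Hypothesis blk : block P F X K a Z Vb.

Definition prepend (p : int) := if (m < p)%R then V p else Vb p.

Lemma prepend_ge (p : int) : (m < p)%R -> prepend p = V p.
Proof. by rewrite /prepend => ->. Qed.

Lemma prepend_le (p : int) : (p <= m)%R -> prepend p = Vb p.
Proof. by rewrite /prepend ltNge => ->. Qed.

(** The block starts from a constant and [g] does not look at [X], so the restarted chain is a
    function of the noise since [a] alone. *)
Lemma prepend_adapted (n : int) : (a <= n)%R -> (n <= m)%R -> adapted (noise prepend a n) (Z n).
Proof.
move=> an; have <- : (a + `|n - a|%N%:Z = n)%R by rewrite gez0_abs ?subr_ge0// [LHS]addrC subrK.
elim: (`|n - a|%N) => [|i IH] aim.
  by rewrite addr0 Za; exact: (adapted_cst (noise_sigma _ _ _)).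
have ni : (a + i.+1%:Z = a + i%:Z + 1 :> int)%R by rewrite -addn1 PoszD addrA.
rewrite ni in aim *; set p := (a + i%:Z)%R in IH aim *.
have pm : (p < m)%R by rewrite -lezD1.
have ap : (a <= p)%R by rewrite /p lerDl.
have [_ [_ _ [g [rho [mg _ -> _]]] _ _]] := blk ap (lt_le_trans pm m0).
have aZ : adapted (noise prepend a (p + 1)%R) (Z p).
  have NN : noise prepend a p `<=` noise prepend a (p + 1)%R by apply: noise_le => //; rewrite lerDl.
  by move=> B mB; apply: NN; exact: (IH (ltW pm)).
have aV : adapted (noise prepend a (p + 1)%R) (Vb (p + 1)%R).
  by rewrite -(prepend_le aim); apply: noise_adapted => //; rewrite (le_lt_trans ap)// ltrDl.
exact: (adapted_comp (adapted_pair (noise_sigma _ _ _) aZ aV) mg).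
Qed.

Lemma prepend_innovated : innovated a prepend.
Proof.
have [inn rec] := inV; split.
- move=> p ap p0; have [mp|pm] := ltP m p.
    by rewrite /innovation prepend_ge//; exact: inn.
  have p1 : (p - 1 < 0)%R by rewrite (lt_le_trans _ p0)// ltrBlDr ltrDl.
  have ap1 : (a <= p - 1)%R by rewrite -ltzD1 subrK.
  have [_ []] := blk ap1 p1; rewrite subrK => aV VI _ _ _.
  by rewrite /innovation prepend_le//; split.
- move=> n an n0; have [nm|mn] := ltP n m.
    have [_ [_ _ [g [rho [_ mrho _ rhoE]]] _ _]] := blk an n0.
    have nm1 : (n + 1 <= m)%R by rewrite lezD1.
    by exists (Z n), rho; rewrite prepend_le//; split => //; exact: (prepend_adapted an (ltW nm)).
  have [Z0 [rho [aZ mrho rhoE]]] := rec n mn n0.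
  have mn1 : (m < n + 1)%R by rewrite (le_lt_trans mn)// ltrDl.
  exists Z0, rho; rewrite prepend_ge//; split => // B mB.
  have NN : noise V m n `<=` noise prepend a n.
    by apply: noise_le => //; [exact: prepend_ge|exact: ltW].
  by apply: NN; exact: aZ.
Qed.

End prepend_block.

(* [X (m + i)] is a function of [X m] and of the noise after [m]; replace [X m] by [Z m]. *)
Lemma noise_cvg (m : int) V (i : nat) (Z : nat -> int -> O -> T) Vb :
  innovated m V -> (m + i%:Z <= 0)%R ->
  (forall j, Z j (m - j%:Z - 1)%R = cst point) ->
  (forall j, block P F X K (m - j%:Z - 1)%R (Z j) (Vb j)) ->
  forall B, measurable B -> exists E : nat -> set O,
  [/\ forall j, noise (prepend m V (Vb j)) (m - j%:Z - 1)%R (m + i%:Z)%R (E j),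
      vanishing (fun j => pr P (X (m + i%:Z)%R @^-1` B `\` E j)) &
      forall j, pr P (E j `\` X (m + i%:Z)%R @^-1` B) = pr P (X (m + i%:Z)%R @^-1` B `\` E j)].
Proof.
move=> inV mi Za blk B mB.
have m0 : (m <= 0)%R by apply: le_trans mi; rewrite lerDl.
have am j : (m - j%:Z - 1 < m)%R by rewrite -addrA -opprD ltrBlDr ltrDl.
have [psi [mpsi psiE]] := innovated_fun inV mi.
set n := (m + i%:Z)%R in mi psi mpsi psiE *.
have mn : (m <= n)%R by rewrite /n lerDl.
pose S := g_sigma_algebraType (noise_gens V m n).
have inn (p : int) : (m < p)%R -> (p <= n)%R -> innovation V p.
  by move=> mp pn; apply: inV.1 => //; exact: le_trans mi.
have NF : noise V m n `<=` F n by exact: noise_filt.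
have mid : @measurable_fun _ _ O S setT id.
  by move=> _ A NA; rewrite setTI preimage_id; apply: (driven_meas dr mi); exact: NF.
have aZ j : adapted (noise (prepend m V (Vb j)) (m - j%:Z - 1)%R m) (Z j m).
  exact: (prepend_adapted m0 (Za j) (blk j) (ltW (am j)) (lexx m)).
have aZF j := block_adapted dr (blk j) (am j) m0.
have mZ j := adapted_measurable (driven_meas dr m0) (aZF j).
have mXm := mX m0.
have mXS : measurable_fun setT (fun w => (X m w, w : S)) by exact: measurable_fun_pair.
have mZS j : measurable_fun setT (fun w => (Z j m w, w : S)) by exact: measurable_fun_pair.
have ZX j A : measurable A -> P (Z j m @^-1` A) = P (X m @^-1` A).
  exact: (block_law dr (blk j) (am j) m0).
have rectX (Y : O -> T) A D : adapted (F m) Y -> measurable A -> noise V m n D ->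
    P ((fun w => (Y w, w : S)) @^-1` (A `*` D)) = P (Y @^-1` A) * P D.
  move=> aY mA ND; rewrite -(noise_indep mi inn (aY A mA) ND).
  by congr (P _); apply/seteqP; split => w [].
(* [X m] and [Z j m] have the same law and both belong to [F m], which is independent of the noise
   after [m]; exchanging them preserves the joint law with that noise. *)
have lawXZ j W : measurable W -> P ((fun w => (Z j m w, w : S)) @^-1` W) = P ((fun w => (X m w, w : S)) @^-1` W).
  move=> mW; apply: (@prob_eq_rect R _ _ T S (law P (mZS j)) (law P mXS)) mW => A D mA mD.
  apply: etrans (rectX _ _ _ (aZF j) mA mD) _.
  apply: etrans _ (esym (rectX _ _ _ (driven_X dr m0) mA mD)).
  by congr (_ * _); exact: ZX.
have cvR : forall W, measurable W -> vanishing (fun j =>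
    pr P ((fun w => (X m w, w : S)) @^-1` W `\` (fun w => (Z j m w, w : S)) @^-1` W)).
  apply: (preimage_cvg mXS mZS lawXZ (@measurable_prod_measurableType _ _ T S)).
  move=> _ [A mA [D mD <-]] e e0.
  have [N NP] := block_cvg dr m0 (mix m0) blk mA e0; exists N => j /NP; apply: le_trans.
  have mXA := preim_measurable mXm mA; have mZA := preim_measurable (mZ j) mA.
  have mAD : measurable (A `*` (D : set S)) by exact: measurableX.
  apply: pr_le.
  - by apply: measurableD; [exact: (preim_measurable mXS mAD)|exact: (preim_measurable (mZS j) mAD)].
  - exact: measurableD.
  - by move=> w [[/= Aw Dw] nZ]; split => // Az; apply: nZ.
have mW := preim_measurable mpsi mB.
exists (fun j => (fun w => (Z j m w, w : S)) @^-1` (psi @^-1` B)).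
have aeX : {ae P, forall w, B (X n w) <-> (fun w => (X m w, w : S)) w \in psi @^-1` B}.
  by apply: filterS psiE => w ->; rewrite inE.
have mXB := preim_measurable (mX mi) mB.
have mXW := preim_measurable mXS mW; have mZW j := preim_measurable (mZS j) mW.
have e1 j : pr P (X n @^-1` B `\` (fun w => (Z j m w, w : S)) @^-1` (psi @^-1` B)) =
    pr P ((fun w => (X m w, w : S)) @^-1` (psi @^-1` B) `\` (fun w => (Z j m w, w : S)) @^-1` (psi @^-1` B)).
  rewrite /pr; congr fine; apply: eq_prob_ae; [exact: measurableD|exact: measurableD|].
  apply: filterS aeX => w; rewrite inE => h; split => -[h1 h2]; split => //; exact/h.
have e2 j : pr P ((fun w => (Z j m w, w : S)) @^-1` (psi @^-1` B) `\` X n @^-1` B) =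
    pr P ((fun w => (Z j m w, w : S)) @^-1` (psi @^-1` B) `\` (fun w => (X m w, w : S)) @^-1` (psi @^-1` B)).
  rewrite /pr; congr fine; apply: eq_prob_ae; [exact: measurableD|exact: measurableD|].
  apply: filterS aeX => w; rewrite inE => h; split => -[h1 h2]; split => // h3; apply: h2; exact/h.
split.
- move=> j; have sN := noise_sigma (prepend m V (Vb j)) (m - j%:Z - 1)%R n.
  have aZn : adapted (noise (prepend m V (Vb j)) (m - j%:Z - 1)%R n) (Z j m).
    have NN : noise (prepend m V (Vb j)) (m - j%:Z - 1)%R m `<=`
        noise (prepend m V (Vb j)) (m - j%:Z - 1)%R n by exact: noise_le.
    by move=> A mA; apply: NN; exact: aZ.
  have aid : @adapted _ _ S (noise (prepend m V (Vb j)) (m - j%:Z - 1)%R n) id.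
    move=> A NA; have NN : noise V m n `<=` noise (prepend m V (Vb j)) (m - j%:Z - 1)%R n.
      by apply: noise_le => //; [move=> p; exact: prepend_ge|exact: ltW].
    by apply: NN; exact: NA.
  exact: (adapted_pair sN aZn aid mW).
- move=> e e0; have [N NP] := cvR _ mW _ e0; exists N => j /NP; by rewrite e1.
- by move=> j; rewrite e1 e2; exact: (pr_sym_diff mXS mZS lawXZ j mW).
Qed.

(** Stage [i] holds innovations after a time [m] and puts a block before them. At that stage only
    finitely many times between [m] and 0 and finitely many [l] up to [i] matter, so one block
    length approximates all these events within [1/(i+1)]. Later stages keep the innovations already
    fixed; a given event is thus approximated ever better by one and the same sequence, and
    [approximable_event] concludes. *)
Lemma innovations_exist (B : nat -> set T) : (forall l, measurable (B l)) ->
  exists V : int -> O -> R, (forall n : int, (n <= 0)%R -> innovation V n) /\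
    forall (n : int) l, (n <= 0)%R ->
      exists E, natfilt V n E /\ {ae P, forall w, B l (X n w) <-> E w}.
Proof.
move=> mB.
pose Iv (i : nat) (s : int * (int -> O -> R)) := (s.1 <= - i%:Z)%R /\ innovated s.1 s.2.
pose close (W E : set O) i := ((pr P (W `\` E) <= i.+1%:R^-1)%R /\ (pr P (E `\` W) <= i.+1%:R^-1)%R).
pose Rl (i : nat) (s s' : int * (int -> O -> R)) := [/\ (s'.1 < s.1)%R,
  forall p : int, (s.1 < p)%R -> s'.2 p = s.2 p &
  forall l q : nat, (l <= i)%N -> (s.1 + q%:Z <= 0)%R ->
    exists E, noise s'.2 s'.1 (s.1 + q%:Z)%R E /\ close (X (s.1 + q%:Z)%R @^-1` B l) E i].
(* Starting from time 0 no innovation is required yet, so any [V] will do. *)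
have [||s [_ sP]] := @dep_choice _ Iv Rl (0%R, fun _ _ => 0%R).
- split; first by rewrite oppr0.
  by split => p /=; [move=> h1 h2|move=> h1 h2]; move: (lt_le_trans h1 h2) || move: (le_lt_trans h1 h2);
    rewrite ltxx.
- move=> i [m V] [/= mi inV]; have m0 : (m <= 0)%R by rewrite (le_trans mi)// oppr_le0.
  have am (j : nat) : (m - j%:Z - 1 < m)%R by rewrite -addrA -opprD ltrBlDr ltrDl.
  have H j : exists ZV : (int -> O -> T) * (int -> O -> R),
      ZV.1 (m - j%:Z - 1)%R = cst point /\ block P F X K (m - j%:Z - 1)%R ZV.1 ZV.2.
    have [Z [V' [Za blk]]] := block_process dr coupled (lt_le_trans (am j) m0).
    by exists (Z, V').
  have [ZV ZVP] := choice H.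
  have Za j : (ZV j).1 (m - j%:Z - 1)%R = cst point by have [] := ZVP j.
  have blk j : block P F X K (m - j%:Z - 1)%R (ZV j).1 (ZV j).2 by have [] := ZVP j.
  pose Q (q l N : nat) := (m + q%:Z <= 0)%R -> forall j, (N <= j)%N ->
    exists E, noise (prepend m V (ZV j).2) (m - j%:Z - 1)%R (m + q%:Z)%R E /\
      close (X (m + q%:Z)%R @^-1` B l) E i.
  have Qmono q l N N' : Q q l N -> (N <= N')%N -> Q q l N'.
    by move=> QN NN' mq j Nj; apply: QN => //; exact: leq_trans Nj.
  have Qex q l : exists N, Q q l N.
    have [mq|mq] := leP (m + q%:Z)%R 0%R; last first.
      by exists 0%N; rewrite /Q leNgt mq.
    have [E [NE van sym]] := noise_cvg inV mq Za blk (mB l).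
    have i0 : (0 < i.+1%:R^-1 :> R)%R by rewrite invr_gt0.
    have [N NP] := van _ i0; exists N => _ j Nj; exists (E j); split; first exact: NE.
    by split; [exact: NP|rewrite sym; exact: NP].
  have Q1 q : exists N, forall l, (l < i.+1)%N -> Q q l N.
    by apply: bounded_uniform; [exact: Qmono|exact: Qex].
  have [N NP] : exists N, forall q, (q < `|m|%N.+1)%N -> forall l, (l < i.+1)%N -> Q q l N.
    apply: (bounded_uniform (Q := fun q N => forall l, (l < i.+1)%N -> Q q l N)) => //.
    by move=> q N N' QN NN' l li; apply: Qmono NN'; exact: QN.
  exists ((m - N%:Z - 1)%R, prepend m V (ZV N).2); split; split => /=.
  + by have N0 : (0 <= N%:Z :> int)%R by []; rewrite intS; move: mi N0; lra.
  + exact: (prepend_innovated (am N) m0 inV (Za N) (blk N)).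
  + exact: am.
  + by move=> p; exact: prepend_ge.
  + move=> l q li mq; apply: (NP q _ l) => //.
    by rewrite ltnS -lez_nat lez0_abs// -lerBrDl sub0r in mq *.
have I1 i : ((s i).1 <= - i%:Z)%R by have [[]] := sP i.
have stab i k : ((s (i + k)%N).1 <= (s i).1)%R /\
    forall p : int, ((s i).1 < p)%R -> (s (i + k)%N).2 p = (s i).2 p.
  elim: k => [|k [IH1 IH2]]; first by rewrite addn0.
  rewrite addnS; have [_ [lt eqV _]] := sP (i + k)%N; split.
    exact: le_trans (ltW lt) IH1.
  by move=> p ip; rewrite eqV ?IH2//; exact: le_lt_trans ip.
(* The first time of stage [|p| + 1] is at most [-|p| - 1], hence before [p], so the innovation at
   [p] is already final there. *)
pose V (p : int) := (s `|p|%N.+1).2 p.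
have Vlow (p : int) : (p <= 0)%R -> ((s `|p|%N.+1).1 < p)%R.
  move=> p0; apply: le_lt_trans (I1 _) _.
  have {2}-> : p = (- `|p|%N%:Z)%R by rewrite lez0_abs ?opprK.
  by rewrite ltrN2 ltz_nat.
have VE i (p : int) : (p <= 0)%R -> ((s i).1 < p)%R -> (s i).2 p = V p.
  move=> p0 ip; rewrite /V; have [ik|ki] := leqP i `|p|%N.+1.
    by rewrite -(subnKC ik); have [_ ->] := stab i (`|p|%N.+1 - i)%N.
  by rewrite -(subnKC (ltnW ki)); have [_ ->//] := stab `|p|%N.+1 (i - `|p|%N.+1)%N; exact: Vlow.
have inV (n : int) : (n <= 0)%R -> innovation V n.
  by move=> n0; have [[_ [inn _]] _] := sP `|n|%N.+1; exact: (inn n (Vlow n n0) n0).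
exists V; split => // n l n0.
have mV (p : int) : (p <= 0)%R -> measurable_fun setT (V p).
  by move=> p0; have [aV _] := inV p p0; exact: (adapted_measurable (driven_meas dr p0) aV).
have sN := natfilt_sigma V n.
have Nm := natfilt_measurable mV n0.
apply: (approximable_event sN Nm); first exact: preim_measurable (mX n0) (mB l).
move=> e e0; have [i0 _ /(_ i0 (leqnn i0))/= i0e] := near_infty_natSinv_lt (PosNum e0).
pose i := maxn i0 (maxn l `|n|%N).
have i0i : (i0 <= i)%N by rewrite leq_maxl.
have li : (l <= i)%N by rewrite /i (leq_trans (leq_maxl l `|n|%N))// leq_maxr.
have ni : (`|n| <= i)%N by rewrite /i (leq_trans (leq_maxr l `|n|%N))// leq_maxr.
have ie : (i.+1%:R^-1 <= e)%R.
  apply: le_trans (ltW i0e); rewrite lef_pV2 ?posrE ?ltr0n// ler_nat ltnS; exact: i0i.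
have sn : ((s i).1 <= n)%R.
  apply: le_trans (I1 i) _; rewrite lerNl -lez0_abs// lez_nat; exact: ni.
have nq : ((s i).1 + `|n - (s i).1|%N%:Z = n)%R.
  by rewrite gez0_abs ?subr_ge0// [LHS]addrC subrK.
have [_ [_ _ /(_ l `|n - (s i).1|%N li)]] := sP i; rewrite nq => /(_ n0)[E [NE [c1 c2]]].
exists E; split; [|exact: le_trans c1 ie|exact: le_trans c2 ie].
move: E NE {c1 c2}; apply: sub_sigma_algebra2 => _ [p [sp pn [C mC ->]]].
exists p; split => //; exists C => //.
by rewrite (VE i.+1)//; exact: le_trans n0.
Qed.

End innovations.

Section innovation_sequence.
Context {R : realType} dO (O : measurableType dO) (P : probability O R)
  (F : int -> set (set O)) (V : int -> O -> R).
Hypothesis sF : forall n, sigma_algebra setT (F n).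
Hypothesis Fle : forall n p : int, (n <= p)%R -> F n `<=` F p.
Hypothesis inV : forall n : int, (n <= 0)%R -> innovation P F V n.

Lemma natfilt_innovations (n : int) : (n <= 0)%R -> natfilt V n `<=` F n.
Proof.
move=> n0; apply: smallest_sub; first exact: sF.
move=> _ [m [mn [B mB ->]]]; have [aV _] := inV (le_trans mn n0).
by apply: (Fle mn); exact: aV.
Qed.

(** With the times sorted in decreasing order, the head is the latest one and the others are at most
    [n - 1]: their events lie in [F (n - 1)], from which [V n] is independent. *)
Lemma innovations_independent : mutually_independent P V.
Proof.
move=> s B us s0 mB.
have PV (n : int) : (n <= 0)%R -> P (V n @^-1` B n) = lam (B n).
  move=> n0; have [_ VI] := inV n0; have := VI _ _ (filtT (sF _)) (mB n).
  by rewrite setTI probability_setT mul1e.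
have ps := permEl (perm_sort (fun x y : int => (y <= x)%R) s).
have -> : \bigcap_(n in [set` s]) V n @^-1` B n =
    \bigcap_(n in [set` sort (fun x y : int => (y <= x)%R) s]) V n @^-1` B n.
  by apply/seteqP; split => w h n /= ns; apply: h => /=; rewrite ?mem_sort// -(mem_sort (fun x y : int => (y <= x)%R)).
rewrite -(perm_big _ ps)/=.
have : sorted (fun x y : int => (y <= x)%R) (sort (fun x y : int => (y <= x)%R) s).
  by apply: sort_sorted => x y; exact: le_total.
have : uniq (sort (fun x y : int => (y <= x)%R) s) by rewrite sort_uniq.
have : forall n, n \in sort (fun x y : int => (y <= x)%R) s -> (n <= 0)%R.
  by move=> n; rewrite mem_sort; exact: s0.
elim: (sort _ _) => [|n t IH] t0.
  by move=> _ _; rewrite big_nil -[RHS](probability_setT P); congr (P _); apply/seteqP; split.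
rewrite cons_uniq => /andP[nt ut] pt.
have trans : transitive (fun x y : int => (y <= x)%R) by move=> x y z xy yz; exact: le_trans yz xy.
have tn p : p \in t -> (p <= n - 1)%R.
  move=> pt'; have /allP/(_ p pt') pn := order_path_min trans pt.
  rewrite -ltzD1 subrK lt_neqAle pn andbT; by apply/eqP => e; move: nt; rewrite -e pt'.
have n0 : (n <= 0)%R by apply: t0; rewrite mem_head.
have n1 : (n - 1 <= n)%R by rewrite lerBlDr lerDl.
have t0' p : p \in t -> (p <= 0)%R by move=> pt'; apply: t0; rewrite inE pt' orbT.
have -> : \bigcap_(p in [set` n :: t]) V p @^-1` B p =
    (\bigcap_(p in [set` t]) V p @^-1` B p) `&` V n @^-1` B n.
  apply/seteqP; split => w.
    by move=> h; split => [p /= pt'|]; apply: h => /=; rewrite inE ?pt' ?orbT// eqxx.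
  by move=> [h1 h2] p /=; rewrite inE => /orP[/eqP ->//|pt']; exact: h1.
have [_ VI] := inV n0; rewrite VI//; last first.
  have := @fin_bigcap_measurable _ (g_sigma_algebraType (F (n - 1)%R)) _ [set` t]
    (fun p => V p @^-1` B p) (finite_seq t).
  rewrite (measurable_gE (sF _)); apply => p /= pt'.
  have [aV _] := inV (t0' p pt'); by apply: (Fle (tn p pt')); exact: aV.
rewrite big_cons muleC PV//; congr (_ * _); apply: IH => //.
exact: path_sorted pt.
Qed.

End innovation_sequence.

(** * From a trivial tail to standardness *)

Section kolmogorovian_standard.
Context {R : realType} {dd : dimension} dO (O : measurableType dO) (P : probability O R)
  (X : int -> O -> Rd R dd) (K : int -> R.-pker (Rd R dd) ~> (Rd R dd)).
Notation T := (Rd R dd).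
Hypothesis XK : markov_with P X K.
Hypothesis mono : monotonic P X K.

Let mX (n : int) : (n <= 0)%R -> measurable_fun setT (X n).
Proof. by case: XK => + _; apply. Qed.

Let P' := pprod P lam.
Let X' (n : int) (w : O * R) := X n w.1.

(** [X'] is a function of the innovations only almost surely, so the copy required by [standard] is
    the adapted version [Y]. It inherits the Markov property with respect to the larger filtration
    [F], hence has it with respect to the innovations, and [markov_immersed] applies. *)
Lemma kolmogorovian_standard : kolmogorovian P (natfilt X) -> standard P X.
Proof.
move=> kol; have [F [eta [dr FE]]] := driven_extension XK.
have mix (n : int) : (n <= 0)%R -> mixing P' X' n.
  move=> n0; apply: (mixing_extension XK n0).
  exact: (markov_mixing XK n0 (kolmogorovian_tail_indep XK n0 kol)).
have [en en_surj] := @enum_coord dd.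
pose B l : set T := if en l is Some (k, q) then [set x : T | (ratr q < x k)%R] else setT.
have mB l : measurable (B l).
  by rewrite /B; case: (en l) => [[k q]|] //; exact: measurable_coord_gt.
have [V [inV appr]] := innovations_exist dr (coupled_extension XK mono) mix mB.
have mV (n : int) : (n <= 0)%R -> measurable_fun setT (V n).
  by move=> n0; have [aV _] := inV n n0; exact: (adapted_measurable (driven_meas dr n0) aV).
have mX' (n : int) : (n <= 0)%R -> measurable_fun setT (X' n).
  by move=> n0; exact: (measurableT_comp (mX n0) (@measurable_fst _ _ O R)).
have H (n : int) : exists Y : O * R -> T, (n <= 0)%R ->
    adapted (natfilt V n) Y /\ {ae P', forall w, X' n w = Y w}.
  have [n0|n0] := leP n 0%R; last by exists (X' n).
  have HE l : exists E, natfilt V n E /\ {ae P', forall w, B l (X' n w) <-> E w} by exact: appr.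
  have [E EP] := choice HE.
  have [|||||Y aY YE] := @adapted_version R _ _ P' _ T (natfilt V n) (X' n) setT B E
    (natfilt_sigma V n) (natfilt_measurable mV n0) (@Rd_standard R dd) (mX' n n0) measurableT.
  - by rewrite preimage_setT probability_setT.
  - exact: mB.
  - by move=> l; have [] := EP l.
  - by move=> l; have [] := EP l.
  - move=> x y _ _ Bxy; apply/funext => k; apply: eq_ratr_lt => q.
    by have [i iP] := en_surj (k, q); have := Bxy i; rewrite /B iP.
  by exists Y => _.
have [Y YP] := choice H.
have aY (n : int) : (n <= 0)%R -> adapted (natfilt V n) (Y n) by move=> n0; have [] := YP n n0.
have YE (n : int) : (n <= 0)%R -> {ae P', forall w, X' n w = Y n w}.
  by move=> n0; have [] := YP n n0.
have mY (n : int) : (n <= 0)%R -> measurable_fun setT (Y n).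
  by move=> n0; exact: (adapted_measurable (natfilt_measurable mV n0) (aY n n0)).
have NF (n : int) : (n <= 0)%R -> natfilt V n `<=` F n.
  exact: (natfilt_innovations (driven_sigma dr) (driven_le dr) inV).
exists _, (O * R)%type, P', Y, V; split => //.
- move=> s C s0 mC.
  have cX : cylinder X 0%R (\bigcap_(n in [set` s]) X n @^-1` C n) by exists s, C.
  have cX' : cylinder X' 0%R (\bigcap_(n in [set` s]) X' n @^-1` C n) by exists s, C.
  have cY : cylinder Y 0%R (\bigcap_(n in [set` s]) Y n @^-1` C n) by exists s, C.
  rewrite -(pprod_fst P (cylinder_measurable mX (lexx 0%R) cX)).
  transitivity (P' (\bigcap_(n in [set` s]) X' n @^-1` C n)).
    by congr (P' _); apply/seteqP; split.
  apply: eq_prob_ae; [exact: (cylinder_measurable mX' (lexx 0%R) cX')|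
    exact: (cylinder_measurable mY (lexx 0%R) cY)|].
  have : {ae P', forall w, forall k : nat, X' (- k%:Z)%R w = Y (- k%:Z)%R w}.
    by apply: ae_foralln => k; apply: YE; rewrite oppr_le0.
  apply: filterS => w XY; have {}XY (n : int) : n \in s -> X' n w = Y n w.
    move=> /s0 n0; have -> : n = (- `|n|%N%:Z)%R by rewrite lez0_abs ?opprK.
    exact: XY.
  by split => h n /= ns; have := h n ns; rewrite /= XY.
- exact: (innovations_independent (driven_sigma dr) (driven_le dr) inV).
- apply: (markov_immersed (K := K)) => //.
  + by move=> n _; exact: natfilt_sigma.
  + by move=> n n0; exact: natfilt_measurable.
  + move=> n n0; apply: smallest_sub; first exact: natfilt_sigma.
    move=> _ [m [mn [C mC ->]]]; apply: (natfilt_le mn).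
    by apply: aY => //; exact: le_trans n0.
  + move=> n E C n0 NE mC; have n10 : (n + 1 <= 0)%R by rewrite lezD1.
    have FnE := NF n (ltW n0) E NE; have mE := driven_meas dr (ltW n0) FnE.
    have mKY (Z : O * R -> T) : measurable_fun setT Z -> measurable_fun setT (fun w => K n (Z w) C).
      by move=> mZ; exact: (measurableT_comp (measurable_kernel (K n) _ mC) mZ).
    transitivity (P' (E `&` X' (n + 1)%R @^-1` C)).
      apply: eq_prob_ae.
      * by apply: measurableI => //; exact: preim_measurable (mY _ n10) mC.
      * by apply: measurableI => //; exact: preim_measurable (mX' _ n10) mC.
      * by apply: filterS (YE _ n10) => w XY; split => -[h1 h2]; split => //=; [rewrite XY|rewrite -XY].
    rewrite (driven_markov dr n0 FnE mC).
    apply: ge0_ae_eq_integral => //.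
    * exact: (measurable_funTS (mKY _ (mX' _ (ltW n0)))).
    * exact: (measurable_funTS (mKY _ (mY _ (ltW n0)))).
    * by apply: filterS (YE _ (ltW n0)) => w /= h _; rewrite -h.
Qed.

End kolmogorovian_standard.

Local Open Scope ring_scope.

Theorem theorem4p8 (R : realType) (d : dimension) (dO : measure_display)
  (O : measurableType dO) (P : probability O R)
  (X : int -> O -> Rd R d) (K : int -> R.-pker (Rd R d) ~> (Rd R d)) :
  d <> dfin 0 ->
  markov_with P X K ->
  strongly_monotonic P X K ->
  identifiable P X K ->
  (kolmogorovian P (natfilt X) <->
     (forall n : int, n <= 0 -> cond_law_is_law P (tailf (natfilt X)) (X n)))
  /\ (kolmogorovian P (natfilt X) <-> standard P X)
  /\ (kolmogorovian P (natfilt X) <->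
        cond_law_is_law P (tailf (natfilt X)) (X 0)).
Proof.
move=> _ XK [mono _ _] ident.
have kol_law : kolmogorovian P (natfilt X) ->
    forall n : int, (n <= 0)%R -> cond_law_is_law P (tailf (natfilt X)) (X n).
  move=> kol n n0; apply: (tail_indep_cond_law XK n0).
  exact: (kolmogorovian_tail_indep XK n0 kol).
have law0_kol : cond_law_is_law P (tailf (natfilt X)) (X 0%R) -> kolmogorovian P (natfilt X).
  move=> law0; apply: (tail_indep_kolmogorovian XK).
  apply: (tail_indep_all XK mono ident).
  exact: (cond_law_tail_indep XK (lexx 0%R) law0).
split; [|split]; split.
- exact: kol_law.
- by move=> H; apply: law0_kol; exact: H.
- exact: (kolmogorovian_standard XK mono).
- exact: (standard_kolmogorovian XK.1).
- by move=> kol; exact: kol_law.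
- exact: law0_kol.
Qed.
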